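(* Let $1\le\nu\le n$ and let $\boldsymbol{F}$ be a $C^{r}$ map from $\mathbb{R}^{n}$ to $\mathbb{R}^{n}$ with $\boldsymbol{F}(\boldsymbol{0})=\boldsymbol{0}$ whose Jacobian $\boldsymbol{A}=D\boldsymbol{F}(\boldsymbol{0})$ is semisimple, with eigenvalues $\mu_{1},\ldots,\mu_{n}$ (counted with multiplicity) and corresponding left eigenvectors $\boldsymbol{v}_{1}^{\star},\ldots,\boldsymbol{v}_{n}^{\star}$ forming a basis. Let $E^{\star}=\mathrm{span}\{\boldsymbol{v}_{1}^{\star},\ldots,\boldsymbol{v}_{\nu}^{\star}\}$, assumed closed under complex conjugation, and let $$\beth_{E^{\star}}=\frac{\min_{k=1\ldots\nu}\log|\mu_{k}|}{\max_{k=1\ldots n}\log|\mu_{k}|}.$$ Assume that $\max_{k=1\ldots n}|\mu_{k}|<1$ and that there exists an integer $\sigma$ with $2\le\sigma\le r$ such that $\beth_{E^{\star}}<\sigma$. Further assume that $$\prod_{k=1}^{n}\mu_{k}^{m_{k}}\neq\mu_{j},\qquad j=1,\ldots,\nu,$$ for all integers $m_{k}\ge0$, $1\le k\le n$, with at least one $m_{l}\neq0$ for some $\nu+1\le l\le n$ and with $2\le\sum_{k=1}^{n}m_{k}\le\sigma-1$. Then the following are true. 1. In a sufficiently small neighbourhood of the origin there exists an invariant foliation $\mathcal{F}$ of $\boldsymbol{F}$ tangent to $E^{\star}$. The foliation $\mathcal{F}$ is unique (in a sufficiently small neighbourhood of the origin) among the $\sigma$-times differentiable invariant foliations tangent to $E^{\star}$,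 and it is also $C^{r}$ smooth. 2. The conjugate dynamics of $\mathcal{F}$, that is, the map $\boldsymbol{S}$ in the invariance equation $\boldsymbol{U}(\boldsymbol{F}(\boldsymbol{x}))=\boldsymbol{S}(\boldsymbol{U}(\boldsymbol{x}))$, can be represented by a polynomial of order $\sigma-1$ (i.e. $\mathcal{F}$ can be represented by a submersion $\boldsymbol{U}$ for which $\boldsymbol{S}$ is a polynomial map of degree at most $\sigma-1$). In its simplest form, written in eigen-coordinates $z_{1},\ldots,z_{\nu}$ in which $D\boldsymbol{S}(\boldsymbol{0})=\mathrm{diag}(\mu_{1},\ldots,\mu_{\nu})$, the only nonlinear terms that $\boldsymbol{S}$ has to include are the monomials $\prod_{k=1}^{\nu}z_{k}^{m_{k}}$ in component $j$ for which $$\prod_{k=1}^{\nu}\mu_{k}^{m_{k}}=\mu_{j},\qquad j\in\{1,\ldots,\nu\},\qquad 2\le\sum_{k=1}^{\nu}m_{k}\le\sigma-1,$$ where $m_k\ge 0$ are integers; that is, $\boldsymbol{U}$ and the polynomial $\boldsymbol{S}$ can be chosen so that all other nonlinear coefficients of $\boldsymbol{S}$ vanish.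
   Context: Convention: $\log 0=-\infty$, so $\beth_{E^{\star}}<\sigma$ entails $\mu_{k}\ne0$ for $k=1,\ldots,\nu$. Left eigenvectors are row vectors with $\boldsymbol{v}_{i}^{\star}\boldsymbol{A}=\mu_{i}\boldsymbol{v}_{i}^{\star}$. The $\mu_k$ and $\boldsymbol v_k^\star$ may be complex, non-real ones occurring in conjugate pairs. All notions are local near the origin. A codimension-$\nu$ foliation near the origin is represented by a submersion $\boldsymbol{U}$ from a neighbourhood of $\boldsymbol{0}\in\mathbb{R}^{n}$ to $\mathbb{R}^{\nu}$; its leaves are $\mathcal{L}_{\boldsymbol{z}}=\{\boldsymbol{x}:\boldsymbol{U}(\boldsymbol{x})=\boldsymbol{z}\}$ and $\mathcal{F}=\{\mathcal{L}_{\boldsymbol{z}}\}$. The foliation is $k$-times differentiable (respectively $C^{k}$) if it can be represented by a submersion $\boldsymbol{U}$ that is $k$-times differentiable (respectively $C^{k}$). The foliation is invariant under $\boldsymbol{F}$ if there is a map $\boldsymbol{S}$ from a neighbourhood of $\boldsymbol{0}\in\mathbb{R}^{\nu}$ to $\mathbb{R}^{\nu}$ (the conjugate dynamics) such that $\boldsymbol{F}(\mathcal{L}_{\boldsymbol{z}})\subset\mathcal{L}_{\boldsymbol{S}(\boldsymbol{z})}$, equivalently $\boldsymbol{U}(\boldsymbol{F}(\boldsymbol{x}))=\boldsymbol{S}(\boldsymbol{U}(\boldsymbol{x}))$ (the invariance equation) for all $\boldsymbol{x}$ in a neighbourhood of the origin. It is tangent to $E^{\star}$ if $\boldsymbol{U}(\boldsymbol{0})=\boldsymbol{0}$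 and the $\nu$ rows of $D\boldsymbol{U}(\boldsymbol{0})$ are linearly independent and span $E^{\star}$ (over $\mathbb{C}$ if $E^{\star}$ is regarded as a complex space). Two submersions $\boldsymbol{U}$ and $\hat{\boldsymbol{U}}$ represent the same foliation if $\hat{\boldsymbol{U}}=\boldsymbol{\Phi}\circ\boldsymbol{U}$ near the origin for a local diffeomorphism $\boldsymbol{\Phi}$ of $\mathbb{R}^{\nu}$ fixing $\boldsymbol{0}$; uniqueness of the foliation is understood in this sense (the pair $\boldsymbol{U},\boldsymbol{S}$ itself is not unique). Eigen-coordinates $z_{1},\ldots,z_{\nu}$ on the parameter space are obtained by a linear change of variables; they are complex when eigenvalues are complex, with $z_{k}=\overline{z}_{k+1}$ for a conjugate pair $\mu_{k}=\overline{\mu}_{k+1}$ and $z_{k}$ real when $\mu_{k}$ is real. *)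

(* Defs.v *)
From HB Require Import structures.
From mathcomp Require Import all_boot all_order all_algebra.
From mathcomp Require Import all_classical all_reals all_analysis.
From mathcomp Require Import complex.
From mathcomp Require mpoly.
Import (canonicals, coercions) mpoly.

Set Implicit Arguments.
Unset Strict Implicit.
Unset Printing Implicit Defensive.

Import Order.TTheory GRing.Theory Num.Theory.
Import numFieldNormedType.Exports.

Local Open Scope classical_set_scope.
Local Open Scope ring_scope.

(** * Differentiability classes

    Both notions below are meant for an open set [A].  Quantifying over all
    directional derivatives of a differentiable map amounts to considering the
    derivative as a map with values in the linear maps. *)

Fixpoint times_differentiable (R : realType) (n m k : nat)
    (A : set 'rV[R]_n) (f : 'rV[R]_n -> 'rV[R]_m) : Prop :=
  if k is k'.+1 then
    (forall x, A x -> differentiable f x) /\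
    (forall v : 'rV[R]_n, times_differentiable k' A (fun x => 'D_v f x))
  else True.

Fixpoint class_C (R : realType) (n m k : nat)
    (A : set 'rV[R]_n) (f : 'rV[R]_n -> 'rV[R]_m) : Prop :=
  if k is k'.+1 then
    (forall x, A x -> differentiable f x) /\
    (forall v : 'rV[R]_n, class_C k' A (fun x => 'D_v f x))
  else forall x, A x -> {for x, continuous f}.

Definition times_differentiable_near0 (R : realType) (n m k : nat)
    (f : 'rV[R]_n -> 'rV[R]_m) : Prop :=
  exists2 A : set 'rV[R]_n, open_nbhs (0 : 'rV[R]_n) A & times_differentiable k A f.

Definition class_C_near0 (R : realType) (n m k : nat)
    (f : 'rV[R]_n -> 'rV[R]_m) : Prop :=
  exists2 A : set 'rV[R]_n, open_nbhs (0 : 'rV[R]_n) A & class_C k A f.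

(** The Jacobian matrix in the column convention (row [i] is the derivative of
    the [i]-th component); the library's ['J f x] acts on row vectors from the
    right and is its transpose. *)
Definition Jac (R : realType) (n m : nat) (f : 'rV[R]_n -> 'rV[R]_m)
    (x : 'rV[R]_n) : 'M[R]_(m, n) := ('J f x)^T.

Definition complexify (R : realType) (m n : nat) (A : 'M[R]_(m, n)) :
    'M[R[i]]_(m, n) := map_mx (real_complex R) A.

(** * Spectral data *)

Definition Estar (R : realType) (n nu : nat) (le_nu_n : (nu <= n)%N)
    (v : 'I_n -> 'rV[R[i]]_n) : 'M[R[i]]_(nu, n) :=
  \matrix_(i < nu) v (widen_ord le_nu_n i).

(** [lne 0 = -oo].  With the library's conventions on inverses and products of
    extended reals, [-oo / x = +oo] for [x < 0] (including [x = -oo]), so the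
    quotient is [+oo] as soon as one of the first [nu] eigenvalues vanishes and
    all eigenvalues have modulus [< 1]. *)
Definition beth (R : realType) (n nu : nat) (le_nu_n : (nu <= n)%N)
    (mu : 'I_n -> R[i]) : \bar R :=
  ((\big[mine/+oo]_(k < nu) lne (Normc.normc (mu (widen_ord le_nu_n k)))%:E) /
   (\big[maxe/-oo]_(k < n) lne (Normc.normc (mu k))%:E))%E.

(** * Foliations near the origin, represented by submersions *)

Definition submersion_near0 (R : realType) (n nu : nat)
    (U : 'rV[R]_n -> 'rV[R]_nu) : Prop :=
  \forall x \near (0 : 'rV[R]_n), differentiable U x /\ row_free (Jac U x).

Definition invariance_equation (R : realType) (n nu : nat)
    (F : 'rV[R]_n -> 'rV[R]_n) (U : 'rV[R]_n -> 'rV[R]_nu)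
    (S : 'rV[R]_nu -> 'rV[R]_nu) : Prop :=
  \forall x \near (0 : 'rV[R]_n), U (F x) = S (U x).

Definition invariant_foliation (R : realType) (n nu : nat)
    (F : 'rV[R]_n -> 'rV[R]_n) (U : 'rV[R]_n -> 'rV[R]_nu) : Prop :=
  submersion_near0 U /\ exists S, invariance_equation F U S.

(** [E] is the matrix of a spanning family, standing for its row space. *)
Definition tangent_to (R : realType) (n nu p : nat) (E : 'M[R[i]]_(p, n))
    (U : 'rV[R]_n -> 'rV[R]_nu) : Prop :=
  [/\ U 0 = 0, row_free (Jac U 0) & (complexify (Jac U 0) == E)%MS].

Definition local_diffeo0 (R : realType) (nu : nat)
    (Phi : 'rV[R]_nu -> 'rV[R]_nu) : Prop :=
  [/\ Phi 0 = 0, class_C_near0 1 Phi &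
      exists Psi : 'rV[R]_nu -> 'rV[R]_nu,
        [/\ Psi 0 = 0, class_C_near0 1 Psi,
            \forall z \near (0 : 'rV[R]_nu), Psi (Phi z) = z &
            \forall z \near (0 : 'rV[R]_nu), Phi (Psi z) = z]].

Definition same_foliation (R : realType) (n nu : nat)
    (U U' : 'rV[R]_n -> 'rV[R]_nu) : Prop :=
  exists2 Phi : 'rV[R]_nu -> 'rV[R]_nu, local_diffeo0 Phi &
    \forall x \near (0 : 'rV[R]_n), U' x = Phi (U x).

(** [U1] is a [C^r] submersion representing the same foliation as [U], with
    conjugate dynamics [S]. *)
Definition representation (R : realType) (n nu p r : nat)
    (F : 'rV[R]_n -> 'rV[R]_n) (E : 'M[R[i]]_(p, n))
    (U U1 : 'rV[R]_n -> 'rV[R]_nu) (S : 'rV[R]_nu -> 'rV[R]_nu) : Prop :=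
  [/\ same_foliation U U1, submersion_near0 U1, tangent_to E U1,
      class_C_near0 r U1 & invariance_equation F U1 S].

(** * Polynomial maps and eigen-coordinates *)

(** [mpoly.msize p] is one more than the total degree of [p] ([0] if [p = 0]). *)
Definition polynomial_map (R : realType) (nu d : nat)
    (S : 'rV[R]_nu -> 'rV[R]_nu) : Prop :=
  exists2 P : 'I_nu -> mpoly.mpoly nu R,
    forall j, (mpoly.msize (P j) <= d.+1)%N &
    forall z j, S z 0 j = mpoly.meval (z 0) (P j).

(** [tau] exchanges the two members of each conjugate pair of [mu]. *)
Definition conj_pairing (R : realType) (nu : nat) (mu : 'I_nu -> R[i])
    (tau : 'I_nu -> 'I_nu) : Prop :=
  [/\ involutive tau, forall k, mu (tau k) = conjc (mu k) &
      forall k, conjc (mu k) = mu k -> tau k = k].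

(** The linear change of variables given by [T], for row vectors. *)
Definition eigen_coord (R : realType) (nu : nat) (T : 'M[R[i]]_nu)
    (u : 'rV[R]_nu) : 'rV[R[i]]_nu := complexify u *m T^T.

Definition eigen_coordinates (R : realType) (nu : nat) (mu : 'I_nu -> R[i])
    (tau : 'I_nu -> 'I_nu) (S : 'rV[R]_nu -> 'rV[R]_nu) (T : 'M[R[i]]_nu) :
    Prop :=
  [/\ T \in unitmx,
      forall u k, eigen_coord T u 0 (tau k) = conjc (eigen_coord T u 0 k) &
      T *m complexify (Jac S 0) *m invmx T = diag_mx (\row_k mu k)].

(** In the coordinates given by [T], component [j] of [S] is a polynomial of
    degree at most [d] whose monomials of degree at least 2 are all resonant
    with [mu j]. *)
Definition resonant_form (R : realType) (nu d : nat) (mu : 'I_nu -> R[i])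
    (S : 'rV[R]_nu -> 'rV[R]_nu) (T : 'M[R[i]]_nu) : Prop :=
  exists Q : 'I_nu -> mpoly.mpoly nu R[i],
    [/\ forall j, (mpoly.msize (Q j) <= d.+1)%N,
        forall u j, eigen_coord T (S u) 0 j =
                    mpoly.meval (eigen_coord T u 0) (Q j) &
        forall j (m : mpoly.multinom nu), (2 <= mpoly.mdeg m)%N ->
          mpoly.mcoeff m (Q j) != 0 -> \prod_(k < nu) mu k ^+ m k = mu j].

(* Main.v *)
Require Import Defs.
From HB Require Import structures.
From mathcomp Require Import all_boot all_order all_algebra.
From mathcomp Require Import all_classical all_reals all_analysis.
From mathcomp Require Import complex.
From mathcomp Require Import ring lra.
From mathcomp Require mpoly.
Import (canonicals, coercions) mpoly.

Set Implicit Arguments.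
Unset Strict Implicit.
Unset Printing Implicit Defensive.

Import Order.TTheory GRing.Theory Num.Theory.
Import numFieldNormedType.Exports.

Local Open Scope classical_set_scope.
Local Open Scope ring_scope.

(** Write [y_k] for the coordinates given by the left eigenvectors, so that the
    linear part of [F] multiplies [y_k] by [mu_k].

    Existence.  In eigen-coordinates a component [u_j] of the submersion has to
    solve [u_j o F = mu_j u_j + s_j(u)], where [s_j] is a polynomial.  Expanding
    degree by degree one finds a polynomial in [y] solving this equation up to
    an error of order [sigma]: a monomial that is not resonant with [mu_j] is
    removed by the change of coordinates, a resonant one is put into [s_j].  By
    the nonresonance hypothesis a resonant monomial only involves the first
    [nu] coordinates, and, all moduli being less than 1, only those whose
    eigenvalue has a larger modulus than [mu_j]; hence the equations can be
    solved one after the other ([approximate_conjugacy],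
    [triangular_normal_form]).  The remaining error [h] is removed by the
    series [sum_i mu_j^(-i-1) h o F^i].  It converges because the spectral
    quotient is less than [sigma], that is, the [sigma]-th power of the spectral
    radius is less than [|mu_j|] ([beth_bound], [cohomological_solution]).

    Smoothness of that series does not require estimates on the derivatives of
    the iterates.  A map is [C^(k+1)] when its derivative, as a function of the
    base point and the vector, is [C^k].  The tangent map of [F] contracts at
    the same rate as [F], and the derivative of [h], jointly in both variables,
    vanishes to the same order as [h]; so the derivative of the series is a
    series of the same kind, and induction on [k] reduces everything to
    continuity ([orbit_sum_Ck], [Ck_contraction_Ck], [Ck_order_Ck]).

    Real foliations.  The solutions [u_j] are averaged so that exchanging the
    members of conjugate pairs amounts to complex conjugation.  Vectors with
    this symmetry are the coordinates of real vectors in a suitable basis,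
    which exists by an argument in the style of Hilbert 90 ([hilbert90],
    [real_coordinates], [normal_form_foliation]).

    Uniqueness.  Let [U] and [U'] be invariant and tangent to the same space, and
    let [u], [w] be their eigen-coordinates.  It suffices that [U'] is constant
    on the leaves of [U]: then [U'] is [Phi o U], where [Phi] is [U'] read on a
    section ([constant_same_foliation]).  If [w] equals a polynomial in [u] up
    to a term with leading part [p] of degree [e < sigma], then invariance
    shows that [p(mu y) - mu_j p(y)] takes equal values at points on which the
    first [nu] coordinates agree; so it involves only these, and by nonresonance
    so does [p], which can be absorbed in the polynomial in [u].  Thus on
    leaves of [U] the differences of [w] are of order [sigma].  Along orbits they
    shrink at most like [a^i] for some [a] larger than the [sigma]-th power of
    the contraction rate of [F] ([conjugate_strict]), while being of order
    [sigma] they shrink at least like that power; so they vanish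
    ([constant_on_leaves]).  Applied to the normal forms of different pairings
    uniqueness also gives that they represent one foliation. *)

Local Notation Re := complex.Re.
Local Notation Im := complex.Im.

(** * Strict and Frechet derivatives *)

Section Calculus.
Context (R : realType).
Implicit Types U V W : normedModType R.

Definition bounded_linear V W (L : V -> W) :=
  (forall a u v, L (a *: u + v) = a *: L u + L v) /\
  exists2 M : R, 0 <= M & forall v, `|L v| <= M * `|v|.

(** Two moving points instead of one: this makes sums, compositions and local
    inverses differentiable in the same sense, and the derivative continuous,
    without a separate continuity hypothesis. *)
Definition strict_diff V W (f : V -> W) (x : V) (L : V -> W) :=
  bounded_linear L /\ forall e : R, 0 < e -> exists2 d : R, 0 < d &
    forall y z, `|y - x| < d -> `|z - x| < d ->
      `|f y - f z - L (y - z)| <= e * `|y - z|.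

Definition frechet_diff V W (f : V -> W) (x : V) (L : V -> W) :=
  bounded_linear L /\ forall e : R, 0 < e -> exists2 d : R, 0 < d &
    forall y, `|y - x| < d -> `|f y - f x - L (y - x)| <= e * `|y - x|.

Definition cont_at V W (f : V -> W) (x : V) :=
  forall e : R, 0 < e -> exists2 d : R, 0 < d &
    forall y, `|y - x| < d -> `|f y - f x| <= e.

(** Openness by radii, so that intersections of neighbourhoods become minima of
    explicit numbers. *)
Definition metric_open V (A : set V) :=
  forall x, A x -> exists2 d : R, 0 < d & forall y, `|y - x| < d -> A y.

Lemma bounded_linear0 V W (L : V -> W) : bounded_linear L -> L 0 = 0.
Proof.
case=> h _; have := h 1 0 0; rewrite !scale1r addr0 => H.
by apply: (addrI (L 0)); rewrite addr0 -H.
Qed.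

Lemma bounded_linearZ V W (L : V -> W) a u : bounded_linear L -> L (a *: u) = a *: L u.
Proof. by move=> h; have := h.1 a u 0; rewrite addr0 (bounded_linear0 h) addr0. Qed.

Lemma bounded_linearD V W (L : V -> W) u v : bounded_linear L -> L (u + v) = L u + L v.
Proof. by move=> h; have := h.1 1 u v; rewrite !scale1r. Qed.

Lemma bounded_linearB V W (L : V -> W) u v : bounded_linear L -> L (u - v) = L u - L v.
Proof. by move=> h; rewrite bounded_linearD // -scaleN1r bounded_linearZ // scaleN1r. Qed.

Lemma bounded_linear_sum V W (L : V -> W) (I : finType) (F : I -> V) :
  bounded_linear L -> L (\sum_i F i) = \sum_i L (F i).
Proof.
move=> h; elim/big_rec2: _ => [|i y1 y2 _ <-]; first exact: bounded_linear0.
exact: bounded_linearD.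
Qed.

Lemma bounded_linear_comp U V W (L : V -> W) (K : U -> V) :
  bounded_linear L -> bounded_linear K -> bounded_linear (L \o K).
Proof.
move=> hL hK; split=> [a u v|] /=.
  by rewrite hK.1 hL.1.
case: hL.2 => M M0 hM; case: hK.2 => N N0 hN.
exists (M * N) => [|v]; first exact: mulr_ge0.
by rewrite (le_trans (hM _)) // -mulrA ler_wpM2l.
Qed.

Lemma bounded_linear_add V W (L K : V -> W) : bounded_linear L -> bounded_linear K -> bounded_linear (fun v => L v + K v).
Proof.
move=> hL hK; split=> [a u v|] /=.
  by rewrite hK.1 hL.1 scalerDr addrACA.
case: hL.2 => M M0 hM; case: hK.2 => N N0 hN.
exists (M + N) => [|v]; first exact: addr_ge0.
by rewrite (le_trans (ler_normD _ _)) // mulrDl lerD.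
Qed.

Lemma bounded_linear_scale V W (L : V -> W) (c : R) : bounded_linear L -> bounded_linear (fun v => c *: L v).
Proof.
move=> hL; split=> [a u v|] /=.
  by rewrite hL.1 scalerDr !scalerA mulrC.
case: hL.2 => M M0 hM; exists (`|c| * M) => [|v]; first exact: mulr_ge0.
by rewrite normrZ -mulrA ler_wpM2l.
Qed.

Lemma bounded_linear_scalel V W (L : V -> R) (w : W) : bounded_linear L -> bounded_linear (fun v => L v *: w).
Proof.
move=> hL; split=> [a u v|] /=.
  by rewrite hL.1 scalerDl scalerA.
case: hL.2 => M M0 hM; exists (`|w| * M) => [|v]; first exact: mulr_ge0.
by rewrite normrZ mulrC -mulrA ler_wpM2l.
Qed.

Lemma bounded_linear_id V : bounded_linear (@id V).
Proof. by split=> //; exists 1 => // v; rewrite mul1r. Qed.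

Lemma bounded_linear_zero V W : bounded_linear (fun _ : V => 0 : W).
Proof.
split=> [a u v|]; first by rewrite scaler0 addr0.
by exists 0 => // v; rewrite mul0r normr0.
Qed.

Lemma le_norm1 V W (p : V * W) : `|p.1| <= `|p|.
Proof. by rewrite (_ : `|p| = Num.max `|p.1| `|p.2|) // le_max lexx. Qed.

Lemma le_norm2 V W (p : V * W) : `|p.2| <= `|p|.
Proof. by rewrite (_ : `|p| = Num.max `|p.1| `|p.2|) // le_max lexx orbT. Qed.

Lemma norm_pair_le V W (p : V * W) (M : R) : `|p.1| <= M -> `|p.2| <= M -> `|p| <= M.
Proof. by move=> h1 h2; rewrite (_ : `|p| = Num.max `|p.1| `|p.2|) // ge_max h1. Qed.

Lemma bounded_linear_fst V W : bounded_linear (fun p : V * W => p.1).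
Proof. by split=> //; exists 1 => // v; rewrite mul1r le_norm1. Qed.

Lemma bounded_linear_snd V W : bounded_linear (fun p : V * W => p.2).
Proof. by split=> //; exists 1 => // v; rewrite mul1r le_norm2. Qed.

Lemma bounded_linear_pair U V W (L : U -> V) (K : U -> W) :
  bounded_linear L -> bounded_linear K -> bounded_linear (fun u => (L u, K u)).
Proof.
move=> hL hK; split=> [a u v|] /=.
  by rewrite hK.1 hL.1.
case: hL.2 => M M0 hM; case: hK.2 => N N0 hN.
exists (M + N) => [|v]; first exact: addr_ge0.
by apply: norm_pair_le => /=; rewrite mulrDl ?(le_trans (hM _)) ?(le_trans (hN _))//
  ?lerDl ?lerDr ?mulr_ge0.
Qed.

Lemma strict_diff_frechet_diff V W (f : V -> W) x L : strict_diff f x L -> frechet_diff f x L.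
Proof.
case=> h1 h2; split=> // e /h2[d d0 hd]; exists d => // y yd.
by apply: hd => //; rewrite subrr normr0.
Qed.

Lemma frechet_diff_cont V W (f : V -> W) x L : frechet_diff f x L -> cont_at f x.
Proof.
case=> h1 h2 e e0; case: (h1.2) => M M0 hM; have [d d0 hd] := h2 1 ltr01.
have M1 : 0 < M + 1 by rewrite ltr_wpDl.
exists (Num.min d (e / (M + 1))); first by rewrite lt_min d0 divr_gt0.
move=> y; rewrite lt_min => /andP[yd ye].
have := hd y yd; rewrite mul1r => H.
have -> : f y - f x = (f y - f x - L (y - x)) + L (y - x) by rewrite subrK.
apply: (le_trans (ler_normD _ _)).
have H2 := hM (y - x).
rewrite ltr_pdivlMr // in ye; lra.
Qed.

Lemma strict_diff_cont V W (f : V -> W) x L : strict_diff f x L -> cont_at f x.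
Proof. by move=> /strict_diff_frechet_diff/frechet_diff_cont. Qed.

Lemma frechet_diff_uniq V W (f : V -> W) x L K : frechet_diff f x L -> frechet_diff f x K -> forall v, L v = K v.
Proof.
move=> [hL h] [hK k] v; apply/eqP; rewrite -subr_eq0 -normr_le0.
apply/ler_addgt0Pr => e e0; rewrite add0r.
have v1 : 0 < `|v| + 1 by rewrite ltr_wpDl.
have e1 : 0 < e / (`|v| + 1) / 2 by rewrite !divr_gt0.
have [d d0 hd] := h _ e1; have [d' d'0 hd'] := k _ e1.
pose t := Num.min d d' / (`|v| + 1) / 2.
have m0 : 0 < Num.min d d' by rewrite lt_min d0.
have t0 : 0 < t by rewrite !divr_gt0.
have tv : `|x + t *: v - x| < Num.min d d'.
  rewrite addrC addKr normrZ (gtr0_norm t0) /t.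
  rewrite mulrAC ltr_pdivrMr // mulrAC ltr_pdivrMr //.
  by rewrite -mulrA ltr_pM2l //; have := normr_ge0 v; lra.
move: (tv); rewrite lt_min => /andP[/hd{}hd /hd'{}hd'].
have E : x + t *: v - x = t *: v by rewrite addrC addKr.
  rewrite E (bounded_linearZ t v hL) normrZ (gtr0_norm t0) in hd.
  rewrite E (bounded_linearZ t v hK) normrZ (gtr0_norm t0) in hd'.
have : `|t *: L v - t *: K v| <= e / (`|v| + 1) * (t * `|v|).
  have -> : t *: L v - t *: K v = (f (x + t *: v) - f x - t *: K v) -
     (f (x + t *: v) - f x - t *: L v).
    by rewrite opprB [RHS]addrC subrKA.
  by apply: (le_trans (ler_normB _ _)); lra.
rewrite -scalerBr normrZ gtr0_norm // mulrCA ler_pM2l // => H.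
apply: (le_trans H); rewrite mulrAC ler_pdivrMr // ler_pM2l //.
by rewrite lerDl.
Qed.

Lemma strict_diff_uniq V W (f : V -> W) x L K : strict_diff f x L -> strict_diff f x K -> forall v, L v = K v.
Proof. by move=> /strict_diff_frechet_diff h /strict_diff_frechet_diff; apply: frechet_diff_uniq. Qed.

Lemma strict_diff_ext V W (f : V -> W) x L K : strict_diff f x L -> (forall v, L v = K v) -> strict_diff f x K.
Proof. by move=> h e; have <- : L = K by apply/funext. Qed.

Lemma bounded_linear_strict_diff V W (L : V -> W) x : bounded_linear L -> strict_diff L x L.
Proof.
move=> h; split=> // e e0; exists 1 => // y z _ _.
by rewrite bounded_linearB // subrr normr0 mulr_ge0 // ltW.
Qed.

Lemma cst_strict_diff V W (c : W) (x : V) : strict_diff (fun=> c) x (fun=> 0).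
Proof.
split=> [|e e0]; first exact: bounded_linear_zero.
by exists 1 => // y z _ _; rewrite !subr0 subrr normr0 mulr_ge0 // ltW.
Qed.

Lemma strict_diff_lip V W (f : V -> W) x L : strict_diff f x L ->
  exists2 M : R, 0 <= M & exists2 d : R, 0 < d &
    forall y z, `|y - x| < d -> `|z - x| < d -> `|f y - f z| <= M * `|y - z|.
Proof.
case=> h1 h2; case: (h1.2) => M M0 hM; have [d d0 hd] := h2 1 ltr01.
exists (M + 1); first exact: addr_ge0.
exists d => // y z yd zd; have := hd y z yd zd; have := hM (y - z).
move=> H1 H2; rewrite -(subrK (L (y - z)) (f y - f z)).
by apply: (le_trans (ler_normD _ _)); lra.
Qed.

Lemma strict_diff_comp U V W (f : V -> W) (g : U -> V) x L K :
  strict_diff f (g x) L -> strict_diff g x K -> strict_diff (f \o g) x (L \o K).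
Proof.
move=> hf hg; split; first by apply: bounded_linear_comp; [case: hf | case: hg].
move=> e e0; have [M M0 [d1 d10 hM]] := strict_diff_lip hg.
have hL := hf.1; case: (hL.2) => N N0 hN.
have M1 : 0 < M + 1 by rewrite ltr_wpDl.
have N1 : 0 < N + 1 by rewrite ltr_wpDl.
have [d2 d20 hd2] := hf.2 (e / 2 / (M + 1)) ltac:(by rewrite !divr_gt0).
have [d3 d30 hd3] := hg.2 (e / 2 / (N + 1)) ltac:(by rewrite !divr_gt0).
exists (Num.min d1 (Num.min d3 (d2 / (M + 1)))).
  by rewrite !lt_min d10 d30 divr_gt0.
move=> y z; rewrite !lt_min => /and3P[y1 y3 y2] /and3P[z1 z3 z2] /=.
have b u : `|u - x| < d1 -> `|u - x| < d2 / (M + 1) -> `|g u - g x| < d2.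
  move=> u1 u2; apply: (le_lt_trans (hM u x u1 _)); first by rewrite subrr normr0.
  rewrite ltr_pdivlMr // in u2; apply: le_lt_trans u2.
  by rewrite mulrC ler_wpM2l // lerDl.
have H1 := hd2 _ _ (b y y1 y2) (b z z1 z2).
have H2 := hd3 _ _ y3 z3.
have H3 := hM _ _ y1 z1.
have H4 := hN (g y - g z - K (y - z)).
have -> : f (g y) - f (g z) - L (K (y - z)) =
   (f (g y) - f (g z) - L (g y - g z)) + L (g y - g z - K (y - z)).
  by rewrite (bounded_linearB (g y - g z) (K (y - z)) hL) subrKA.
apply: (le_trans (ler_normD _ _)).
have -> : e * `|y - z| = e / 2 * `|y - z| + e / 2 * `|y - z| by lra.
apply: lerD.
  apply: (le_trans H1); rewrite mulrAC ler_pdivrMr //.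
    rewrite -[leRHS]mulrA ler_pM2l ?divr_gt0 //.
  by apply: (le_trans H3); have := normr_ge0 (y - z); nra.
apply: (le_trans H4).
apply: (@le_trans _ _ ((N + 1) * (e / 2 / (N + 1) * `|y - z|))).
  apply: ler_pM => //; lra.
by rewrite mulrA mulrCA divff ?gt_eqF // mulr1.
Qed.

Lemma strict_diff_pair U V W (f : U -> V) (g : U -> W) x L K :
  strict_diff f x L -> strict_diff g x K -> strict_diff (fun u => (f u, g u)) x (fun u => (L u, K u)).
Proof.
move=> hf hg; split; first by apply: bounded_linear_pair; [case: hf | case: hg].
move=> e e0; have [d1 d10 h1] := hf.2 e e0; have [d2 d20 h2] := hg.2 e e0.
exists (Num.min d1 d2); first by rewrite lt_min d10.
move=> y z; rewrite !lt_min => /andP[y1 y2] /andP[z1 z2].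
by apply: norm_pair_le => /=; [apply: h1 | apply: h2].
Qed.

Lemma bounded_linear_addp W : bounded_linear (fun p : W * W => p.1 + p.2).
Proof. by apply: bounded_linear_add; [apply: bounded_linear_fst | apply: bounded_linear_snd]. Qed.

Lemma strict_diff_add V W (f g : V -> W) x L K :
  strict_diff f x L -> strict_diff g x K -> strict_diff (fun u => f u + g u) x (fun u => L u + K u).
Proof.
move=> hf hg.
exact: (strict_diff_comp (bounded_linear_strict_diff _ (bounded_linear_addp W)) (strict_diff_pair hf hg)).
Qed.

Lemma scale_strict_diff W (p : R * W) :
  strict_diff (fun q : R * W => q.1 *: q.2) p (fun v => v.1 *: p.2 + p.1 *: v.2).
Proof.
split.
  apply: bounded_linear_add; first exact: (bounded_linear_scalel p.2 (bounded_linear_fst R W)).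
  exact: (bounded_linear_scale p.1 (bounded_linear_snd R W)).
move=> e e0; exists (e / 2) => [|y z yp zp]; first by rewrite divr_gt0.
have -> : y.1 *: y.2 - z.1 *: z.2 - ((y - z).1 *: p.2 + p.1 *: (y - z).2) =
  (y.1 - z.1) *: (y.2 - p.2) + (z.1 - p.1) *: (y.2 - z.2).
  have E : y.1 *: y.2 - z.1 *: z.2 = (y.1 - z.1) *: y.2 + z.1 *: (y.2 - z.2).
    by rewrite scalerBl scalerBr subrKA.
  by rewrite E opprD addrACA -scalerBr -scalerBl.
have a1 := le_norm1 (y - z); have a2 := le_norm2 (y - z).
have b1 := le_norm1 (z - p); have b2 := le_norm2 (y - p).
apply: (le_trans (ler_normD _ _)); rewrite !normrZ.
have -> : e * `|y - z| = `|y - z| * (e / 2) + (e / 2) * `|y - z| by lra.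
apply: lerD; apply: ler_pM => //=.
- by apply: (le_trans b2); rewrite ltW.
- by apply: (le_trans b1); rewrite ltW.
Qed.

Lemma strict_diff_scale V W (s : V -> R) (f : V -> W) x L K :
  strict_diff s x L -> strict_diff f x K ->
  strict_diff (fun u => s u *: f u) x (fun u => L u *: f x + s x *: K u).
Proof.
move=> hs hf.
exact: (strict_diff_comp (scale_strict_diff (s x, f x)) (strict_diff_pair hs hf)).
Qed.

Lemma strict_diff_local V W (f g : V -> W) x L (A : set V) :
  metric_open A -> A x -> (forall y, A y -> f y = g y) -> strict_diff f x L -> strict_diff g x L.
Proof.
move=> oA Ax fg [h1 h2]; split=> // e /h2[d d0 hd].
have [d' d'0 hA] := oA x Ax.
exists (Num.min d d'); first by rewrite lt_min d0.
move=> y z; rewrite !lt_min => /andP[y1 y2] /andP[z1 z2].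
by rewrite -!fg ?hd //; apply: hA.
Qed.

End Calculus.

(** * Smoothness by iterated derivatives *)

Section TangentClasses.
Context (R : realType).
Implicit Types U V W : normedModType R.

(** The derivative is a function on [V * V], smooth jointly in the base point and
    the vector.  Compared with a derivative valued in a space of linear maps,
    this keeps all levels among normed spaces of the same kind and makes the
    class stable under tangent maps. *)
Fixpoint Ck W (k : nat) V (A : set V) (f : V -> W) : Prop :=
  if k is k'.+1 then
    exists2 f1 : V * V -> W, (forall x, A x -> strict_diff f x (fun v => f1 (x, v))) &
      Ck k' [set p : V * V | A p.1] f1
  else forall x, A x -> cont_at f x.

Lemma Ck_cont W k V (A : set V) (f : V -> W) x : Ck k A f -> A x -> cont_at f x.
Proof.
case: k => [|k] /= h Ax; first exact: h.
by case: h => f1 h _; apply: strict_diff_cont (h x Ax).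
Qed.

Lemma metric_open_fst V U (A : set V) : metric_open A -> metric_open [set p : V * U | A p.1].
Proof.
move=> oA p /oA[d d0 hd]; exists d => // q qp; apply: hd.
exact: le_lt_trans (le_norm1 (q - p)) qp.
Qed.

Lemma Ck_sub W k V (A B : set V) (f : V -> W) :
  (forall x, A x -> B x) -> Ck k B f -> Ck k A f.
Proof.
elim: k V A B f => [|k ih] V A B f AB /=; first by move=> h x /AB/h.
case=> f1 h1 h2; exists f1 => [x /AB/h1 //|].
by apply: ih h2 => p; apply: AB.
Qed.

Lemma Ck_S W k V (A : set V) (f : V -> W) : Ck k.+1 A f -> Ck k A f.
Proof.
elim: k V A f => [|k ih] V A f /=.
  by case=> f1 h _ x /h/strict_diff_cont.
by case=> f1 h h2; exists f1 => //; apply: ih.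
Qed.

Lemma Ck_le W k l V (A : set V) (f : V -> W) : (k <= l)%N -> Ck l A f -> Ck k A f.
Proof.
move=> kl; rewrite -(subnK kl); elim: (l - k)%N => [|m ih] //.
by rewrite addSn => /Ck_S.
Qed.

Lemma cont_local V W (f g : V -> W) x (A : set V) :
  metric_open A -> A x -> (forall y, A y -> f y = g y) -> cont_at f x -> cont_at g x.
Proof.
move=> oA Ax fg h e /h[d d0 hd]; have [d' d'0 hA] := oA x Ax.
exists (Num.min d d'); first by rewrite lt_min d0.
by move=> y; rewrite lt_min => /andP[y1 y2]; rewrite -!fg ?hd //; apply: hA.
Qed.

Lemma Ck_ext W k V (A : set V) (f g : V -> W) :
  metric_open A -> (forall x, A x -> f x = g x) -> Ck k A f -> Ck k A g.
Proof.
case: k => [|k] oA fg /=; first by move=> h x Ax; apply: (cont_local oA Ax fg (h x Ax)).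
by case=> f1 h h1; exists f1 => // x Ax; apply: (strict_diff_local oA Ax fg (h x Ax)).
Qed.

(** The derivatives chosen on the members of the cover agree by uniqueness, so
    they can be glued. *)
Lemma Ck_bigcup W k V I (A : I -> set V) (f : V -> W) :
  (forall i, metric_open (A i)) -> (forall i, Ck k (A i) f) -> Ck k [set x | exists i, A i x] f.
Proof.
elim: k V A f => [|k ih] V A f oA /=; first by move=> h x [i Ai]; apply: (h i).
move=> /(_ _)/cid2-/all_sig[f1 h].
pose g (p : V * V) : W := if pselect (exists i, A i p.1) is left e
  then f1 (projT1 (cid e)) p else 0.
have gE i x v : A i x -> g (x, v) = f1 i (x, v).
  move=> Aix; rewrite /g; case: pselect => [e|[]]; last by exists i.
  case: cid => j /= Ajx.
  exact: (strict_diff_uniq ((h j).1 x Ajx) ((h i).1 x Aix)).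
exists g => [x [i Aix]|].
  by apply: strict_diff_ext ((h i).1 x Aix) _ => v; rewrite (gE i).
have hk : Ck k [set p : V * V | exists i, A i p.1] g.
  apply: (ih _ (fun i => [set p : V * V | A i p.1])) => i; first exact: metric_open_fst.
  apply: Ck_ext (h i).2; first exact: metric_open_fst.
  by move=> [x v] /= Aix; rewrite (gE i).
exact: hk.
Qed.

Lemma Ck_lin W k V (A : set V) (L : V -> W) : bounded_linear L -> Ck k A L.
Proof.
elim: k V A L => [|k ih] V A L hL /=.
  by move=> x _; apply: strict_diff_cont (bounded_linear_strict_diff x hL).
exists (fun p => L p.2) => [x _|]; first exact: bounded_linear_strict_diff.
by apply: ih; apply: (bounded_linear_comp hL (bounded_linear_snd V V)).
Qed.

Lemma Ck_cst W k V (A : set V) (c : W) : Ck k A (fun _ : V => c).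
Proof.
case: k => [|k] /=.
  by move=> x _; apply: strict_diff_cont (cst_strict_diff c x).
exists (fun=> 0) => [x _|]; first exact: cst_strict_diff.
exact/Ck_lin/bounded_linear_zero.
Qed.

Lemma cont_pair U V W (f : U -> V) (g : U -> W) x :
  cont_at f x -> cont_at g x -> cont_at (fun u => (f u, g u)) x.
Proof.
move=> h k e e0; have [d d0 hd] := h e e0; have [d' d'0 hd'] := k e e0.
exists (Num.min d d'); first by rewrite lt_min d0.
move=> y; rewrite lt_min => /andP[y1 y2].
by apply: norm_pair_le => /=; [apply: hd|apply: hd'].
Qed.

Lemma cont_comp U V W (f : V -> W) (g : U -> V) x :
  cont_at f (g x) -> cont_at g x -> cont_at (f \o g) x.
Proof.
move=> h k e e0; have [d d0 hd] := h e e0.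
have [d' d'0 hd'] := k (d / 2) ltac:(by rewrite divr_gt0).
exists d' => // y /hd' H; apply: hd; apply: le_lt_trans H _.
by rewrite ltr_pdivrMr // ltr_pMr // ltr1n.
Qed.

Lemma Ck_pair U k V W (A : set U) (f : U -> V) (g : U -> W) :
  Ck k A f -> Ck k A g -> Ck k A (fun u => (f u, g u)).
Proof.
elim: k U A f g => [|k ih] U A f g /=.
  by move=> h h' x Ax; apply: cont_pair; [apply: h|apply: h'].
move=> [f1 hf1 hf] [g1 hg1 hg]; exists (fun p => (f1 p, g1 p)); last exact: ih.
by move=> x Ax; apply: (strict_diff_pair (hf1 x Ax) (hg1 x Ax)).
Qed.

Lemma Ck_comp k U V W (A : set U) (B : set V) (f : V -> W) (g : U -> V) :
  (forall x, A x -> B (g x)) -> Ck k B f -> Ck k A g -> Ck k A (fun x => f (g x)).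
Proof.
elim: k U V W A B f g => [|k ih] U V W A B f g AB.
  by move=> h h' x Ax; apply: (cont_comp (h _ (AB _ Ax)) (h' x Ax)).
move=> hf hg; have gS := Ck_S hg; case: hf hg => [f1 hf1 hf] [g1 hg1 hg].
exists (fun p => f1 (g p.1, g1 p)).
  by move=> x Ax; apply: (strict_diff_comp (hf1 _ (AB x Ax)) (hg1 x Ax)).
apply: (ih _ _ _ _ _ f1 (fun p => (g p.1, g1 p))) hf _; first by move=> p /= /AB.
apply: Ck_pair hg; apply: (ih _ _ _ _ A g (fun p => p.1)) => //.
exact/Ck_lin/bounded_linear_fst.
Qed.

Lemma Ck_fst k V U W (A : set V) (f : V -> W) :
  Ck k A f -> Ck k [set p : V * U | A p.1] (fun p => f p.1).
Proof. by move=> h; apply: Ck_comp h _ => //; apply/Ck_lin/bounded_linear_fst. Qed.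

Lemma Ck_linl k U V W (A : set U) (L : V -> W) (g : U -> V) :
  bounded_linear L -> Ck k A g -> Ck k A (fun x => L (g x)).
Proof. by move=> hL; apply: (@Ck_comp k U V W A setT L g) => //; apply: Ck_lin. Qed.

Lemma Ck_add k V W (A : set V) (f g : V -> W) :
  Ck k A f -> Ck k A g -> Ck k A (fun x => f x + g x).
Proof. by move=> hf hg; apply: (Ck_linl (bounded_linear_addp W) (Ck_pair hf hg)). Qed.

Lemma Ck_cscale k V W (A : set V) c (f : V -> W) :
  Ck k A f -> Ck k A (fun x => c *: f x).
Proof. by move=> hf; apply: (Ck_linl _ hf); apply/bounded_linear_scale/bounded_linear_id. Qed.

Lemma Ck_opp k V W (A : set V) (f : V -> W) :
  Ck k A f -> Ck k A (fun x => - f x).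
Proof.
by move=> /(Ck_cscale (-1)); congr Ck; apply/funext => x; rewrite scaleN1r.
Qed.

Lemma Ck_subr k V W (A : set V) (f g : V -> W) :
  Ck k A f -> Ck k A g -> Ck k A (fun x => f x - g x).
Proof. by move=> hf hg; apply: Ck_add => //; apply: Ck_opp. Qed.

Lemma Ck_sum k V W (A : set V) I (s : seq I) (f : I -> V -> W) :
  (forall i, Ck k A (f i)) -> Ck k A (fun x => \sum_(i <- s) f i x).
Proof.
move=> h; elim: s => [|i s ih].
  have -> : (fun x => \sum_(i <- [::]) f i x) = fun=> 0.
    by apply/funext => x; rewrite big_nil.
  exact: Ck_cst.
have -> : (fun x => \sum_(j <- i :: s) f j x) = fun x => f i x + \sum_(j <- s) f j x.
  by apply/funext => x; rewrite big_cons.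
exact: Ck_add.
Qed.

Lemma Ck_scale k V W (A : set V) (s : V -> R) (f : V -> W) :
  Ck k A s -> Ck k A f -> Ck k A (fun x => s x *: f x).
Proof.
elim: k V A s f => [|k ih] V A s f hs hf.
  move=> x Ax; apply: (@cont_comp V (R * W)%type W (fun q => q.1 *: q.2) (fun u => (s u, f u))).
    exact: strict_diff_cont (scale_strict_diff _).
  by apply: cont_pair; [apply: hs|apply: hf].
have [hs' hf'] := (Ck_S hs, Ck_S hf).
case: hs hf => [s1 hs1 hs] [f1 hf1 hf].
exists (fun p => s1 p *: f p.1 + s p.1 *: f1 p).
  by move=> x Ax; apply: (strict_diff_scale (hs1 x Ax) (hf1 x Ax)).
by apply: Ck_add; apply: ih => //; apply: Ck_fst.
Qed.

Lemma Ck_mul k V (A : set V) (f g : V -> R) :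
  Ck k A f -> Ck k A g -> Ck k A (fun x => f x * g x).
Proof. exact: Ck_scale. Qed.

End TangentClasses.

(** * Geometric series, mean values and equivalent norms *)

Section Tools.
Context (R : realType).
Implicit Types U V W : normedModType R.

Lemma geo_series_cvg (t : nat -> R) (K th : R) :
  0 <= th < 1 -> (forall i, `|t i| <= K * th ^+ i) -> cvgn (series t).
Proof.
move=> /andP[t0 t1] h; apply: normed_cvg.
apply: (@series_le_cvg _ _ (geometric K th)) => //= [n|].
  exact: le_trans (h n).
by apply: is_cvg_geometric_series; rewrite ger0_norm.
Qed.

Lemma geo_series_partial (t : nat -> R) (K th : R) n p :
  0 <= th < 1 -> (forall i, `|t i| <= K * th ^+ i) ->
  `|series t (n + p)%N - series t n| <= K * th ^+ n / (1 - th).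
Proof.
move=> /andP[t0 t1] h; have t2 : 0 < 1 - th by rewrite subr_gt0.
have K0 : 0 <= K by have := le_trans (normr_ge0 _) (h 0%N); rewrite expr0 mulr1.
apply: (@le_trans _ _ (K * (th ^+ n - th ^+ (n + p)) / (1 - th))); last first.
  rewrite ler_pM2r ?invr_gt0 // ler_wpM2l // lerBlDr lerDl exprn_ge0 //.
elim: p => [|p ih].
  by rewrite addn0 !subrr normr0 mulr0 mul0r.
rewrite addnS seriesSr addrAC (le_trans (ler_normD _ _)) //.
apply: (le_trans (lerD ih (h _))).
rewrite ler_pdivlMr // mulrDl divfK ?gt_eqF // exprS.
by set a := th ^+ (n + p); rewrite le_eqVlt; apply/orP; left; apply/eqP; ring.
Qed.

Lemma geo_series_tail (t : nat -> R) (K th : R) n :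
  0 <= th < 1 -> (forall i, `|t i| <= K * th ^+ i) ->
  `|limn (series t) - series t n| <= K * th ^+ n / (1 - th).
Proof.
move=> ht h; have c := geo_series_cvg ht h.
apply/ler_addgt0Pr => e e0.
have [N _ hN] := (cvgrPdist_le _ _).1 c e e0.
have := hN (n + N)%N (leq_addl _ _) => /= H.
rewrite -(subrKA (series t (n + N)%N)) addrC (le_trans (ler_normD _ _)) //.
by apply: lerD => //; exact: geo_series_partial.
Qed.

Lemma lim_series_lin (t u : nat -> R) (a : R) :
  cvgn (series t) -> cvgn (series u) ->
  limn (series (fun i => a * t i + u i)) = a * limn (series t) + limn (series u).
Proof.
move=> ct cu.
have -> : (fun i => a * t i + u i) = (a *: t : nat -> R) + u by [].
have h : cvgn (series (a *: t : nat -> R)) := is_cvg_seriesZ ct.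
by rewrite lim_seriesD // lim_seriesZ.
Qed.

Lemma geo_small (K th : R) : 0 <= th < 1 -> forall e : R, 0 < e ->
  exists n, K * th ^+ n / (1 - th) <= e.
Proof.
move=> /andP[t0 t1] e e0; have t2 : 0 < 1 - th by rewrite subr_gt0.
have c : geometric K th @ \oo --> 0 by apply: cvg_geometric; rewrite ger0_norm.
have [N _ hN] := (cvgrPdist_le _ _).1 c (e * (1 - th)) (mulr_gt0 e0 t2).
exists N; have := hN N (leqnn N); rewrite /= sub0r normrN => H.
by rewrite ler_pdivrMr //; apply: le_trans (ler_norm _) H.
Qed.

Lemma frechet_diff_line V (f : V -> R) (z w : V) t L :
  frechet_diff f (z + t *: w) L -> is_derive (t : R) (1 : R) (fun s => f (z + s *: w)) (L w).
Proof.
move=> [hL h].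
have key : (fun h : R => h^-1 *: (f (z + (h *: (1 : R) + t) *: w) - f (z + t *: w)))
    @ 0^' --> L w.
  apply/cvgrPdist_le => e e0.
  have w1 : 0 < `|w| + 1 by rewrite ltr_wpDl.
  have [d d0 hd] := h (e / (`|w| + 1)) ltac:(by rewrite divr_gt0).
  have : nbhs (0 : R) (fun s => s != 0 -> `|L w - s^-1 *: (f (z + (s *: (1 : R) + t) *: w) - f (z + t *: w))| <= e); last by [].
  apply: (proj2 (nbhs_normP (0 : R) _)).
  exists (d / (`|w| + 1)) => [|s /= + s0]; first by rewrite /= divr_gt0.
  rewrite sub0r normrN => sd0.
  have E : z + (s *: (1 : R) + t) *: w - (z + t *: w) = s *: w.
    by rewrite opprD addrACA subrr add0r -scalerBl addrK /GRing.scale /= mulr1.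
  have := hd (z + (s *: (1 : R) + t) *: w); rewrite E normrZ (bounded_linearZ _ _ hL) => H.
  have sd : `|s| * `|w| < d.
    move: sd0; rewrite ltr_pdivlMr //; apply: le_lt_trans.
    by rewrite ler_wpM2l // lerDl.
  have {}H := H sd.
  set D := f _ - f _ in H *.
  have -> : L w - s^-1 *: D = - s^-1 *: (D - s *: L w).
    by rewrite /GRing.scale /=; field.
  rewrite normrZ normrN normfV ler_pdivrMl ?normr_gt0 //.
  apply: (le_trans H); rewrite [leLHS]mulrCA ler_wpM2l //.
  by rewrite mulrAC ler_pdivrMr // ler_pM2l // lerDl.
have dv : derivable (fun s : R => f (z + s *: w)) t 1.
  by apply/cvg_ex; exists (L w).
by apply: DeriveDef => //; apply/cvg_lim.
Qed.

Lemma cont_at_continuous V W (f : V -> W) x : cont_at f x <-> {for x, continuous f}.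
Proof.
split=> [h|h].
  apply/cvgrPdist_le => e e0; have [d d0 hd] := h e e0.
  apply/nbhs_normP; exists d => //= y; rewrite /= distrC => yd.
  by rewrite distrC; apply: hd.
move=> e e0; have /cvgrPdist_le/(_ e e0) := h.
move=> /nbhs_normP[d /= d0 hd]; exists d => // y yd.
by rewrite distrC; apply: hd; rewrite /= distrC.
Qed.

Lemma mvt_line V (f : V -> R) (z w : V) (D : R -> V -> R) :
  (forall t, 0 <= t <= 1 -> frechet_diff f (z + t *: w) (D t)) ->
  exists2 t : R, 0 < t < 1 & f (z + w) - f z = D t w.
Proof.
move=> h.
have hd t : t \in `]0, 1[ -> is_derive (t : R) (1 : R) (fun s => f (z + s *: w)) (D t w).
  by rewrite in_itv /= => /andP[/ltW t0 /ltW t1]; apply: frechet_diff_line; apply: h; rewrite t0.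
have hc : {within `[0, 1], continuous (fun s : R => f (z + s *: w))}.
  apply: derivable_within_continuous => t; rewrite in_itv /= => ht.
  by have [] := frechet_diff_line (h t ht).
have [t] := MVT ltr01 hd hc.
rewrite in_itv /= => t01; rewrite scale1r scale0r addr0 subr0 mulr1 => E.
by exists t.
Qed.

(** The map contracts in a norm adapted to its linear part, not necessarily in
    the given one. *)
Definition eqnorm V (N : V -> R) :=
  [/\ forall a x, N (a *: x) = `|a| * N x, forall x y, N (x + y) <= N x + N y,
      exists2 c : R, 0 < c & forall x, N x <= c * `|x| &
      exists2 c : R, 0 < c & forall x, `|x| <= c * N x].

(** The maximum, so that the tangent map contracts at the same rate as the map. *)
Definition pairN V (N : V -> R) (p : V * V) : R := Num.max (N p.1) (N p.2).

Lemma eqnorm_ge0 V (N : V -> R) x : eqnorm N -> 0 <= N x.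
Proof.
case=> _ _ _ [c c0 h]; have := le_trans (normr_ge0 x) (h x).
by rewrite pmulr_rge0.
Qed.

Lemma eqnorm0 V (N : V -> R) : eqnorm N -> N 0 = 0.
Proof. by case=> h _ _ _; rewrite -(scale0r (0 : V)) h normr0 mul0r. Qed.

Lemma eqnorm_pair V (N : V -> R) : eqnorm N -> eqnorm (pairN N).
Proof.
move=> hN; case: (hN) => hZ hD [c c0 hc] [e e0 he]; split.
- by move=> a x; rewrite /pairN /= !hZ -maxr_pMr.
- move=> x y; rewrite /pairN /= ge_max; apply/andP; split.
    by apply: (le_trans (hD _ _)); apply: lerD; rewrite le_max lexx.
  by apply: (le_trans (hD _ _)); apply: lerD; rewrite le_max lexx orbT.
- exists c => // x; rewrite /pairN ge_max; apply/andP; split.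
    by apply: (le_trans (hc _)); rewrite ler_pM2l // le_norm1.
  by apply: (le_trans (hc _)); rewrite ler_pM2l // le_norm2.
- exists e => // x; apply: norm_pair_le.
    by apply: (le_trans (he _)); rewrite ler_pM2l // le_max lexx.
  by apply: (le_trans (he _)); rewrite ler_pM2l // le_max lexx orbT.
Qed.

Lemma eqnorm_segment V (N : V -> R) x y m t : eqnorm N ->
  N x < m -> N y < m -> 0 <= t <= 1 -> N (x + t *: (y - x)) < m.
Proof.
case=> hZ hD _ _ xm ym /andP[t0 t1].
have -> : x + t *: (y - x) = (1 - t) *: x + t *: y.
  by rewrite scalerBl scalerBr scale1r addrA addrAC.
apply: le_lt_trans (hD _ _) _; rewrite !hZ !ger0_norm ?subr_ge0 //.
have hM : Num.max (N x) (N y) < m by rewrite gt_max xm.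
apply: le_lt_trans hM.
have h1 : N x <= Num.max (N x) (N y) by rewrite le_max lexx.
have h2 : N y <= Num.max (N x) (N y) by rewrite le_max lexx orbT.
nra.
Qed.

Lemma metric_open_eqnorm V (N : V -> R) (d : R) : eqnorm N -> metric_open [set x | N x < d].
Proof.
move=> hN x /= xd; case: (hN) => _ hD [c c0 hc] _.
exists ((d - N x) / c) => [|y yx]; first by rewrite divr_gt0 // subr_gt0.
rewrite /= -(subrK x y); apply: le_lt_trans (hD _ _) _.
rewrite -ltrBrDr; apply: le_lt_trans (hc _) _.
by rewrite mulrC -ltr_pdivlMr.
Qed.

End Tools.

(** * Smoothness of series along orbits *)

Section SeriesThm.
Context (R : realType).
Implicit Types U V W : normedModType R.

Definition bigO V (d : nat) (f : V -> R) :=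
  exists2 C : R, 0 <= C & exists2 e : R, 0 < e &
    forall x, `|x| < e -> `|f x| <= C * `|x| ^+ d.

(** The class [C^k], with vanishing of order [d] at the origin for the function
    and for all its iterated derivatives, each taken jointly in base point and
    vector: a loss of one order in the point is compensated by linearity in the
    vector. *)
Fixpoint order_Ck (k d : nat) V (A : set V) (h : V -> R) : Prop :=
  bigO d h /\
  if k is k'.+1 then
    exists2 h1 : V * V -> R, (forall x, A x -> strict_diff h x (fun v => h1 (x, v))) &
      order_Ck k' d [set p : V * V | A p.1] h1
  else forall x, A x -> cont_at h x.

(** Parallel to [order_Ck]: the induction on [k] for series along orbits unfolds
    both together. *)
Fixpoint contraction_Ck (k : nat) (q : R) V (N : V -> R) (A : set V) (F : V -> V) : Prop :=
  (exists2 e : R, 0 < e & forall x, N x < e -> N (F x) <= q * N x) /\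
  if k is k'.+1 then
    exists2 F1 : V * V -> V, (forall x, A x -> strict_diff F x (fun v => F1 (x, v))) &
      contraction_Ck k' q (pairN N) [set p : V * V | A p.1] (fun p => (F p.1, F1 p))
  else forall x, A x -> cont_at F x.

Definition orbit_sum V (c : nat -> R) (F : V -> V) (h : V -> R) (x : V) : R :=
  limn (series (fun i => c i * h (iter i F x))).

Lemma order_Ck_ord k d V (A : set V) (h : V -> R) : order_Ck k d A h -> bigO d h.
Proof. by case: k => [|k] []. Qed.

Lemma contraction_Ck_contr k q V N (A : set V) F : contraction_Ck k q N A F ->
  exists2 e : R, 0 < e & forall x, N x < e -> N (F x) <= q * N x.
Proof. by case: k => [|k] []. Qed.

Lemma contraction_Ck_cont k q V N (A : set V) F : contraction_Ck k q N A F -> forall x, A x -> cont_at F x.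
Proof.
case: k => [|k] [_ h] //; case: h => F1 h _ x Ax.
exact: strict_diff_cont (h x Ax).
Qed.

Lemma order_Ck_cont k d V (A : set V) h : order_Ck k d A h -> forall x, A x -> cont_at h x.
Proof.
case: k => [|k] [_ hh] //; case: hh => F1 h' _ x Ax.
exact: strict_diff_cont (h' x Ax).
Qed.

Lemma iter_contr V (N : V -> R) (F : V -> V) (q e : R) :
  0 <= q < 1 -> (forall x, 0 <= N x) -> (forall x, N x < e -> N (F x) <= q * N x) ->
  forall x i, N x < e -> N (iter i F x) <= q ^+ i * N x /\ N (iter i F x) < e.
Proof.
move=> /andP[q0 q1] N0 h x i xe.
suff H : N (iter i F x) <= q ^+ i * N x.
  split=> //; apply: le_lt_trans H _; apply: le_lt_trans xe.
  by rewrite ler_piMl // exprn_ile1 // ltW.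
elim: i => [|i ih] /=; first by rewrite mul1r.
apply: le_trans (h _ _) _.
  by apply: le_lt_trans ih _; apply: le_lt_trans xe; rewrite ler_piMl // exprn_ile1 // ltW.
by rewrite exprS -mulrA ler_wpM2l.
Qed.

(** The contraction turns the order [d] of [h] into a factor [q^d] at each step,
    against a factor [l] from the coefficients. *)
Lemma orbit_decay d V (N : V -> R) (A : set V) F h (c : nat -> R) (q l C : R) :
  eqnorm N -> metric_open A -> A 0 -> 0 <= q < 1 -> 0 <= l ->
  (forall i, `|c i| <= C * l ^+ i) ->
  (exists2 e : R, 0 < e & forall x, N x < e -> N (F x) <= q * N x) ->
  bigO d h ->
  exists2 e : R, 0 < e <= 1 & exists2 K : R, 0 <= K & forall x i, N x < e ->
    [/\ A (iter i F x), N (iter i F x) < e &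
        `|c i * h (iter i F x)| <= K * N x ^+ d * (l * q ^+ d) ^+ i].
Proof.
move=> hN oA A0 hq l0 hc [e1 e10 h1] [B B0 [e2 e20 h2]].
have [e3 e30 h3] := oA 0 A0; case: (hN) => _ _ _ [b b0 hb].
have N0 x : 0 <= N x by apply: eqnorm_ge0.
pose m := Num.min e1 (Num.min 1 (Num.min (e2 / b) (e3 / b))).
have C0 : 0 <= C by have := le_trans (normr_ge0 _) (hc 0%N); rewrite expr0 mulr1.
exists m; first by rewrite /m !lt_min !ge_min e10 ltr01 !divr_gt0 // lexx /= orbT.
exists (C * (B * b ^+ d)); first by rewrite !mulr_ge0 // exprn_ge0 // ltW.
move=> x i xm.
have hm x' : N x' < m -> N (F x') <= q * N x'.
  by rewrite /m lt_min => /andP[/h1].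
have [H1 H2] := iter_contr hq N0 hm i xm.
have /and4P[_ _ a2 a3] : [&& N (iter i F x) < e1, N (iter i F x) < 1,
    N (iter i F x) < e2 / b & N (iter i F x) < e3 / b].
  by move: H2; rewrite /m !lt_min.
have B1 : `|iter i F x| < e2.
  by apply: le_lt_trans (hb _) _; rewrite mulrC -ltr_pdivlMr.
have B2 : `|iter i F x| < e3.
  by apply: le_lt_trans (hb _) _; rewrite mulrC -ltr_pdivlMr.
split; [by apply: h3; rewrite subr0|exact: H2|].
have -> : C * (B * b ^+ d) * N x ^+ d * (l * q ^+ d) ^+ i =
    C * l ^+ i * (B * (b * (q ^+ i * N x)) ^+ d).
  by rewrite !exprMn exprAC; ring.
rewrite normrM ler_pM //; apply: (le_trans (h2 _ B1)); rewrite ler_wpM2l //.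
have bN : `|iter i F x| <= b * (q ^+ i * N x).
  by apply: (le_trans (hb _)); rewrite ler_pM2l.
by rewrite lerXn2r ?nnegrE //; apply: le_trans bN.
Qed.

Lemma orbit_bound d V (N : V -> R) (A : set V) F h (c : nat -> R) (q l C : R) :
  eqnorm N -> metric_open A -> A 0 -> 0 <= q < 1 -> 0 <= l ->
  (forall i, `|c i| <= C * l ^+ i) ->
  (exists2 e : R, 0 < e & forall x, N x < e -> N (F x) <= q * N x) ->
  bigO d h ->
  exists2 e : R, 0 < e & exists2 K : R, 0 <= K & forall x i, N x < e ->
    [/\ A (iter i F x), N (iter i F x) < e &
        `|c i * h (iter i F x)| <= K * (l * q ^+ d) ^+ i].
Proof.
move=> hN oA A0 hq l0 hc hF hh.
have [e /andP[e0 e1] [K K0 hK]] := orbit_decay hN oA A0 hq l0 hc hF hh.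
exists e => //; exists K => // x i xe; have [h1 h2 h3] := hK x i xe; split=> //.
apply: (le_trans h3); rewrite ler_wpM2r ?exprn_ge0 ?mulr_ge0 ?exprn_ge0 //.
  by case/andP: hq.
rewrite ler_piMr // exprn_ile1 ?(eqnorm_ge0 x hN) //.
by apply: le_trans e1; exact: ltW.
Qed.

Lemma strict_diff_iter V (A : set V) (F : V -> V) (F1 : V * V -> V) x :
  (forall x, A x -> strict_diff F x (fun v => F1 (x, v))) ->
  (forall i, A (iter i F x)) ->
  let TF := fun p : V * V => (F p.1, F1 p) in
  forall i, (forall v, (iter i TF (x, v)).1 = iter i F x) /\
    strict_diff (iter i F) x (fun v => (iter i TF (x, v)).2).
Proof.
move=> h hA TF; elim=> [|i [ih1 ih2]].
  by split=> //=; apply/bounded_linear_strict_diff/bounded_linear_id.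
split=> [v|]; first by rewrite /= ih1.
have := strict_diff_comp (h _ (hA i)) ih2; rewrite /=.
move=> /strict_diff_ext; apply=> v /=; rewrite -(ih1 v); by case: (iter i TF (x, v)).
Qed.

(** The derivative of the sum is the sum of the same kind for the tangent map
    and the derivative of [h].  To see this, the terms are compared through the
    mean value theorem with their derivatives, whose decay is the orbit bound
    for the tangent map; linearity in the vector extends that bound from small
    vectors to all of them. *)
Theorem orbit_sum_Ck k d V (N : V -> R) (A : set V) F h (c : nat -> R) (q l C : R) :
  eqnorm N -> metric_open A -> A 0 -> 0 <= q < 1 -> 0 <= l -> l * q ^+ d < 1 ->
  (forall i, `|c i| <= C * l ^+ i) ->
  contraction_Ck k q N A F -> order_Ck k d A h ->
  exists2 e : R, 0 < e &
    (forall x, N x < e -> A x) /\ Ck k [set x | N x < e] (orbit_sum c F h).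
Proof.
move=> + + + hq l0 lq hc.
have q0 : 0 <= q by case/andP: hq.
have ht : 0 <= l * q ^+ d < 1 by rewrite lq mulr_ge0 // exprn_ge0.
set th := l * q ^+ d in lq ht *.
elim: k V N A F h => [|k ih] V N A F h hN oA A0 hF hh.
  have [e e0 [K K0 hK]] := orbit_bound hN oA A0 hq l0 hc (contraction_Ck_contr hF) (order_Ck_ord hh).
  have hKb y i : N y < e -> `|c i * h (iter i F y)| <= K * th ^+ i.
    by move=> ye; have [] := hK y i ye.
  exists e => //; split=> [x xe|x /= xe]; first by have [] := hK x 0%N xe.
  move=> r r0; have [n hn] := geo_small K ht (divr_gt0 r0 (ltr0n _ 3)).
  have hS : cont_at (fun y => series (fun i => c i * h (iter i F y)) n) x.
    have : Ck 0 [set x] (fun y => \sum_(i <- index_iota 0 n) c i * h (iter i F y)).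
      apply: Ck_sum => i; apply: Ck_mul; first exact: Ck_cst.
      move=> _ ->; apply: (@cont_comp _ _ _ _ h (iter i F)).
        by apply: (order_Ck_cont hh); have [] := hK x i xe.
      elim: i => [|i ihi]; first by apply: strict_diff_cont (bounded_linear_strict_diff _ (bounded_linear_id V)).
      apply: (@cont_comp _ _ _ _ F (iter i F)) => //.
      by apply: (contraction_Ck_cont hF); have [] := hK x i xe.
    by apply.
  have [s s0 hs] := hS (r / 3) (divr_gt0 r0 (ltr0n _ 3)).
  have [s' s'0 hs'] := metric_open_eqnorm hN xe.
  exists (Num.min s s'); first by rewrite lt_min s0.
  move=> y; rewrite lt_min => /andP[/hs H1 /hs' /= ye].
  have H2 := geo_series_tail n ht (fun i => hKb x i xe).
  have H3 := geo_series_tail n ht (fun i => hKb y i ye).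
  rewrite /orbit_sum.
  set a := limn _ in H2 *; set b := limn _ in H3 *.
  set a' := series (fun i => c i * h (iter i F x)) n in H1 H2.
  set b' := series (fun i => c i * h (iter i F y)) n in H1 H3.
  have -> : b - a = (b - b') + (b' - a') - (a - a') by ring.
  apply: (le_trans (ler_normB _ _)); have := ler_normD (b - b') (b' - a').
  lra.
have [e e0 [K K0 hK]] := orbit_bound hN oA A0 hq l0 hc (contraction_Ck_contr hF) (order_Ck_ord hh).
have hKb y i : N y < e -> `|c i * h (iter i F y)| <= K * th ^+ i.
  by move=> ye; have [] := hK y i ye.
case: hF => hF0 [F1 hF1 hF]; case: hh => hh0 [h1 hh1 hh].
set TF := (fun p : V * V => (F p.1, F1 p)) in hF.
have hN2 := eqnorm_pair hN.
have oA2 : metric_open [set p : V * V | A p.1] by apply: metric_open_fst.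
have [e1 e10 [eA hW1]] := ih _ _ _ _ _ hN2 oA2 A0 hF hh.
have [e2 e20 [K2 K20 hK2]] := orbit_bound hN2 oA2 A0 hq l0 hc (contraction_Ck_contr hF) (order_Ck_ord hh).
have N0 x : 0 <= N x by apply: eqnorm_ge0.
case: (hN) => hZ hD [b b0 hb] _.
pose m := Num.min e (Num.min e1 e2).
have m0 : 0 < m by rewrite !lt_min e0 e10.
have mA x : N x < m -> A x.
  by rewrite lt_min => /andP[xe _]; have [] := hK x 0%N xe.
pose f i x := c i * h (iter i F x).
pose f1 i (p : V * V) := c i * h1 (iter i TF p).
have frechet_diff_f x i : N x < m -> strict_diff (f i) x (fun v => f1 i (x, v)).
  rewrite lt_min => /andP[xe _].
  have hA j : A (iter j F x) by have [] := hK x j xe.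
  have [H1 H2] := strict_diff_iter hF1 hA i.
  have H3 := strict_diff_comp (hh1 _ (hA i)) H2.
  have := strict_diff_scale (cst_strict_diff (c i) x) H3 => /strict_diff_ext; apply => v /=.
  rewrite scale0r add0r /f1 -(H1 v) /TF.
  by case: (iter i _ (x, v)).
pose K3 := K2 * (2 * (b + 1) / e2).
have K30 : 0 <= K3 by rewrite !mulr_ge0 ?invr_ge0 // ?addr_ge0 ?(ltW b0) ?(ltW e20).
have Lip1 x i v : N x < m -> `|f1 i (x, v)| <= K3 * `|v| * th ^+ i.
  move=> xm; have lin := (frechet_diff_f x i xm).1.
  have [->|v0] := eqVneq v 0.
    by have := bounded_linear0 lin; rewrite /= => ->; rewrite !normr0 mulr0 mul0r.
  have nv : 0 < `|v| by rewrite normr_gt0.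
  pose s := e2 / (2 * (b + 1) * `|v|).
  have b1 : 0 < b + 1 by rewrite addr_gt0.
  have s0 : 0 < s by rewrite divr_gt0 // !mulr_gt0.
  have H : pairN N (x, s *: v) < e2.
    rewrite /pairN /= gt_max; apply/andP; split.
      by move: xm; rewrite !lt_min => /and3P[].
    rewrite hZ gtr0_norm //; apply: (@le_lt_trans _ _ (s * (b * `|v|))).
      by rewrite ler_pM2l.
    rewrite /s; rewrite mulrAC ltr_pdivrMr ?mulr_gt0 // ltr_pM2l //.
    by have := mulr_gt0 b0 nv; nra.
  have [_ _] := hK2 (x, s *: v) i H.
  rewrite -/(f1 i (x, s *: v)) -/th.
  have -> : f1 i (x, s *: v) = s * f1 i (x, v) by exact: (bounded_linearZ s v lin).
  rewrite normrM gtr0_norm // mulrC -ler_pdivlMr // => /le_trans; apply.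
  rewrite /K3 /s le_eqVlt; apply/orP; left; apply/eqP; field.
  by rewrite !gt_eqF.
have Lip x y i : N x < m -> N y < m -> `|f i y - f i x| <= K3 * `|y - x| * th ^+ i.
  move=> xm ym.
  have seg t : 0 <= t <= 1 -> frechet_diff (f i) (x + t *: (y - x))
      (fun v => f1 i (x + t *: (y - x), v)).
    by move=> t01; apply: strict_diff_frechet_diff; apply: frechet_diff_f; apply: eqnorm_segment.
  have [t /andP[t0 t1]] := mvt_line seg.
  rewrite [x + _]addrC subrK => ->.
  by apply: Lip1; apply: eqnorm_segment => //; rewrite !ltW.
exists m => //; split=> //.
exists (orbit_sum c TF h1).
  move=> x /= xm; split.
    split=> [a u v|].
      have cu w := geo_series_cvg ht (fun i => Lip1 x i w xm).
      transitivity (limn (series (fun i => a * f1 i (x, u) + f1 i (x, v)))).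
        congr (limn (series _)); apply/funext => i.
        exact: ((frechet_diff_f x i xm).1.1 a u v).
      exact: lim_series_lin.
    exists (K3 / (1 - th)); first by rewrite divr_ge0 // subr_ge0; case/andP: ht => _ /ltW.
    move=> v; have := geo_series_tail 0 ht (fun i => Lip1 x i v xm).
    rewrite /series /= big_nil subr0 mulr1 => H.
    by rewrite mulrAC.
  move=> r r0.
  have [n hn] := geo_small (2 * K3) ht (divr_gt0 r0 (ltr0n _ 2)).
  have hS : strict_diff (fun y => \sum_(i <- index_iota 0 n) f i y) x
      (fun v => \sum_(i <- index_iota 0 n) f1 i (x, v)).
    elim: (index_iota 0 n) => [|i s ihs].
      have -> : (fun y => \sum_(i <- [::]) f i y) = fun=> 0.
        by apply/funext => y; rewrite big_nil.
      by apply: strict_diff_ext (cst_strict_diff 0 x) _ => v; rewrite big_nil.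
    have -> : (fun y => \sum_(j <- i :: s) f j y) = fun y => f i y + \sum_(j <- s) f j y.
      by apply/funext => y; rewrite big_cons.
    by apply: strict_diff_ext (strict_diff_add (frechet_diff_f x i xm) ihs) _ => v; rewrite big_cons.
  have [s s0 hs] := hS.2 (r / 2) (divr_gt0 r0 (ltr0n _ 2)).
  have [s' s'0 hs'] := metric_open_eqnorm hN xm.
  exists (Num.min s s'); first by rewrite lt_min s0.
  move=> y z; rewrite !lt_min => /andP[ys /hs' /= ym] /andP[zs /hs' /= zm].
  have H1 := hs y z ys zs.
  have me y' : N y' < m -> N y' < e by rewrite lt_min => /andP[].
  have cf y' : N y' < m -> cvgn (series (fun i => f i y')).
    by move=> /me ye; apply: (geo_series_cvg ht (fun i => hKb y' i ye)).
  have cf1 w := geo_series_cvg ht (fun i => Lip1 x i w xm).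
  pose t i := -1 * (1 * f1 i (x, y - z) + f i z) + f i y.
  have ct : cvgn (series (fun i => 1 * f1 i (x, y - z) + f i z)).
    have -> : (fun i => 1 * f1 i (x, y - z) + f i z) = (fun i => f1 i (x, y - z)) + f ^~ z.
      by apply/funext => i; rewrite mul1r.
    by apply: is_cvg_seriesD => //; apply: cf.
  have E : orbit_sum c F h y - orbit_sum c F h z - orbit_sum c TF h1 (x, y - z)
      = limn (series t).
    rewrite /t lim_series_lin // ?lim_series_lin //; [|exact: cf..].
    rewrite /orbit_sum /f /f1; ring.
  have tb i : `|t i| <= 2 * K3 * `|y - z| * th ^+ i.
    have := Lip1 x i (y - z) xm; have := Lip z y i zm ym.
    have -> : t i = (f i y - f i z) - f1 i (x, y - z) by rewrite /t; ring.
    by move=> a1 a2; apply: (le_trans (ler_normB _ _)); lra.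
  have H2 := geo_series_tail n ht tb.
  rewrite E -(subrK (series t n) (limn _)).
  apply: (le_trans (ler_normD _ _)).
  have -> : r * `|y - z| = r / 2 * `|y - z| + r / 2 * `|y - z| by lra.
  apply: lerD.
    apply: (le_trans H2).
    have -> : 2 * K3 * `|y - z| * th ^+ n / (1 - th) = (2 * K3 * th ^+ n / (1 - th)) * `|y - z| by ring.
    exact: ler_wpM2r.
  apply: le_trans H1; rewrite le_eqVlt; apply/orP; left; apply/eqP; congr (`|_|).
  rewrite /series /= -!sumrB; apply: eq_bigr => i _; rewrite /t; ring.
(* The induction hypothesis covers small vectors; the sets [As s] exhaust the
   others by rescaling. *)
pose As (s : {posnum R}) := [set p : V * V | N p.1 < m /\ N (s%:num *: p.2) < e1].
have oAs s : metric_open (As s).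
  move=> p [p1 p2].
  have [r1 r10 hr1] := metric_open_eqnorm hN p1; have [r2 r20 hr2] := metric_open_eqnorm hN p2.
  exists (Num.min r1 (r2 / s%:num)); first by rewrite lt_min r10 divr_gt0.
  move=> p'; rewrite lt_min => /andP[pp1 pp2]; split.
    apply: hr1; apply: le_lt_trans pp1; exact: (le_norm1 (p' - p)).
  apply: hr2; rewrite -scalerBr normrZ gtr0_norm // mulrC -ltr_pdivlMr //.
  apply: le_lt_trans pp2; exact: (le_norm2 (p' - p)).
have TAs s : Ck k (As s) (orbit_sum c TF h1).
  apply: (@Ck_ext _ _ _ _ _ (fun p => s%:num^-1 *: orbit_sum c TF h1 (p.1, s%:num *: p.2))).
  - exact: oAs.
  - move=> [x v] [/= xm _].
    have cu w := geo_series_cvg ht (fun i => Lip1 x i w xm).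
    have -> : orbit_sum c TF h1 (x, s%:num *: v) = s%:num * orbit_sum c TF h1 (x, v).
      rewrite /orbit_sum.
      have := lim_series_lin (s%:num) (cu v) (cu 0).
      have E0 : (fun i => f1 i (x, 0)) = fun=> 0.
        by apply/funext => i; apply: (bounded_linear0 (frechet_diff_f x i xm).1).
      rewrite E0.
      have -> : limn (series (fun=> 0 : R)) = 0.
        apply: cvg_lim => //.
        have -> : series (fun=> 0 : R) = fun=> 0.
          by apply/funext => n; rewrite /series /= big1.
        exact: cvg_cst.
      rewrite addr0 => <-; congr (limn (series _)); apply/funext => i.
      have -> : f1 i (x, 0) = 0 by rewrite -[LHS]/((f1 ^~ (x, 0)) i) E0.
      by rewrite addr0; apply: (bounded_linearZ s%:num v (frechet_diff_f x i xm).1).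
    by rewrite /GRing.scale /= mulrA mulVf ?mul1r.
  apply: Ck_cscale.
  apply: (@Ck_comp _ k _ _ _ _ _ (orbit_sum c TF h1) (fun p : V * V => (p.1, s%:num *: p.2))) hW1 _.
    move=> [x v] [/= xm vm]; rewrite /pairN /= gt_max vm andbT.
    by move: xm; rewrite !lt_min => /and3P[].
  apply: Ck_lin; apply: bounded_linear_pair; first exact: bounded_linear_fst.
  exact/bounded_linear_scale/bounded_linear_snd.
apply: Ck_sub (Ck_bigcup oAs TAs) => -[x v] /= xm.
have v1 : 0 < N v + 1 by rewrite ltr_wpDl.
have s0 : 0 < e1 / (N v + 1) by rewrite divr_gt0.
exists (PosNum s0); split=> //=.
rewrite hZ gtr0_norm // mulrAC ltr_pdivrMr // ltr_pM2l //.
by rewrite ltrDl.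
Qed.

Lemma orbit_sum_order d V (N : V -> R) (A : set V) F h (c : nat -> R) (q l C : R) :
  eqnorm N -> metric_open A -> A 0 -> 0 <= q < 1 -> 0 <= l -> l * q ^+ d < 1 ->
  (forall i, `|c i| <= C * l ^+ i) ->
  (exists2 e : R, 0 < e & forall x, N x < e -> N (F x) <= q * N x) ->
  bigO d h -> bigO d (orbit_sum c F h).
Proof.
move=> hN oA A0 hq l0 lq hc hF hh.
have [e /andP[e0 _] [K K0 hK]] := orbit_decay hN oA A0 hq l0 hc hF hh.
have ht : 0 <= l * q ^+ d < 1 by rewrite lq mulr_ge0 // exprn_ge0 //; case/andP: hq.
have t1 : 0 < 1 - l * q ^+ d by rewrite subr_gt0.
case: (hN) => _ _ [b b0 hb] _; have N0 x : 0 <= N x by apply: eqnorm_ge0.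
exists (K * b ^+ d / (1 - l * q ^+ d)).
  by rewrite divr_ge0 ?(ltW t1) // mulr_ge0 // exprn_ge0 // ltW.
exists (e / b) => [|x xe]; first by rewrite divr_gt0.
have Nx : N x < e by apply: le_lt_trans (hb x) _; rewrite mulrC -ltr_pdivlMr.
have hb' i : `|c i * h (iter i F x)| <= K * N x ^+ d * (l * q ^+ d) ^+ i.
  by have [] := hK x i Nx.
have := geo_series_tail 0 ht hb'.
rewrite /series /= big_nil subr0 mulr1 => H; apply: (le_trans H).
rewrite [leRHS]mulrAC ler_wpM2r ?invr_ge0 ?(ltW t1) // -mulrA -exprMn ler_wpM2l //.
by rewrite lerXn2r ?nnegrE // mulr_ge0 // ltW.
Qed.

(** The coefficients will be the real and imaginary parts of a geometric
    sequence, hence the coupled recursion. *)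
Lemma orbit_sum_shift V (F : V -> V) (h : V -> R) (a b : nat -> R) (al be : R) x :
  (forall i, a i.+1 = al * a i + be * b i) ->
  cvgn (series (fun i => a i * h (iter i F x))) ->
  cvgn (series (fun i => a i * h (iter i F (F x)))) ->
  cvgn (series (fun i => b i * h (iter i F (F x)))) ->
  orbit_sum a F h x = a 0%N * h x + al * orbit_sum a F h (F x) + be * orbit_sum b F h (F x).
Proof.
move=> ab c0 ca cb; rewrite /orbit_sum.
set t := fun i => a i * h (iter i F x) in c0 *.
have c1 : cvgn (series (fun i => t i.+1)).
  have -> : (fun i => t i.+1) = (fun i => al * (a i * h (iter i F (F x))) +
      be * (b i * h (iter i F (F x)))).
    by apply/funext => i; rewrite /t ab iterSr; ring.
  have cb' := @is_cvg_seriesZ _ _ be cb.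
  exact: (is_cvg_seriesD (@is_cvg_seriesZ _ _ al ca) cb').
have -> : limn (series t) = t 0%N + limn (series (fun i => t i.+1)).
  apply: cvg_lim => //; rewrite -cvg_shiftS /=.
  have -> : (fun n => series t n.+1) = (fun n => t 0%N + series (fun i => t i.+1) n).
    apply/funext => m; rewrite /series /= big_nat_recl //.
  by apply: cvgD => //; exact: cvg_cst.
rewrite /t /= -addrA; congr (_ + _).
have -> : (fun i => t i.+1) = (fun i => al * (a i * h (iter i F (F x))) +
      (be * (b i * h (iter i F (F x))) + 0)).
  by apply/funext => i; rewrite /t ab iterSr; ring.
have c00 : cvgn (series (fun=> 0 : R)).
  have -> : series (fun=> 0 : R) = fun=> 0 by apply/funext => m; rewrite /series /= big1.
  exact: is_cvg_cst.
have cb' : cvgn (series (fun i => be * (b i * h (iter i F (F x))) + 0)).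
  have -> : (fun i => be * (b i * h (iter i F (F x))) + 0) = be *: (fun i => b i * h (iter i F (F x)) : R).
    by apply/funext => i; rewrite addr0.
  exact: is_cvg_seriesZ.
rewrite lim_series_lin // lim_series_lin //.
have -> : limn (series (fun=> 0 : R)) = 0.
  have -> : series (fun=> 0 : R) = fun=> 0 by apply/funext => m; rewrite /series /= big1.
  by rewrite lim_cst.
by rewrite addr0.
Qed.

End SeriesThm.

(** * Contraction rates of iterated tangent maps *)

Section Orders.
Context (R : realType).
Implicit Types U V W : normedModType R.

(** Compare the two difference quotients along a short segment starting at the
    nearby point. *)
Lemma strict_diff_close V W (f : V -> W) x0 L : strict_diff f x0 L ->
  forall e : R, 0 < e -> exists2 d : R, 0 < d &
    forall x K, `|x - x0| < d -> frechet_diff f x K -> forall v, `|K v - L v| <= e * `|v|.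
Proof.
move=> [hL h] e e0; have [d d0 hd] := h (e / 2) (divr_gt0 e0 (ltr0n _ 2)).
exists d => // x K xd [hK k] v.
have [d' d'0 hd'] := k (e / 2) (divr_gt0 e0 (ltr0n _ 2)).
have v1 : 0 < `|v| + 1 by rewrite ltr_wpDl.
pose r := Num.min d' (d - `|x - x0|).
have r0 : 0 < r by rewrite lt_min d'0 subr_gt0.
pose t := r / (`|v| + 1).
have t0 : 0 < t by rewrite divr_gt0.
have tv : `|t *: v| < r.
  rewrite normrZ gtr0_norm // mulrAC ltr_pdivrMr // ltr_pM2l //.
  by rewrite ltrDl.
move: (tv); rewrite lt_min => /andP[tv1 tv2].
have E : x + t *: v - x = t *: v by rewrite addrC addKr.
have H1 := hd' (x + t *: v); rewrite E in H1; have {}H1 := H1 tv1.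
have H2 := hd (x + t *: v) x; rewrite E in H2.
have {}H2 : `|f (x + t *: v) - f x - L (t *: v)| <= e / 2 * `|t *: v|.
  apply: H2 => //; rewrite addrAC; apply: le_lt_trans (ler_normD _ _) _.
  by rewrite -ltrBrDl.
have : `|K (t *: v) - L (t *: v)| <= e * `|t *: v|.
  have -> : K (t *: v) - L (t *: v) = (f (x + t *: v) - f x - L (t *: v)) -
     (f (x + t *: v) - f x - K (t *: v)).
    by rewrite opprB [RHS]addrC subrKA.
  by apply: (le_trans (ler_normB _ _)); lra.
clearbody t; rewrite (bounded_linearZ t v hK) (bounded_linearZ t v hL) -scalerBr !normrZ (gtr0_norm t0).
by rewrite mulrCA ler_pM2l.
Qed.

Lemma frechet_diff_contr V (N : V -> R) (F L : V -> V) (rho q : R) :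
  eqnorm N -> frechet_diff F 0 L -> F 0 = 0 -> (forall v, N (L v) <= rho * N v) -> rho < q ->
  exists2 e : R, 0 < e & forall x, N x < e -> N (F x) <= q * N x.
Proof.
move=> hN [hL h] F0 hr rq; case: (hN) => hZ hD [c c0 hc] [b b0 hb].
have qr : 0 < q - rho by rewrite subr_gt0.
have [d d0 hd] := h ((q - rho) / (c * b)) ltac:(by rewrite divr_gt0 // mulr_gt0).
exists (d / b) => [|x xd]; first by rewrite divr_gt0.
have xd' : `|x - 0| < d.
  by rewrite subr0; apply: le_lt_trans (hb _) _; rewrite mulrC -ltr_pdivlMr.
have := hd x xd'; rewrite F0 !subr0 => H.
rewrite -(subrK (L x) (F x)); apply: (le_trans (hD _ _)).
have -> : q * N x = (q - rho) * N x + rho * N x by ring.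
apply: lerD => //; apply: (le_trans (hc _)).
apply: (@le_trans _ _ (c * ((q - rho) / (c * b) * `|x|))); first by rewrite ler_pM2l.
apply: (@le_trans _ _ (c * ((q - rho) / (c * b) * (b * N x)))).
  by rewrite ler_pM2l // ler_pM2l // divr_gt0 // mulr_gt0.
rewrite le_eqVlt; apply/orP; left; apply/eqP; field.
by rewrite !gt_eqF.
Qed.

(** The derivative [F1] vanishes on zero vectors and is close to [L] in the
    vector near the fixed point, so its derivative at the origin only sees the
    vector.  The linear part therefore keeps its contraction rate when passing
    to tangent maps. *)
Lemma tangent_map_strict_diff V (F L : V -> V) (F1 : V * V -> V) (A : set V) M :
  metric_open A -> A 0 -> (forall x, A x -> strict_diff F x (fun v => F1 (x, v))) ->
  strict_diff F 0 L -> strict_diff F1 0 M ->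
  strict_diff (fun p : V * V => (F p.1, F1 p)) 0 (fun p => (L p.1, L p.2)).
Proof.
move=> oA A0 hF hL hM.
have hE p : M p = L p.2.
  apply/eqP; rewrite -subr_eq0 -normr_le0; apply/ler_addgt0Pr => e e0; rewrite add0r.
  have p1 : 0 < `|p| + 1 by rewrite ltr_wpDl.
  pose r := e / 2 / (`|p| + 1).
  have r0 : 0 < r by rewrite !divr_gt0.
  have [d1 d10 h1] := (strict_diff_frechet_diff hM).2 r r0.
  have [d2 d20 h2] := strict_diff_close hL r0.
  have [d3 d30 h3] := oA 0 A0.
  pose m := Num.min d1 (Num.min d2 d3).
  have m0 : 0 < m by rewrite !lt_min d10 d20.
  pose t := m / (`|p| + 1).
  have t0 : 0 < t by rewrite divr_gt0.
  have tp : `|t *: p| < m.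
    rewrite normrZ gtr0_norm // mulrAC ltr_pdivrMr // ltr_pM2l //.
    by rewrite ltrDl.
  move: (tp); rewrite !lt_min => /and3P[tp1 tp2 tp3].
  have ta2 : `|(t *: p).1 - 0| < d2.
    by rewrite subr0; apply: le_lt_trans tp2; apply: le_norm1.
  have ta3 : `|(t *: p).1 - 0| < d3.
    by rewrite subr0; apply: le_lt_trans tp3; apply: le_norm1.
  have A1 := h3 _ ta3.
  have H2 := h2 _ _ ta2 (strict_diff_frechet_diff (hF _ A1)) p.2.
  have H1 := h1 (t *: p); rewrite subr0 in H1; have {}H1 := H1 tp1.
  have F10 : F1 0 = 0 by apply: (bounded_linear0 (hF 0 A0).1).
  have E : F1 (t *: p) = t *: F1 ((t *: p).1, p.2).
    exact: (bounded_linearZ t p.2 (hF _ A1).1).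
  clearbody t; rewrite F10 subr0 E (bounded_linearZ t p hM.1) -scalerBr !normrZ (gtr0_norm t0) mulrCA ler_pM2l // in H1.
  have -> : M p - L p.2 = (F1 ((t *: p).1, p.2) - L p.2) - (F1 ((t *: p).1, p.2) - M p).
    by rewrite opprB [RHS]addrC subrKA.
  apply: (le_trans (ler_normB _ _)).
  have H3 := le_norm2 p.
  have : r * `|p| <= e / 2.
    by rewrite /r mulrAC ler_pdivrMr // ler_pM2l ?divr_gt0 // lerDl.
  have : r * `|p.2| <= r * `|p| by rewrite ler_pM2l.
  lra.
apply: strict_diff_ext (strict_diff_pair (strict_diff_comp _ _) hM) _; last by move=> p; rewrite hE.
  exact: hL.
exact/bounded_linear_strict_diff/bounded_linear_fst.
Qed.

(** Any rate above that of the linear part is reached near the fixed point, and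
    tangent maps have the linear part [L] on both factors; the induction
    applies to them. *)
Lemma Ck_contraction_Ck k V (N : V -> R) (A : set V) (F L : V -> V) (rho q : R) :
  eqnorm N -> metric_open A -> A 0 -> F 0 = 0 -> strict_diff F 0 L ->
  (forall v, N (L v) <= rho * N v) -> 0 <= rho < q ->
  Ck k.+1 A F -> contraction_Ck k.+1 q N A F.
Proof.
elim: k V N A F L => [|k ih] V N A F L hN oA A0 F0 hL hr /[dup] hrq /andP[r0 rq] hF.
  case: hF => F1 hF1 hF; split; first exact: (frechet_diff_contr hN (strict_diff_frechet_diff hL) F0 hr rq).
  exists F1 => //; split; last first.
    move=> p Ap; apply: cont_pair; last exact: hF.
    apply: (@cont_comp _ _ _ _ F (fun p => p.1)).
      exact: strict_diff_cont (hF1 _ Ap).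
    exact: strict_diff_cont (bounded_linear_strict_diff _ (bounded_linear_fst V V)).
  have [e e0 he] := frechet_diff_contr hN (strict_diff_frechet_diff hL) F0 hr rq.
  case: (hN) => hZ hD [c c0 hc] [b b0 hb].
  have qr : 0 < q - rho by rewrite subr_gt0.
  have [d d0 hd] := strict_diff_close hL (divr_gt0 qr (mulr_gt0 c0 b0)).
  have [d' d'0 hd'] := oA 0 A0.
  exists (Num.min e (Num.min (d / b) (d' / b))); first by rewrite !lt_min e0 !divr_gt0.
  move=> [x v]; rewrite /pairN /= !lt_min !gt_max => /and3P[/andP[xe _] /andP[xd _] /andP[xd' _]].
  have sm r : N x < r / b -> `|x - 0| < r.
    by rewrite subr0 ltr_pdivlMr // mulrC; apply: le_lt_trans.
  have Ax := hd' _ (sm _ xd').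
  have H := hd x _ (sm _ xd) (strict_diff_frechet_diff (hF1 x Ax)) v.
  rewrite ge_max; apply/andP; split.
    apply: (le_trans (he x xe)).
    by rewrite ler_wpM2l ?le_max ?lexx // ltW // (le_lt_trans r0).
  have H2 : N (F1 (x, v)) <= q * N v.
    rewrite -(subrK (L v) (F1 (x, v))); apply: (le_trans (hD _ _)).
    have -> : q * N v = (q - rho) * N v + rho * N v by ring.
    apply: lerD => //; apply: (le_trans (hc _)).
    apply: (@le_trans _ _ (c * ((q - rho) / (c * b) * `|v|))); first by rewrite ler_pM2l.
    apply: (@le_trans _ _ (c * ((q - rho) / (c * b) * (b * N v)))).
      by rewrite ler_pM2l // ler_pM2l // divr_gt0 // mulr_gt0.
    rewrite le_eqVlt; apply/orP; left; apply/eqP; field.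
    by rewrite !gt_eqF.
  apply: (le_trans H2).
  by rewrite ler_wpM2l ?le_max ?lexx ?orbT // ltW // (le_lt_trans r0).
have hF' := Ck_S hF; case: hF => F1 hF1 hF.
split; first exact: (frechet_diff_contr hN (strict_diff_frechet_diff hL) F0 hr rq).
exists F1 => //.
have hM : exists M, strict_diff F1 0 M by case: (hF) => F2 hF2 _; exists (fun v => F2 (0, v)); apply: hF2.
case: hM => M hM.
apply: (ih _ _ _ _ (fun p => (L p.1, L p.2))).
- exact: eqnorm_pair.
- exact: metric_open_fst.
- exact: A0.
- by rewrite /= F0; congr pair; apply: (bounded_linear0 (hF1 0 A0).1).
- exact: (tangent_map_strict_diff oA A0 hF1 hL hM).
- move=> p; rewrite /pairN /=.
  rewrite ge_max; apply/andP; split; apply: (le_trans (hr _)); rewrite ler_wpM2l // le_max lexx ?orbT //.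
- exact: hrq.
- have hF2 : Ck k.+1 [set p : V * V | A p.1] F1 by exact: hF.
  have hF3 := @Ck_fst R k.+1 V V V A F hF'.
  exact: Ck_pair hF3 hF2.
Qed.

End Orders.

(** * Leading parts at the origin *)

Section TaylorOrders.
Context (R : realType) (n : nat).
Local Notation V := ('rV[R]_n : normedModType R).

Lemma coord_le (x : 'rV[R]_n) i : `|x 0 i| <= `|x|.
Proof.
rewrite [leRHS]mx_normrE.
exact: (le_bigmax_cond _ (fun ij : 'I_1 * 'I_n => `|x ij.1 ij.2|) (j := (0, i))).
Qed.

Lemma rV_norm_le (x : 'rV[R]_n) (M : R) : 0 <= M -> (forall i, `|x 0 i| <= M) -> `|x| <= M.
Proof.
move=> M0 h; rewrite [leLHS]mx_normrE; apply/bigmax_leP; split=> // -[j i] _ /=.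
by rewrite ord1.
Qed.

Lemma bounded_linear_coord i : bounded_linear (fun x : V => x 0 i : R).
Proof.
split=> [a u v|]; first by rewrite !mxE.
by exists 1 => // v; rewrite mul1r; apply: coord_le.
Qed.

Lemma rV_delta_sum (x : 'rV[R]_n) : x = \sum_i x 0 i *: delta_mx 0 i.
Proof. exact: row_sum_delta. Qed.

(** Differentiability only, as opposed to [Ck]: leading parts at the origin exist
    at this level. *)
Fixpoint Dk (k : nat) (A : set V) (f : V -> R) : Prop :=
  if k is k'.+1 then
    exists2 g : 'I_n -> V -> R,
      (forall x, A x -> frechet_diff f x (fun v : V => \sum_i v 0 i * g i x)) &
      forall i, Dk k' A (g i)
  else True.

Lemma Dk_S k A f : Dk k.+1 A f -> Dk k A f.
Proof.
elim: k f => [|k ih] f //= [g h1 h2]; exists g => // i; exact: ih.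
Qed.

Lemma Dk_le k l A f : (k <= l)%N -> Dk l A f -> Dk k A f.
Proof.
move=> kl; rewrite -(subnK kl); elim: (l - k)%N => [|m ih] //.
by rewrite addSn => /Dk_S.
Qed.

(** Homogeneous polynomials of degree [e], presented through the linear forms so
    that a function with homogeneous partial derivatives is handled at once. *)
Fixpoint hpoly (e : nat) (q : V -> R) : Prop :=
  if e is e'.+1 then
    exists2 p : 'I_n -> V -> R, (forall i, hpoly e' (p i)) &
      forall x, q x = \sum_i x 0 i * p i x
  else exists c, forall x, q x = c.

Lemma hpolyZ e q (c : R) : hpoly e q -> hpoly e (fun x => c * q x).
Proof.
elim: e q => [|e ih] q /=; first by case=> b hb; exists (c * b) => x; rewrite hb.
case=> p h1 h2; exists (fun i x => c * p i x) => [i|x]; first exact: ih.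
by rewrite h2 mulr_sumr; apply: eq_bigr => i _; rewrite mulrCA.
Qed.

Lemma hpoly_hom e q (t : R) x : hpoly e q -> q (t *: x) = t ^+ e * q x.
Proof.
elim: e q => [|e ih] q /=; first by case=> b hb; rewrite !hb mul1r.
case=> p h1 h2; rewrite !h2 mulr_sumr; apply: eq_bigr => i _.
by rewrite (ih _ (h1 i)) mxE exprS; ring.
Qed.

Lemma hpoly_cont e q x : hpoly e q -> cont_at q x.
Proof.
move=> hq; suff h : Ck 0 setT q by exact: h.
elim: e q hq => [|e ih] q /=.
  by case=> b hb y _; rewrite (_ : q = fun=> b); [apply: strict_diff_cont (cst_strict_diff b y)|apply/funext].
case=> p h1 h2.
have -> : q = fun x => \sum_i x 0 i * p i x by apply/funext.
by apply: (Ck_sum (k := 0)) => i; apply: (Ck_mul (k := 0)); [apply/Ck_lin/bounded_linear_coord|apply: ih].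
Qed.

Lemma cont_bigO (W : normedModType R) (f : W -> R) : cont_at f 0 -> bigO 0 f.
Proof.
move=> /(_ 1 ltr01)[d d0 h]; exists (`|f 0| + 1); first exact: addr_ge0.
exists d => // x xd; rewrite expr0 mulr1 -(subrK (f 0) (f x)).
apply: (le_trans (ler_normD _ _)); rewrite addrC lerD2l.
by apply: h; rewrite subr0.
Qed.

(** A statement for one degree, to be proved by strong induction together with
    the bound on partial derivatives. *)
Definition leading e := forall (f : V -> R) (A : set V), metric_open A -> A 0 -> Dk e.+1 A f ->
  bigO e f -> exists2 q, hpoly e q & bigO e.+1 (fun x => f x - q x).

(** If a partial derivative had a nonzero leading part [q] of a lower degree,
    then [q] would be bounded below near some point [x]; by the mean value
    theorem on the segment from [t x] to [t (x + r e_i)], this would show up in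
    [f] with a power of [t] that its order excludes. *)
Lemma derivative_order d f (g : 'I_n -> V -> R) (A : set V) :
  (forall e, (e < d)%N -> leading e) -> metric_open A -> A 0 ->
  (forall x, A x -> frechet_diff f x (fun v : V => \sum_i v 0 i * g i x)) ->
  (forall i, Dk d A (g i)) -> (forall i, bigO 0 (g i)) ->
  bigO d.+1 f -> forall i, bigO d (g i).
Proof.
move=> LT oA A0 hf hg hg0 [C1 C10 [e1 e10 h1]] i.
suff H e : (e <= d)%N -> bigO e (g i) by apply: H.
elim: e => [|e ih] ed; first exact: hg0.
have [q hq [C2 C20 [e2 e20 h2]]] := LT e ed _ _ oA A0 (Dk_le ed (hg i)) (ih (ltnW ed)).
suff q0 x : q x = 0.
  by exists C2 => //; exists e2 => // x xe; have := h2 x xe; rewrite q0 subr0.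
apply/eqP; apply: contraT => qx.
pose c := `|q x| / 2.
have c0 : 0 < c by rewrite divr_gt0 // normr_gt0.
have [s s0 hs] := hpoly_cont x hq c0.
pose ei : V := delta_mx 0 i.
have ei1 : `|ei| <= 1.
  apply: rV_norm_le => // j; rewrite mxE eqxx /=.
  by case: (j == i); rewrite ?normr1 ?normr0.
pose r := Num.min s 1 / 2.
have r0 : 0 < r by rewrite divr_gt0 // lt_min s0 ltr01.
have rs : r < s.
  have h : Num.min s 1 <= s by rewrite ge_min lexx.
  by rewrite /r ltr_pdivrMr //; lra.
have r1 : r <= 1.
  have h : Num.min s 1 <= 1 by rewrite ge_min lexx orbT.
  by rewrite /r ler_pdivrMr //; lra.
clearbody r.
have qlow t : 0 <= t <= r -> c <= `|q (x + t *: ei)|.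
  move=> /andP[t0 tr].
  have := hs (x + t *: ei); rewrite addrC addKr normrZ (ger0_norm t0) => H.
  have {}H : `|q (x + t *: ei) - q x| <= c.
    apply: H; apply: le_lt_trans rs; apply: le_trans tr.
    by rewrite -[leRHS]mulr1 ler_wpM2l.
  have := ler_normD (q x - q (x + t *: ei)) (q (x + t *: ei)).
  rewrite subrK distrC => H2; rewrite /c in H *; lra.
pose M := `|x| + 1.
have M0 : 0 < M by rewrite ltr_wpDl.
have ptM t : 0 <= t <= r -> `|x + t *: ei| <= M.
  move=> /andP[t0 tr]; apply: (le_trans (ler_normD _ _)).
  rewrite lerD2l normrZ (ger0_norm t0); apply: le_trans r1; apply: le_trans tr.
  by rewrite -[leRHS]mulr1 ler_wpM2l.
clearbody M; have [e3 e30 h3] := oA 0 A0.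
pose B := r * (C2 * M ^+ e.+1) + 2 * C1 * M ^+ e.+2.
have B0 : 0 <= B.
  have [r0' M0'] := (ltW r0, ltW M0).
  have Mn k : 0 <= M ^+ k by apply: exprn_ge0.
  exact: addr_ge0 (mulr_ge0 r0' (mulr_ge0 C20 (Mn _)))
    (mulr_ge0 (mulr_ge0 (ler0n _ 2) C10) (Mn _)).
pose m := Num.min e1 (Num.min e2 (Num.min e3 1)).
have m0 : 0 < m by rewrite !lt_min e10 e20 e30 ltr01.
have key t : 0 < t -> t * M < m -> r * c <= t * B.
  move=> t0; rewrite !lt_min => /and4P[tm1 tm2 tm3 tm4].
  have pt u : 0 <= u <= r -> `|t *: (x + u *: ei)| <= t * M.
    by move=> hu; rewrite normrZ (gtr0_norm t0) ler_pM2l //; apply: ptM.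
  have seg u : 0 <= u <= 1 -> 0 <= u * r <= r.
    by move=> /andP[u0 u1]; rewrite mulr_ge0 ?(ltW r0) //= ler_piMl // ltW.
  have E u : t *: x + u *: (t *: (r *: ei)) = t *: (x + (u * r) *: ei).
    by rewrite scalerDr !scalerA; congr (_ + _ *: _); ring.
  have hfd u : 0 <= u <= 1 -> frechet_diff f (t *: x + u *: (t *: (r *: ei)))
     (fun v : V => \sum_j v 0 j * g j (t *: x + u *: (t *: (r *: ei)))).
    move=> hu; apply: hf; apply: h3; rewrite subr0 E.
    by apply: le_lt_trans (pt _ (seg u hu)) _.
  have [u hu] := mvt_line hfd.
  rewrite (bigD1 i) //= big1 => [|j ji]; last first.
    by rewrite !mxE eqxx (negPf ji) /= !mulr0 mul0r.
  rewrite addr0 !mxE !eqxx mulr1 E.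
  have hu' : 0 <= u <= 1 by case/andP: hu => /ltW -> /ltW.
  have U := seg u hu'; set w := x + (u * r) *: ei => Ef.
  have wM : `|t *: w| <= t * M by apply: pt.
  have tM0 : 0 <= t * M by rewrite mulr_ge0 ?ltW.
  have b1 : `|f (t *: x + t *: (r *: ei))| <= C1 * (t * M) ^+ e.+2.
    have -> : t *: x + t *: (r *: ei) = t *: (x + r *: ei) by rewrite scalerDr.
    have hr : `|t *: (x + r *: ei)| <= t * M by apply: pt; rewrite lexx ltW.
    apply: (le_trans (h1 _ (le_lt_trans hr tm1))); rewrite ler_wpM2l //.
    apply: (@le_trans _ _ ((t * M) ^+ d.+1)).
      by rewrite lerXn2r ?nnegrE.
    by rewrite ler_wiXn2l // ltW.
  have b2 : `|f (t *: x)| <= C1 * (t * M) ^+ e.+2.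
    have hr : `|t *: x| <= t * M.
      by have := pt 0; rewrite scale0r addr0; apply; rewrite lexx ltW.
    apply: (le_trans (h1 _ (le_lt_trans hr tm1))); rewrite ler_wpM2l //.
    apply: (@le_trans _ _ ((t * M) ^+ d.+1)).
      by rewrite lerXn2r ?nnegrE.
    by rewrite ler_wiXn2l // ltW.
  have b3 : `|g i (t *: w)| >= t ^+ e * c - C2 * (t * M) ^+ e.+1.
    have H := h2 _ (le_lt_trans wM tm2).
    have H' : `|g i (t *: w) - q (t *: w)| <= C2 * (t * M) ^+ e.+1.
      by apply: (le_trans H); rewrite ler_wpM2l // lerXn2r ?nnegrE.
    have H2 : t ^+ e * c <= `|q (t *: w)|.
      rewrite (hpoly_hom _ _ hq) normrM normrX (gtr0_norm t0) ler_pM2l ?exprn_gt0 //.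
      exact: qlow.
    have := ler_normD (q (t *: w) - g i (t *: w)) (g i (t *: w)).
    rewrite subrK distrC; lra.
  have b4 : t * r * `|g i (t *: w)| <= 2 * C1 * (t * M) ^+ e.+2.
    have -> : t * r * `|g i (t *: w)| = `|t * r * g i (t *: w)|.
      by rewrite normrM (gtr0_norm (mulr_gt0 t0 r0)).
    rewrite -Ef.
    by apply: (le_trans (ler_normB _ _)); lra.
  have b5 : t * r * (t ^+ e * c - C2 * (t * M) ^+ e.+1) <= 2 * C1 * (t * M) ^+ e.+2.
    by apply: le_trans b4; rewrite (ler_pM2l (mulr_gt0 t0 r0)).
  rewrite -(ler_pM2l (exprn_gt0 e.+1 t0)).
  move: b5; rewrite /B !exprMn !exprS.
  set te := t ^+ e; set Me := M ^+ e; clearbody te Me => b5.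
  nra.
have tB : 0 < B + 1 by rewrite ltr_wpDl.
pose t := Num.min (m / 2 / M) (r * c / 2 / (B + 1)).
have rc : 0 < r * c by rewrite mulr_gt0.
have t0 : 0 < t by rewrite lt_min !divr_gt0.
have t1 : t * M < m.
  rewrite -ltr_pdivlMr //; apply: (@le_lt_trans _ _ (m / 2 / M)).
    by rewrite ge_min lexx.
  by rewrite ltr_pM2r ?invr_gt0 //; lra.
have := key t t0 t1.
have : t * (B + 1) <= r * c / 2.
  by rewrite -ler_pdivlMr // ge_min lexx orbT.
nra.
Qed.

(** The leading part is obtained by integrating those of the partial
    derivatives along rays (Euler's formula for homogeneous functions). *)
Lemma leading_part e : leading e.
Proof.
elim/ltn_ind: e => -[|e] LT f A oA A0.
  move=> [g hg _] _; exists (fun=> f 0); first by exists (f 0).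
  have [hL h] := hg 0 A0; have [M M0 hM] := hL.2; have [d d0 hd] := h 1 ltr01.
  exists (M + 1); first exact: addr_ge0.
  exists d => // x xd; rewrite expr1.
  have := hd x; rewrite subr0 => /(_ xd); have := hM x; set L := \sum_i _.
  move=> a1 a2; rewrite -(subrK L (f x - f 0)).
  by apply: (le_trans (ler_normD _ _)); lra.
move=> [g hf hg] hord.
have hg0 i : bigO 0 (g i).
  by apply: cont_bigO; have [k hk _] := hg i; apply: frechet_diff_cont (hk 0 A0).
have hge : forall i, bigO e (g i).
  apply: (derivative_order _ oA A0 hf) => //.
  - by move=> e' e'e; apply: LT; rewrite ltnS ltnW.
  - by move=> i; apply: Dk_S.
have hq i : exists q, hpoly e q /\ bigO e.+1 (fun x => g i x - q x).
  by have [q h1 h2] := LT e (ltnSn e) _ _ oA A0 (hg i) (hge i); exists q.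
move: (fin_all_exists hq) => [q hq'].
pose a := (e.+1%:R : R)^-1.
exists (fun x : V => \sum_i x 0 i * (a * q i x)).
  exists (fun i x => a * q i x) => // i; apply: hpolyZ; exact: (hq' i).1.
have hC i : exists C : R, 0 <= C /\ exists2 d : R, 0 < d & forall x : V, `|x| < d ->
    `|g i x - q i x| <= C * `|x| ^+ e.+1.
  by have [C C0 h] := (hq' i).2; exists C.
move: (fin_all_exists hC) => [C hC'] {hC}.
have hd i : exists d : R, 0 < d /\ forall x : V, `|x| < d ->
    `|g i x - q i x| <= C i * `|x| ^+ e.+1.
  by have [_ [d d0 h]] := hC' i; exists d.
move: (fin_all_exists hd) => [d hd'] {hd}.
have [d1 d10 h1] := oA 0 A0.
pose m := \big[Num.min/d1]_i d i.
have m0 : 0 < m.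
  rewrite /m; elim/big_ind: _ => // [x y x0 y0|i _]; first by rewrite lt_min x0.
  exact: (hd' i).1.
have md1 : m <= d1 by apply: bigmin_le_id.
have mdi i : m <= d i by apply: bigmin_le_cond.
have f0 : f 0 = 0.
  case: hord => C1 C10 [e1 e10 h]; have := h 0; rewrite normr0 expr0n mulr0 => /(_ e10).
  by rewrite normr_le0 => /eqP.
exists (\sum_i C i); first by apply: sumr_ge0 => i _; exact: (hC' i).1.
exists m => // x xm.
pose Q := \sum_i x 0 i * (a * q i x).
have tx t : 0 <= t <= 1 -> `|t *: x| < m.
  move=> /andP[t0 t1]; apply: le_lt_trans xm; rewrite normrZ (ger0_norm t0).
  by rewrite ler_piMl.
have dphi (t : R) : 0 <= t <= 1 -> is_derive (t : R) (1 : R)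
    (fun s : R => f (0 + s *: x) - s ^+ e.+1 * Q)
    (\sum_i x 0 i * (g i (t *: x) - q i (t *: x))).
  move=> ht.
  have H1 : frechet_diff f (0 + t *: x) (fun v : V => \sum_i v 0 i * g i (0 + t *: x)).
    by apply: hf; apply: h1; rewrite subr0 add0r; apply: lt_le_trans md1; apply: tx.
  have H2 := frechet_diff_line H1.
  have H3 : is_derive (t : R) (1 : R) (fun s : R => s ^+ e.+1 * Q) (e.+1%:R * t ^+ e * Q).
    have H := is_deriveM (DeriveDef (@exprn_derivable R e.+1 t 1) (exp_derive _ _ _))
      (is_derive_cst Q t 1).
    by apply: is_derive_eq H _; rewrite /GRing.scale /=; ring.
  apply: is_derive_eq (is_deriveB H2 H3) _.
  rewrite /Q mulr_sumr -sumrB; apply: eq_bigr => i _.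
  rewrite add0r (hpoly_hom t x (hq' i).1) /a.
  field.
  by rewrite nat1r pnatr_eq0.
have hc : {within `[0, 1], continuous (fun s : R => f (0 + s *: x) - s ^+ e.+1 * Q)}.
  apply: derivable_within_continuous => t; rewrite in_itv /= => ht.
  by have [] := dphi t ht.
have hm (t : R) : t \in `]0, 1[ -> is_derive (t : R) (1 : R)
    (fun s : R => f (0 + s *: x) - s ^+ e.+1 * Q)
    (\sum_i x 0 i * (g i (t *: x) - q i (t *: x))).
  by rewrite in_itv /= => /andP[/ltW t0 /ltW t1]; apply: dphi; rewrite t0.
have [t] := MVT ltr01 hm hc.
rewrite in_itv /= => /andP[/ltW t0 /ltW t1].
rewrite scale1r scale0r !add0r f0 expr1n mul1r expr0n mul0r !subr0 mulr1 => ->.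
apply: (le_trans (ler_norm_sum _ _ _)).
rewrite mulr_suml; apply: ler_sum => i _; rewrite normrM.
have H := (hd' i).2 (t *: x) (lt_le_trans (tx t _) (mdi i)).
have {}H := H ltac:(by rewrite t0).
rewrite exprS mulrCA ler_pM //; first exact: coord_le.
apply: (le_trans H); rewrite ler_wpM2l //; first exact: (hC' i).1.
by rewrite lerXn2r ?nnegrE // normrZ (ger0_norm t0) ler_piMl.
Qed.

End TaylorOrders.

Arguments bounded_linear_coord {R n} i.

(** * Comparison of the notions of differentiability *)

Section Conversions.
Context (R : realType).
Implicit Types U V W : normedModType R.

Lemma openop V (A : set V) : open A -> metric_open A.
Proof.
move=> oA x Ax; have /nbhs_normP[d /= d0 hd] := open_nbhs_nbhs (conj oA Ax).
by exists d => // y yx; apply: hd; rewrite /= distrC.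
Qed.

Lemma opopen V (A : set V) : metric_open A -> open A.
Proof.
move=> oA; rewrite openE => x /oA[d d0 hd]; apply/nbhs_normP.
by exists d => //= y; rewrite /= distrC; apply: hd.
Qed.

Lemma near0P V (P : V -> Prop) :
  (\forall x \near (0 : V), P x) <-> exists2 d : R, 0 < d & forall x, `|x| < d -> P x.
Proof.
split=> [/nbhs_normP[d /= d0 hd]|[d d0 hd]].
  by exists d => // x xd; apply: hd; rewrite /= sub0r normrN.
by apply/nbhs_normP; exists d => // x; rewrite /= sub0r normrN; apply: hd.
Qed.

Lemma differentiable_frechet_diff V W (f : V -> W) x : differentiable f x -> frechet_diff f x ('d f x).
Proof.
move=> df; split.
  split=> [a u v|]; first exact: linearP.
  have [M M0 hM] := linear_lipschitz (diff_continuous df).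
  by exists M => //; exact: ltW.
move=> e e0; have /diff_locally/eqaddoP/(_ e e0) := df.
move=> /near0P[d d0 hd]; exists d => // y yd.
have := hd (y - x) yd; rewrite /= !fctE /= /cst subrK.
by rewrite opprD addrA.
Qed.

Lemma frechet_diff_diff V W (f : V -> W) x L :
  frechet_diff f x L -> differentiable f x /\ forall v, 'd f x v = L v.
Proof.
move=> [hL h].
pose L' : {linear V -> W} := HB.pack L (GRing.isLinear.Build R V W *:%R L hL.1).
have LE v : L' v = L v by [].
have cL : continuous L'.
  move=> y; apply/cont_at_continuous.
  exact: strict_diff_cont (bounded_linear_strict_diff y hL).
have key : f \o shift x = cst (f x) + L' +o_ 0 id.
  apply/eqaddoP => e e0; apply/near0P; have [d d0 hd] := h e e0.
  exists d => // y yd; have := hd (y + x); rewrite addrK => /(_ yd).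
  by rewrite /= !fctE /= /cst opprD addrA.
have E := diff_unique cL key.
split; last by move=> v; rewrite E.
by apply/diff_locallyP; rewrite E.
Qed.

Lemma frechet_diff_ext V W (f : V -> W) x L K : frechet_diff f x L -> (forall v, L v = K v) -> frechet_diff f x K.
Proof. by move=> h e; have <- : L = K by apply/funext. Qed.

Lemma frechet_diff_linl V W U (f : V -> W) (K : W -> U) x L :
  bounded_linear K -> frechet_diff f x L -> frechet_diff (fun y => K (f y)) x (fun v => K (L v)).
Proof.
move=> hK [hL h]; split; first exact: bounded_linear_comp.
have [M M0 hM] := hK.2; have M1 : 0 < M + 1 by rewrite ltr_wpDl.
move=> e e0; have [d d0 hd] := h (e / (M + 1)) (divr_gt0 e0 M1).
exists d => // y yd; rewrite -!(bounded_linearB _ _ hK).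
apply: (le_trans (hM _)); have H := hd y yd.
apply: (@le_trans _ _ ((M + 1) * (e / (M + 1) * `|y - x|))).
  by apply: ler_pM => //; lra.
by rewrite mulrA mulrCA divff ?gt_eqF // mulr1.
Qed.

Lemma frechet_diff_add V W (f g : V -> W) x L K :
  frechet_diff f x L -> frechet_diff g x K -> frechet_diff (fun y => f y + g y) x (fun v => L v + K v).
Proof.
move=> [hL h] [hK k]; split; first exact: bounded_linear_add.
move=> e e0; have [d d0 hd] := h (e / 2) (divr_gt0 e0 (ltr0n _ 2)).
have [d' d'0 hd'] := k (e / 2) (divr_gt0 e0 (ltr0n _ 2)).
exists (Num.min d d'); first by rewrite lt_min d0.
move=> y; rewrite lt_min => /andP[/hd H1 /hd' H2].
have -> : f y + g y - (f x + g x) - (L (y - x) + K (y - x)) =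
  (f y - f x - L (y - x)) + (g y - g x - K (y - x)).
  by rewrite !opprD (addrACA (f y)) [LHS]addrACA.
by apply: (le_trans (ler_normD _ _)); lra.
Qed.

Lemma bigO_lin V U d (f : V -> R) (K : U -> V) :
  bounded_linear K -> bigO d f -> bigO d (fun x => f (K x)).
Proof.
move=> hK [C C0 [e e0 h]]; have [M M0 hM] := hK.2.
have M1 : 0 < M + 1 by rewrite ltr_wpDl.
exists (C * (M + 1) ^+ d); first by rewrite mulr_ge0 // exprn_ge0 // ltW.
exists (e / (M + 1)) => [|x]; first by rewrite divr_gt0.
rewrite ltr_pdivlMr // => xe.
have H : `|K x| <= (M + 1) * `|x| by apply: (le_trans (hM _)); rewrite ler_wpM2r // lerDl.
apply: (le_trans (h _ _)); first by apply: le_lt_trans H _; rewrite mulrC.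
rewrite -mulrA -exprMn ler_wpM2l // lerXn2r ?nnegrE // mulr_ge0 // ltW //.
Qed.

Lemma bigOD V d (f g : V -> R) : bigO d f -> bigO d g -> bigO d (fun x => f x + g x).
Proof.
move=> [C C0 [e e0 h]] [C' C'0 [e' e'0 h']]; exists (C + C'); first exact: addr_ge0.
exists (Num.min e e'); first by rewrite lt_min e0.
move=> x; rewrite lt_min => /andP[/h H1 /h' H2]; rewrite mulrDl.
by apply: (le_trans (ler_normD _ _)); apply: lerD.
Qed.

Lemma bigOM V d1 d2 (f g : V -> R) :
  bigO d1 f -> bigO d2 g -> bigO (d1 + d2) (fun x => f x * g x).
Proof.
move=> [C C0 [e e0 h]] [C' C'0 [e' e'0 h']]; exists (C * C'); first exact: mulr_ge0.
exists (Num.min e e'); first by rewrite lt_min e0.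
move=> x; rewrite lt_min => /andP[/h H1 /h' H2]; rewrite normrM exprD mulrACA.
exact: ler_pM.
Qed.

Lemma bigO_le V d1 d2 (f : V -> R) : (d1 <= d2)%N -> bigO d2 f -> bigO d1 f.
Proof.
move=> le [C C0 [e e0 h]]; exists C => //; exists (Num.min e 1).
  by rewrite lt_min e0 ltr01.
move=> x; rewrite lt_min => /andP[/h H1 H2]; apply: (le_trans H1).
by rewrite ler_wpM2l // ler_wiXn2l // ltW.
Qed.

Lemma bigO_bounded_linear V (f : V -> R) : bounded_linear f -> bigO 1 f.
Proof. by case=> _ [M M0 h]; exists M => //; exists 1 => // x _; rewrite expr1. Qed.

Lemma bigO_cst V (c : R) : bigO 0 (fun _ : V => c).
Proof. by exists `|c| => //; exists 1 => // x _; rewrite expr0 mulr1. Qed.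

Lemma bigO_local V d (f g : V -> R) (A : set V) :
  metric_open A -> A 0 -> (forall x, A x -> f x = g x) -> bigO d f -> bigO d g.
Proof.
move=> oA A0 fg [C C0 [e e0 h]]; have [r r0 hr] := oA 0 A0.
exists C => //; exists (Num.min e r); first by rewrite lt_min e0.
move=> x; rewrite lt_min => /andP[xe xr]; rewrite -fg ?h //.
by apply: hr; rewrite subr0.
Qed.

Lemma order_Ck_ext k d V (A : set V) (f g : V -> R) : metric_open A -> A 0 ->
  (forall x, A x -> f x = g x) -> order_Ck k d A f -> order_Ck k d A g.
Proof.
move=> oA A0 fg; case: k => [|k] [h1 h2]; split; try exact: (bigO_local oA A0 fg h1).
  by move=> x Ax; apply: (cont_local oA Ax fg (h2 x Ax)).
case: h2 => f1 h2 h3; exists f1 => // x Ax.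
exact: (strict_diff_local oA Ax fg (h2 x Ax)).
Qed.

Lemma order_Ck_S k d V (A : set V) (f : V -> R) : order_Ck k.+1 d A f -> order_Ck k d A f.
Proof.
elim: k V A f => [|k ih] V A f [h1 [f1 h2 h3]]; split=> //.
  by move=> x /h2/strict_diff_cont.
by exists f1 => //; apply: ih.
Qed.

Lemma order_Ck_lin k d V U (A : set V) (f : V -> R) (K : U -> V) : bounded_linear K ->
  order_Ck k d A f -> order_Ck k d [set x | A (K x)] (fun x => f (K x)).
Proof.
elim: k V U A f K => [|k ih] V U A f K hK [h1 h2]; split; try exact: bigO_lin.
  move=> x Ax; apply: (@cont_comp _ _ _ _ f K); first exact: h2.
  exact: strict_diff_cont (bounded_linear_strict_diff x hK).
case: h2 => f1 h2 h3; exists (fun p => f1 (K p.1, K p.2)).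
  by move=> x Ax; apply: (strict_diff_comp (h2 _ Ax) (bounded_linear_strict_diff x hK)).
apply: (ih _ _ [set p : V * V | A p.1] f1 (fun p => (K p.1, K p.2))) => //.
apply: bounded_linear_pair; first exact: (bounded_linear_comp hK (bounded_linear_fst U U)).
exact: (bounded_linear_comp hK (bounded_linear_snd U U)).
Qed.

Lemma order_CkD k d V (A : set V) (f g : V -> R) :
  order_Ck k d A f -> order_Ck k d A g -> order_Ck k d A (fun x => f x + g x).
Proof.
elim: k V A f g => [|k ih] V A f g [h1 h2] [h3 h4]; split; try exact: bigOD.
  move=> x Ax; apply: (@cont_comp _ _ _ _ (fun p : R * R => p.1 + p.2) (fun x => (f x, g x))).
    exact: strict_diff_cont (bounded_linear_strict_diff _ (bounded_linear_addp R)).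
  by apply: cont_pair; [apply: h2|apply: h4].
case: h2 => f1 h2 h2'; case: h4 => g1 h4 h4'.
exists (fun p => f1 p + g1 p); last exact: ih.
by move=> x Ax; apply: (strict_diff_add (h2 x Ax) (h4 x Ax)).
Qed.

Lemma order_Ck_mul_lin k d V (A : set V) (l g : V -> R) :
  bounded_linear l -> order_Ck k d.-1 A g -> order_Ck k d A (fun x => l x * g x).
Proof.
elim: k V A l g => [|k ih] V A l g hl hg; split.
- apply: (bigO_le (leqSpred d)); rewrite -add1n.
  exact: (bigOM (bigO_bounded_linear hl) (order_Ck_ord hg)).
- move=> x Ax; apply: (@cont_comp R V (R * R)%type R (fun q => q.1 *: q.2) (fun u => (l u, g u))).
    exact: strict_diff_cont (scale_strict_diff (l x, g x)).
  by apply: cont_pair; [exact: strict_diff_cont (bounded_linear_strict_diff x hl)|apply: (order_Ck_cont hg)].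
- apply: (bigO_le (leqSpred d)); rewrite -add1n.
  exact: (bigOM (bigO_bounded_linear hl) (order_Ck_ord hg)).
have hgS := order_Ck_S hg; case: hg => h1 [g1 h2 h3].
exists (fun p => l p.2 * g p.1 + l p.1 * g1 p).
  by move=> x Ax; apply: (strict_diff_scale (bounded_linear_strict_diff x hl) (h2 x Ax)).
apply: order_CkD; apply: ih => //.
- exact: (bounded_linear_comp hl (bounded_linear_snd V V)).
- exact: (order_Ck_lin (bounded_linear_fst V V) hgS).
- exact: (bounded_linear_comp hl (bounded_linear_fst V V)).
Qed.

Lemma order_Ck_zero k d V (A : set V) : order_Ck k d A (fun _ : V => 0).
Proof.
elim: k V A => [|k ih] V A; split.
- by exists 0 => //; exists 1 => // x _; rewrite normr0 mul0r.
- by move=> x _; exact: strict_diff_cont (cst_strict_diff 0 x).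
- by exists 0 => //; exists 1 => // x _; rewrite normr0 mul0r.
by exists (fun=> 0); [move=> x _; exact: cst_strict_diff|exact: ih].
Qed.

Lemma order_Ck_sum k d V (A : set V) I (s : seq I) (f : I -> V -> R) :
  (forall i, order_Ck k d A (f i)) -> order_Ck k d A (fun x => \sum_(i <- s) f i x).
Proof.
move=> h; elim: s => [|i s ih].
  have -> : (fun x => \sum_(i <- [::]) f i x) = fun=> 0.
    by apply/funext => x; rewrite big_nil.
  exact: order_Ck_zero.
have -> : (fun x => \sum_(j <- i :: s) f j x) = fun x => f i x + \sum_(j <- s) f j x.
  by apply/funext => x; rewrite big_cons.
exact: order_CkD.
Qed.

End Conversions.

Section RowVectors.
Context (R : realType).

Lemma bounded_linear_deltaE n (W : normedModType R) (L : 'rV[R]_n -> W) v :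
  bounded_linear L -> L v = \sum_i v 0 i *: L (delta_mx 0 i).
Proof.
move=> hL; rewrite {1}(rV_delta_sum v) (bounded_linear_sum _ hL).
by apply: eq_bigr => i _; rewrite (bounded_linearZ _ _ hL).
Qed.

Lemma Ck_Dk n k (A : set 'rV[R]_n) (f : 'rV[R]_n -> R) : Ck k A f -> Dk k A f.
Proof.
elim: k f => [|k ih] f //= [f1 h1 h2].
exists (fun i x => f1 (x, delta_mx 0 i)) => [x Ax|i].
  have := strict_diff_frechet_diff (h1 x Ax) => h.
  by apply: frechet_diff_ext h _ => v; rewrite [LHS](bounded_linear_deltaE v (h1 x Ax).1).
apply: ih; apply: (@Ck_comp R k _ _ _ A _ f1 (fun x => (x, delta_mx 0 i))) h2 _ => //.
apply: Ck_pair; [exact/Ck_lin/bounded_linear_id|exact: Ck_cst].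
Qed.

(** The derivative is the sum of the coordinates of the vector times partial
    derivatives, which have order [d - 1]. *)
Lemma Ck_order_Ck n k d (A : set 'rV[R]_n) (f : 'rV[R]_n -> R) :
  metric_open A -> A 0 -> (d <= k)%N -> Ck k A f -> bigO d f -> order_Ck k d A f.
Proof.
move=> oA A0; elim: k d f => [|k ih] d f dk hf hd.
  by split.
split=> //; have hTD := Ck_Dk hf; case: hf => f1 h1 h2.
exists f1 => //.
pose g i (x : 'rV[R]_n) := f1 (x, delta_mx 0 i).
have hg i : Ck k A (g i).
  apply: (@Ck_comp R k _ _ _ A _ f1 (fun x => (x, delta_mx 0 i))) h2 _ => //.
  by apply: Ck_pair; [exact/Ck_lin/bounded_linear_id|exact: Ck_cst].
have hg0 i : bigO 0 (g i) by apply: cont_bigO; apply: (Ck_cont (hg i) A0).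
have hKg i : order_Ck k d.-1 A (g i).
  apply: ih => //; first by rewrite -subn1 leq_subLR add1n.
  case: d dk hd => [|d] dk hd //=.
  apply: (derivative_order (f := f) (d := d) _ oA A0) => //.
  - by move=> e _; apply: leading_part.
  - move=> x Ax; have := strict_diff_frechet_diff (h1 x Ax) => h.
    by apply: frechet_diff_ext h _ => v; rewrite [LHS](bounded_linear_deltaE v (h1 x Ax).1).
  - by move=> j; apply: (Dk_le _ (Ck_Dk (hg j))).
apply: (@order_Ck_ext _ _ _ _ _ (fun p : 'rV[R]_n * 'rV[R]_n => \sum_i p.2 0 i * g i p.1)).
- exact: metric_open_fst.
- exact: A0.
- by move=> [x v] /= Ax; rewrite [RHS](bounded_linear_deltaE v (h1 x Ax).1).
apply: order_Ck_sum => i; apply: order_Ck_mul_lin.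
  exact: (bounded_linear_comp (bounded_linear_coord i) (bounded_linear_snd 'rV[R]_n 'rV[R]_n)).
exact: (order_Ck_lin (bounded_linear_fst _ _) (hKg i)).
Qed.

Lemma eqnorm_normr (V : normedModType R) : eqnorm (fun x : V => `|x|).
Proof.
split; [exact: normrZ|exact: ler_normD| |]; by exists 1 => // x; rewrite mul1r.
Qed.

(** Apply the mean value theorem to [f - L] along the segment between the two
    points. *)
Lemma strict_diff_of_partials n m (f : 'rV[R]_n -> 'rV[R]_m) (g : 'I_n -> 'rV[R]_n -> 'rV[R]_m)
   (A : set 'rV[R]_n) x :
  metric_open A -> A x -> (forall y, A y -> frechet_diff f y (fun v => \sum_i v 0 i *: g i y)) ->
  (forall i, cont_at (g i) x) -> strict_diff f x (fun v => \sum_i v 0 i *: g i x).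
Proof.
move=> oA Ax hf hg; split; first by case: (hf x Ax).
move=> e e0; pose r := e / (n%:R + 1).
have n1 : 0 < n%:R + 1 :> R by rewrite ltr_wpDl.
have r0 : 0 < r by rewrite divr_gt0.
have hd i : exists d : R, 0 < d /\ forall y, `|y - x| < d -> `|g i y - g i x| <= r.
  by have [d d0 h] := hg i r r0; exists d.
move: (fin_all_exists hd) => [d hd'] {hd}.
have [d1 d10 h1] := oA x Ax.
pose m0 := \big[Num.min/d1]_i d i.
have m00 : 0 < m0.
  rewrite /m0; elim/big_ind: _ => // [a b a0 b0|i _]; first by rewrite lt_min a0.
  exact: (hd' i).1.
have md1 : m0 <= d1 by apply: bigmin_le_id.
have mdi i : m0 <= d i by apply: bigmin_le_cond.
exists m0 => // y z ym zm.
have seg t : 0 <= t <= 1 -> `|z + t *: (y - z) - x| < m0.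
  have -> : z + t *: (y - z) - x = (z - x) + t *: ((y - x) - (z - x)).
    by rewrite opprB addrA subrK addrAC.
  exact: (eqnorm_segment (eqnorm_normr _)).
apply: rV_norm_le; first by rewrite mulr_ge0 // ltW.
move=> j.
have hfd t : 0 <= t <= 1 -> frechet_diff (fun y => f y 0 j) (z + t *: (y - z))
    (fun v => (\sum_i v 0 i *: g i (z + t *: (y - z))) 0 j).
  move=> ht; apply: (frechet_diff_linl (bounded_linear_coord j)); apply: hf; apply: h1.
  by apply: lt_le_trans md1; apply: seg.
have [t /andP[t0 t1]] := mvt_line hfd.
rewrite [z + (y - z)]addrC subrK => E.
set S := \sum_i (y - z) 0 i *: g i x.
have -> : (f y - f z - S) 0 j = f y 0 j - f z 0 j - S 0 j by rewrite !mxE.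
rewrite E /S.
rewrite !summxE -sumrB; apply: (le_trans (ler_norm_sum _ _ _)).
apply: (@le_trans _ _ (\sum_(i < n) r * `|y - z|)).
  apply: ler_sum => i _; rewrite !mxE -mulrBr normrM mulrC.
  apply: ler_pM => //; last by have := coord_le (y - z) i; rewrite !mxE.
  have H := (hd' i).2 (z + t *: (y - z)) (lt_le_trans (seg t _) (mdi i)).
  have {}H := H ltac:(by rewrite !ltW).
  apply: le_trans H; have := coord_le (g i (z + t *: (y - z)) - g i x) j.
  by rewrite !mxE.
rewrite sumr_const card_ord -mulr_natl mulrA ler_wpM2r //.
by rewrite /r mulrA ler_pdivrMr // mulrC ler_pM2l // lerDl.
Qed.

Lemma class_C_cont n m k (A : set 'rV[R]_n) (f : 'rV[R]_n -> 'rV[R]_m) x :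
  class_C k A f -> A x -> cont_at f x.
Proof.
case: k => [|k] /= h Ax; first by apply/cont_at_continuous/h.
by apply: frechet_diff_cont (differentiable_frechet_diff (h.1 x Ax)).
Qed.

(** The derivative is the linear combination of the derivatives in the
    directions of the basis, each of which is of class [C^k] by induction. *)
Lemma class_C_Ck n m k (A : set 'rV[R]_n) (f : 'rV[R]_n -> 'rV[R]_m) :
  metric_open A -> class_C k A f -> Ck k A f.
Proof.
move=> oA; elim: k f => [|k ih] f.
  by move=> h x Ax; apply/cont_at_continuous/h.
move=> [h1 h2].
exists (fun p : 'rV[R]_n * 'rV[R]_n => \sum_i p.2 0 i *: 'D_(delta_mx 0 i) f p.1).
  move=> x Ax; apply: (strict_diff_of_partials (g := fun i y => 'D_(delta_mx 0 i) f y) oA Ax) => /= [y Ay|i]; last exact: (class_C_cont (h2 _) Ax).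
  have hy := differentiable_frechet_diff (h1 y Ay).
  apply: frechet_diff_ext hy _ => v.
  rewrite [LHS](bounded_linear_deltaE v (differentiable_frechet_diff (h1 y Ay)).1); apply: eq_bigr => i _.
  by rewrite (deriveE _ (h1 y Ay)).
apply: Ck_sum => i; apply: Ck_scale.
  by apply: Ck_lin; apply: (bounded_linear_comp (bounded_linear_coord i) (bounded_linear_snd 'rV[R]_n 'rV[R]_n)).
have h := ih _ (h2 (delta_mx 0 i)).
exact: (@Ck_fst R k 'rV[R]_n 'rV[R]_n 'rV[R]_m A _ h).
Qed.

Lemma Ck_class_C n m k (A : set 'rV[R]_n) (f : 'rV[R]_n -> 'rV[R]_m) :
  metric_open A -> Ck k A f -> class_C k A f.
Proof.
move=> oA; elim: k f => [|k ih] f.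
  by move=> h x Ax; apply/cont_at_continuous/h.
move=> [f1 h1 h2]; have hd x (Ax : A x) := frechet_diff_diff (strict_diff_frechet_diff (h1 x Ax)).
split=> [x /hd[]//|v]; apply: ih.
apply: (@Ck_ext _ _ _ _ _ (fun x => f1 (x, v))) => //.
  by move=> x Ax; have [d1 d2] := hd x Ax; rewrite (deriveE _ d1) d2.
apply: (@Ck_comp R k _ _ _ A _ f1 (fun x => (x, v))) h2 _ => //.
by apply: Ck_pair; [exact/Ck_lin/bounded_linear_id|exact: Ck_cst].
Qed.

Lemma times_differentiable_Dk n m k (A : set 'rV[R]_n) (f : 'rV[R]_n -> 'rV[R]_m) j :
  times_differentiable k A f -> Dk k A (fun x => f x 0 j).
Proof.
elim: k f => [|k ih] f //= [h1 h2].
exists (fun i x => 'D_(delta_mx 0 i) f x 0 j) => [x Ax|i]; last exact: ih.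
have hx := differentiable_frechet_diff (h1 x Ax).
apply: frechet_diff_ext (frechet_diff_linl (bounded_linear_coord j) hx) _ => v; rewrite [in LHS](bounded_linear_deltaE v hx.1) summxE; apply: eq_bigr => i _.
by rewrite mxE (deriveE _ (h1 x Ax)).
Qed.

Lemma class_C_times_differentiable n m k (A : set 'rV[R]_n) (f : 'rV[R]_n -> 'rV[R]_m) :
  class_C k A f -> times_differentiable k A f.
Proof. by elim: k f => [|k ih] f //= [h1 h2]; split=> // v; apply: ih. Qed.

Lemma Dk_lin2 n k (A : set 'rV[R]_n) (f g : 'rV[R]_n -> R) (a b : R) :
  Dk k A f -> Dk k A g -> Dk k A (fun x => a * f x + b * g x).
Proof.
elim: k f g => [|k ih] f g //= [f1 h1 h2] [g1 h3 h4].
exists (fun i x => a * f1 i x + b * g1 i x) => [x Ax|i]; last exact: ih.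
have sc (c : R) := @bounded_linear_scale R R R (@id R) c (bounded_linear_id R).
have := frechet_diff_add (frechet_diff_linl (sc a) (h1 x Ax)) (frechet_diff_linl (sc b) (h3 x Ax)).
move=> /frechet_diff_ext; apply => v.
rewrite /= /GRing.scale /= !mulr_sumr -big_split /=.
by apply: eq_bigr => i _; ring.
Qed.

End RowVectors.

(** * Local inverses and straightened submersions *)

HB.instance Definition _ (R : realType) (m n : nat) := Complete.on 'M[R]_(m, n).

Section InverseFunction.
Context (R : realType).

Lemma contraction_fixpoint n (T : 'rV[R]_n -> 'rV[R]_n) (r : R) : 0 <= r ->
  (forall x, `|x| <= r -> `|T x| <= r) ->
  (forall x y, `|x| <= r -> `|y| <= r -> `|T x - T y| <= 1 / 2 * `|x - y|) ->
  exists2 x, `|x| <= r & x = T x.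
Proof.
move=> r0 hT hc; pose B : set 'rV[R]_n := [set x | `|x| <= r].
have fB : isFun _ _ B B T by split=> x; exact: hT.
pose T' : {fun B >-> B} := HB.pack T fB.
have half0 : 0 <= (1 / 2 : R) by rewrite divr_ge0.
have cT : is_contraction T'.
  exists (NngNum half0); split; first by rewrite /=; lra.
  by move=> [x y] [/= Bx By]; apply: hc.
have clB : closed B.
  rewrite (_ : B = [set x | `|x - 0| <= r]); last by apply/seteqP; split=> x; rewrite /B /= subr0.
  rewrite -[X in closed X]setCK; apply: open_closedC; apply: opopen => x /= /negP.
  rewrite subr0 -ltNge => xr; exists (`|x| - r); first by rewrite subr_gt0.
  move=> y yx; apply/negP; rewrite subr0 -ltNge.
  have := ler_normD (x - y) y; rewrite subrK distrC; lra.
have B0 : B !=set0 by exists 0; rewrite /B /= normr0.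
have [x Bx Ex] := banach_fixed_point cT clB B0.
by exists x.
Qed.

Lemma near_id_inverse n (L : 'rV[R]_n -> 'rV[R]_n) : bounded_linear L ->
  (forall v, `|L v - v| <= 1 / 2 * `|v|) ->
  exists K, [/\ bounded_linear K, forall v, K (L v) = v, forall v, L (K v) = v &
    forall v, `|K v| <= 2 * `|v|].
Proof.
move=> hL h.
have low v : `|v| <= 2 * `|L v|.
  have := h v; have := ler_normD (v - L v) (L v); rewrite subrK distrC; lra.
pose M : 'M[R]_n := \matrix_i L (delta_mx 0 i).
have LE v : L v = v *m M.
  by rewrite (bounded_linear_deltaE v hL) mulmx_sum_row; apply: eq_bigr => i _; rewrite rowK.
have uM : M \in unitmx.
  rewrite -row_free_unit; apply: inj_row_free => v; rewrite -LE => v0.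
  by have := low v; rewrite v0 normr0 mulr0 normr_le0 => /eqP.
have LK v : L (v *m invmx M) = v by rewrite LE mulmxKV.
have bK (v : 'rV[R]_n) : `|v *m invmx M| <= 2 * `|v| by rewrite -{2}(LK v); apply: low.
exists (fun v => v *m invmx M); split=> //.
  split=> [a u v|]; first by rewrite mulmxDl -scalemxAl.
  by exists 2.
by move=> v; rewrite LE mulmxK.
Qed.

Definition local_inverse n (G g : 'rV[R]_n -> 'rV[R]_n) (A : set 'rV[R]_n) (d rho : R) :=
  [/\ 0 < d, 0 < rho,
    forall xi, `|xi| < d -> [/\ G (g xi) = xi, `|g xi| <= 2 * `|xi| & A (g xi)],
    forall x, `|x| < rho -> `|G x| < d /\ g (G x) = x &
    forall xi eta, `|xi| < d -> `|eta| < d -> `|g xi - g eta| <= 2 * `|xi - eta|].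

(** The inverse at [xi] is the fixed point of [x - G x + xi], a contraction where
    [G] is close to the identity; it is Lipschitz, and so inherits strict
    differentiability from [G] at every point. *)
Theorem inverse_function n (G : 'rV[R]_n -> 'rV[R]_n) (A : set 'rV[R]_n) :
  metric_open A -> A 0 -> G 0 = 0 -> (forall x, A x -> exists L, strict_diff G x L) ->
  strict_diff G 0 id ->
  exists g d rho, [/\ local_inverse G g A d rho, g 0 = 0,
    forall xi, `|xi| < d -> exists K, strict_diff g xi K & strict_diff g 0 id].
Proof.
move=> oA A0 G0 dG hG.
have half0 : 0 < (1 / 2 : R) by rewrite divr_gt0.
have [d0 d00 h0] := hG.2 _ half0.
have [d1 d10 h1] := strict_diff_close hG half0.
have [d2 d20 h2] := oA 0 A0.
pose m := Num.min d0 (Num.min d1 d2).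
have m0 : 0 < m by rewrite !lt_min d00 d10.
have [md0 md1 md2] : [/\ m <= d0, m <= d1 & m <= d2].
  by rewrite /m !ge_min !lexx !orbT.
have lip y z : `|y| < m -> `|z| < m -> `|G y - G z - (y - z)| <= 1 / 2 * `|y - z|.
  by move=> ym zm; apply: h0; rewrite subr0; apply: lt_le_trans md0.
have low y z : `|y| < m -> `|z| < m -> `|y - z| <= 2 * `|G y - G z|.
  move=> ym zm; have := lip y z ym zm.
  have := ler_normD ((y - z) - (G y - G z)) (G y - G z).
  rewrite subrK [`|y - z - _|]distrC; lra.
pose r := m / 2.
have r0 : 0 < r by rewrite divr_gt0.
have rm : r < m by rewrite /r; lra.
pose d := r / 2.
have dd : 0 < d by rewrite divr_gt0.
have ex xi : `|xi| < d -> exists2 x, `|x| <= r & G x = xi.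
  move=> xid; pose T x := x - G x + xi.
  have [||x xr Ex] := @contraction_fixpoint _ T r (ltW r0).
  - move=> x xr; have := lip x 0 (le_lt_trans xr rm); rewrite normr0 => /(_ m0).
    rewrite G0 !subr0 distrC => H; rewrite /T; apply: (le_trans (ler_normD _ _)).
    by rewrite /d in xid; lra.
  - move=> x y xr yr; have := lip x y (le_lt_trans xr rm) (le_lt_trans yr rm).
    have -> : T x - T y = - (G x - G y - (x - y)).
      rewrite /T [RHS]opprB opprD addrACA subrr addr0.
      by rewrite [in LHS]opprD [LHS]addrACA -[in LHS]opprD.
    by rewrite normrN.
  exists x => //; move: Ex; rewrite /T -addrA -{1}(addr0 x) => /addrI/eqP.
  by rewrite eq_sym addrC subr_eq0 => /eqP.
pose g xi := if pselect (`|xi| < d) is left h then projT1 (cid2 (ex xi h)) else 0.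
have gP xi : `|xi| < d -> `|g xi| <= r /\ G (g xi) = xi.
  by move=> xid; rewrite /g; case: pselect => // h; case: cid2.
have gm xi : `|xi| < d -> `|g xi| < m by move=> /gP[h _]; apply: le_lt_trans rm.
have glip xi eta : `|xi| < d -> `|eta| < d -> `|g xi - g eta| <= 2 * `|xi - eta|.
  move=> x1 e1; have := low _ _ (gm _ x1) (gm _ e1).
  by rewrite (gP _ x1).2 (gP _ e1).2.
have inj x y : `|x| < m -> `|y| < m -> G x = G y -> x = y.
  move=> xm ym E; apply/eqP; rewrite -subr_eq0 -normr_le0.
  by have := low x y xm ym; rewrite E subrr normr0 mulr0.
have g0 : g 0 = 0.
  have d0' : `|0 : 'rV[R]_n| < d by rewrite normr0.
  by apply: inj; rewrite ?normr0 ?G0 ?(gP _ d0').2 //; apply: gm.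
have gA xi : `|xi| < d -> A (g xi).
  by move=> /gm xm; apply: h2; rewrite subr0; apply: lt_le_trans md2.
have LI : local_inverse G g A d (d / 2).
  split=> //; first by rewrite divr_gt0.
    move=> xi xid; split; [exact: (gP _ xid).2| |exact: gA].
    by have := glip xi 0 xid; rewrite normr0 g0 !subr0; apply.
  move=> x xd; have xm : `|x| < m by rewrite /d /r in xd; lra.
  have Gd : `|G x| < d.
    have := lip x 0 xm; rewrite normr0 G0 !subr0 => /(_ m0) H.
    have := ler_normD (G x - x) x; rewrite subrK; lra.
  by split=> //; apply: inj => //; [apply: gm|exact: (gP _ Gd).2].
have dg xi : `|xi| < d -> forall L K, strict_diff G (g xi) L -> bounded_linear K ->
   (forall v, K (L v) = v) -> (forall v, `|K v| <= 2 * `|v|) -> strict_diff g xi K.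
  move=> xid L K hL hK KL bK; split=> // e e0.
  have [s s0 hs] := hL.2 (e / 4) (divr_gt0 e0 (ltr0n _ 4)).
  exists (Num.min (s / 2) (d - `|xi|)); first by rewrite lt_min divr_gt0 // subr_gt0.
  move=> y z; rewrite !lt_min => /andP[ys yd] /andP[zs zd].
  have nd w : `|w - xi| < d - `|xi| -> `|w| < d.
    by move=> wd; have := ler_normD (w - xi) xi; rewrite subrK; lra.
  have yd' := nd _ yd; have zd' := nd _ zd.
  have ns w : `|w| < d -> `|w - xi| < s / 2 -> `|g w - g xi| < s.
    by move=> wd ws; have := glip w xi wd xid; lra.
  have H := hs _ _ (ns _ yd' ys) (ns _ zd' zs).
  rewrite (gP _ yd').2 (gP _ zd').2 in H.
  have -> : g y - g z - K (y - z) = - K (y - z - L (g y - g z)).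
    by rewrite (bounded_linearB (y - z) _ hK) KL opprB.
  rewrite normrN; apply: (le_trans (bK _)).
  have := glip y z yd' zd'; nra.
exists g, d, (d / 2); split=> //.
  move=> xi xid; have [L hL] := dG _ (gA _ xid).
  have cl : forall v, `|L v - v| <= 1 / 2 * `|v|.
    by apply: (h1 (g xi)); [rewrite subr0; apply: lt_le_trans (gm _ xid) md1|exact: strict_diff_frechet_diff].
  have [K [hK KL _ bK]] := near_id_inverse hL.1 cl.
  by exists K; apply: (dg _ xid L).
have d0' : `|0 : 'rV[R]_n| < d by rewrite normr0.
apply: (dg 0 d0' id) => //; first by rewrite g0.
  exact: bounded_linear_id.
by move=> v; rewrite ler_peMl // ler1n.
Qed.

Lemma bounded_linear_mulmx n m (M : 'M[R]_(n, m)) : bounded_linear (fun x : 'rV[R]_n => x *m M).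
Proof.
split=> [a u v|]; first by rewrite mulmxDl -scalemxAl.
exists (\sum_i `|row i M|); first by rewrite sumr_ge0.
move=> v; rewrite mulmx_sum_row; apply: (le_trans (ler_norm_sum _ _ _)).
rewrite mulr_suml; apply: ler_sum => i _; rewrite normrZ mulrC ler_wpM2l //.
exact: coord_le.
Qed.

(** A submersion is straightened by completing it with the projection along a
    right inverse [L] of its derivative [J]. *)
Lemma straighten n nu (U : 'rV[R]_n -> 'rV[R]_nu) (A : set 'rV[R]_n)
   (J : 'M[R]_(n, nu)) (L : 'M[R]_(nu, n)) :
  metric_open A -> A 0 -> U 0 = 0 -> (forall x, A x -> exists K, strict_diff U x K) ->
  strict_diff U 0 (fun v => v *m J) -> L *m J = 1%:M ->
  let G := fun x => x - x *m J *m L + U x *m L in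
  (forall x, G x *m J = U x) /\
  exists g d rho, [/\ local_inverse G g A d rho, g 0 = 0,
    forall xi, `|xi| < d -> exists K, strict_diff g xi K & strict_diff g 0 id].
Proof.
move=> oA A0 U0 dU hU LJ G.
have hJL : bounded_linear (fun x : 'rV[R]_n => x *m J *m L).
  exact: (bounded_linear_comp (bounded_linear_mulmx L) (bounded_linear_mulmx J)).
have sG x K : strict_diff U x K -> strict_diff G x (fun v => v - v *m J *m L + K v *m L).
  move=> hK; apply: strict_diff_add; last exact: (strict_diff_comp (bounded_linear_strict_diff _ (bounded_linear_mulmx L)) hK).
  apply: bounded_linear_strict_diff; apply: bounded_linear_add; first exact: bounded_linear_id.
  have := bounded_linear_scale (-1) hJL; congr bounded_linear; apply/funext => v; exact: scaleN1r.
split=> [x|].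
  by rewrite /G mulmxDl mulmxBl -!(mulmxA _ L J) LJ !mulmx1 subrr add0r.
apply: inverse_function => //.
- by rewrite /G U0 !mul0mx subrr addr0.
- by move=> x /dU[K /sG h]; eexists; exact: h.
by apply: strict_diff_ext (sG _ _ hU) _ => v; rewrite subrK.
Qed.

End InverseFunction.

(** * Complex-valued functions and eigen-coordinates *)

Section ComplexValued.
Context (R : realType).
Local Notation C := (R[i]).
Implicit Types V W : normedModType R.

(** The modulus as a real number, while [`|z|] is complex-valued. *)
Definition cmod : C -> R := @Normc.normc R.

Lemma cmod0 : cmod 0 = 0. Proof. exact: Normc.normc0. Qed.
Lemma cmod1 : cmod 1 = 1. Proof. exact: Normc.normc1. Qed.
Lemma cmodM z w : cmod (z * w) = cmod z * cmod w. Proof. exact: Normc.normcM. Qed.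
Lemma cmodD z w : cmod (z + w) <= cmod z + cmod w. Proof. exact: le_normcD. Qed.
Lemma cmodN z : cmod (- z) = cmod z. Proof. exact: normcN. Qed.
Lemma cmodV z : cmod z^-1 = (cmod z)^-1. Proof. exact: Normc.normcV. Qed.
Lemma cmod_ge0 z : 0 <= cmod z. Proof. by case: z => a b; apply: sqrtr_ge0. Qed.
Lemma cmod_eq0 z : (cmod z == 0) = (z == 0).
Proof.
apply/eqP/eqP; first exact: Normc.eq0_normc.
by move=> ->; exact: cmod0.
Qed.
Lemma cmodX z k : cmod (z ^+ k) = cmod z ^+ k.
Proof. by elim: k => [|k ih]; rewrite ?expr0 ?cmod1 // !exprS cmodM ih. Qed.
Lemma cmod_prod I (s : seq I) (f : I -> C) : cmod (\prod_(i <- s) f i) = \prod_(i <- s) cmod (f i).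
Proof. by elim: s => [|i s ih]; rewrite ?big_nil ?cmod1 // !big_cons cmodM ih. Qed.
Lemma cmod_sum I (s : seq I) (f : I -> C) : cmod (\sum_(i <- s) f i) <= \sum_(i <- s) cmod (f i).
Proof.
elim: s => [|i s ih]; rewrite ?big_nil ?cmod0 // !big_cons.
by apply: (le_trans (cmodD _ _)); rewrite lerD2l.
Qed.
Lemma cmod_conj z : cmod (conjc z) = cmod z. Proof. by case: z => a b /=; rewrite sqrrN. Qed.
Lemma cmod_real (x : R) : cmod (real_complex R x) = `|x|.
Proof. by rewrite /cmod /= expr0n /= addr0 sqrtr_sqr. Qed.
Lemma cmod_gt0 z : (0 < cmod z) = (z != 0).
Proof. by rewrite lt_def cmod_ge0 andbT cmod_eq0. Qed.

Lemma le_Re z : `|Re z| <= cmod z.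
Proof. by case: z => a b /=; rewrite -sqrtr_sqr ler_wsqrtr // lerDl sqr_ge0. Qed.
Lemma le_Im z : `|Im z| <= cmod z.
Proof. by case: z => a b /=; rewrite -sqrtr_sqr ler_wsqrtr // lerDr sqr_ge0. Qed.
Lemma le_cmod z : cmod z <= `|Re z| + `|Im z|.
Proof.
case: z => a b /=.
rewrite -[leRHS]ger0_norm ?addr_ge0 // -[leRHS]sqrtr_sqr ler_wsqrtr //.
rewrite sqrrD !real_normK ?num_real // -addrA lerD2l lerDr.
by rewrite mulrn_wge0 // mulr_ge0.
Qed.

Lemma ReD (z w : C) : Re (z + w) = Re z + Re w. Proof. by case: z; case: w. Qed.
Lemma ImD (z w : C) : Im (z + w) = Im z + Im w. Proof. by case: z; case: w. Qed.
Lemma ReN (z : C) : Re (- z) = - Re z. Proof. by case: z. Qed.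
Lemma ImN (z : C) : Im (- z) = - Im z. Proof. by case: z. Qed.
Lemma ReM (z w : C) : Re (z * w) = Re z * Re w - Im z * Im w.
Proof. by case: z => a b; case: w. Qed.
Lemma ImM (z w : C) : Im (z * w) = Re z * Im w + Im z * Re w.
Proof. by case: z => a b; case: w => c d /=; rewrite [b * c]mulrC [c * b]mulrC. Qed.
Lemma Re_conj (z : C) : Re (conjc z) = Re z. Proof. by case: z. Qed.
Lemma Im_conj (z : C) : Im (conjc z) = - Im z. Proof. by case: z. Qed.
Lemma Re_real (x : R) : Re (real_complex R x) = x. Proof. by []. Qed.
Lemma Im_real (x : R) : Im (real_complex R x) = 0. Proof. by []. Qed.
Lemma complex_eq (z w : C) : Re z = Re w -> Im z = Im w -> z = w.
Proof. by case: z => a b; case: w => c d /= -> ->. Qed.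

Definition cCk k V (A : set V) (f : V -> C) :=
  Ck k A (fun x => Re (f x)) /\ Ck k A (fun x => Im (f x)).

Definition cbigO V d (f : V -> C) := bigO d (fun x => cmod (f x)).

Lemma cCk_sub k V (A B : set V) (f : V -> C) :
  (forall x, A x -> B x) -> cCk k B f -> cCk k A f.
Proof. by move=> AB [h1 h2]; split; [apply: Ck_sub h1|apply: Ck_sub h2]. Qed.

Lemma cCk_le k l V (A : set V) (f : V -> C) : (k <= l)%N -> cCk l A f -> cCk k A f.
Proof. by move=> kl [h1 h2]; split; [apply: Ck_le h1|apply: Ck_le h2]. Qed.

Lemma cCk_cst k V (A : set V) (c : C) : cCk k A (fun _ : V => c).
Proof. by split; exact: Ck_cst. Qed.

Lemma cCk_add k V (A : set V) (f g : V -> C) :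
  cCk k A f -> cCk k A g -> cCk k A (fun x => f x + g x).
Proof.
move=> [h1 h2] [h3 h4]; split.
  have := Ck_add h1 h3; congr Ck; apply/funext => x; by rewrite ReD.
have := Ck_add h2 h4; congr Ck; apply/funext => x; by rewrite ImD.
Qed.

Lemma cCk_mul k V (A : set V) (f g : V -> C) :
  cCk k A f -> cCk k A g -> cCk k A (fun x => f x * g x).
Proof.
move=> [h1 h2] [h3 h4]; split.
  have := Ck_subr (Ck_mul h1 h3) (Ck_mul h2 h4); congr Ck; apply/funext => x; by rewrite ReM.
have := Ck_add (Ck_mul h1 h4) (Ck_mul h2 h3); congr Ck; apply/funext => x; by rewrite ImM.
Qed.

Lemma cCk_scale k V (A : set V) (c : C) (f : V -> C) :
  cCk k A f -> cCk k A (fun x => c * f x).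
Proof. by move=> h; apply: cCk_mul => //; exact: cCk_cst. Qed.

Lemma cCk_opp k V (A : set V) (f : V -> C) : cCk k A f -> cCk k A (fun x => - f x).
Proof.
by move=> /(cCk_scale (-1)); congr cCk; apply/funext => x; rewrite mulN1r.
Qed.

Lemma cCk_subr k V (A : set V) (f g : V -> C) :
  cCk k A f -> cCk k A g -> cCk k A (fun x => f x - g x).
Proof. by move=> h1 h2; apply: cCk_add => //; apply: cCk_opp. Qed.

Lemma cCk_conj k V (A : set V) (f : V -> C) : cCk k A f -> cCk k A (fun x => conjc (f x)).
Proof.
move=> [h1 h2]; split.
  by move: h1; congr Ck; apply/funext => x; rewrite Re_conj.
by move: (Ck_opp h2); congr Ck; apply/funext => x; rewrite Im_conj.
Qed.

Lemma cCk_sum k V (A : set V) I (s : seq I) (f : I -> V -> C) :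
  (forall i, cCk k A (f i)) -> cCk k A (fun x => \sum_(i <- s) f i x).
Proof.
move=> h; elim: s => [|i s ih].
  have := @cCk_cst k V A 0; congr cCk; apply/funext => x; by rewrite big_nil.
have := cCk_add (h i) ih; congr cCk; apply/funext => x; by rewrite big_cons.
Qed.

Lemma cCk_exp k V (A : set V) (f : V -> C) e : cCk k A f -> cCk k A (fun x => f x ^+ e).
Proof.
move=> h; elim: e => [|e ih].
  have := @cCk_cst k V A 1; congr cCk; apply/funext => x; by rewrite expr0.
have := cCk_mul h ih; congr cCk; apply/funext => x; by rewrite exprS.
Qed.

Lemma cCk_prod k V (A : set V) I (s : seq I) (f : I -> V -> C) :
  (forall i, cCk k A (f i)) -> cCk k A (fun x => \prod_(i <- s) f i x).
Proof.
move=> h; elim: s => [|i s ih].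
  have := @cCk_cst k V A 1; congr cCk; apply/funext => x; by rewrite big_nil.
have := cCk_mul (h i) ih; congr cCk; apply/funext => x; by rewrite big_cons.
Qed.

Lemma cCk_meval k V (A : set V) p (f : V -> 'I_p -> C) (P : mpoly.mpoly p C) :
  (forall i, cCk k A (fun x => f x i)) -> cCk k A (fun x => mpoly.meval (f x) P).
Proof.
move=> h; have : cCk k A (fun x => \sum_(m <- mpoly.msupp P)
    mpoly.mcoeff m P * \prod_(i < p) f x i ^+ m i).
  apply: cCk_sum => m; apply: cCk_scale; apply: cCk_prod => i; exact: cCk_exp.
by congr cCk; apply/funext => x; rewrite mpoly.mevalE.
Qed.

Lemma cbigO_le V d1 d2 (f : V -> C) : (d1 <= d2)%N -> cbigO d2 f -> cbigO d1 f.
Proof. exact: bigO_le. Qed.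

Lemma bigO_bound V d (f g : V -> R) (A : set V) :
  metric_open A -> A 0 -> (forall x, A x -> `|f x| <= `|g x|) -> bigO d g -> bigO d f.
Proof.
move=> oA A0 fg [c c0 [e e0 h]]; have [r r0 hr] := oA 0 A0.
exists c => //; exists (Num.min e r); first by rewrite lt_min e0.
move=> x; rewrite lt_min => /andP[xe xr]; apply: le_trans (h x xe).
by apply: fg; apply: hr; rewrite subr0.
Qed.

Lemma metric_openT V : metric_open (@setT V).
Proof. by move=> x _; exists 1. Qed.

Lemma cbigOD V d (f g : V -> C) : cbigO d f -> cbigO d g -> cbigO d (fun x => f x + g x).
Proof.
move=> h1 h2; apply: (bigO_bound (@metric_openT V) I _ (bigOD h1 h2)) => x _.
by rewrite !ger0_norm ?addr_ge0 ?cmod_ge0 // cmodD.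
Qed.

Lemma cbigOM V d1 d2 (f g : V -> C) :
  cbigO d1 f -> cbigO d2 g -> cbigO (d1 + d2) (fun x => f x * g x).
Proof.
by move=> h1 h2; have := bigOM h1 h2; congr bigO; apply/funext => x; rewrite cmodM.
Qed.

Lemma cbigON V d (f : V -> C) : cbigO d f -> cbigO d (fun x => - f x).
Proof. by congr bigO; apply/funext => x; rewrite cmodN. Qed.

Lemma cbigOB V d (f g : V -> C) : cbigO d f -> cbigO d g -> cbigO d (fun x => f x - g x).
Proof. by move=> h1 h2; apply: cbigOD => //; apply: cbigON. Qed.

Lemma cbigO_cst V (c : C) : cbigO 0 (fun _ : V => c).
Proof. exact: bigO_cst. Qed.

Lemma cbigO_zero V d : cbigO d (fun _ : V => 0).
Proof. by exists 0 => //; exists 1 => // x _; rewrite cmod0 normr0 mul0r. Qed.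

Lemma cbigO_scale V d (c : C) (f : V -> C) : cbigO d f -> cbigO d (fun x => c * f x).
Proof. by move=> h; have := cbigOM (cbigO_cst V c) h. Qed.

Lemma cbigO_sum V d I (s : seq I) (P : pred I) (f : I -> V -> C) :
  (forall i, P i -> cbigO d (f i)) -> cbigO d (fun x => \sum_(i <- s | P i) f i x).
Proof.
move=> h; elim: s => [|i s ih].
  by have := @cbigO_zero V d; congr cbigO; apply/funext => x; rewrite big_nil.
case: (boolP (P i)) => Pi.
  by have := cbigOD (h i Pi) ih; congr cbigO; apply/funext => x; rewrite big_cons Pi.
by move: ih; congr cbigO; apply/funext => x; rewrite big_cons (negPf Pi).
Qed.

Lemma cbigO_conj V d (f : V -> C) : cbigO d f -> cbigO d (fun x => conjc (f x)).
Proof. by congr bigO; apply/funext => x; rewrite cmod_conj. Qed.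

Lemma cbigO_ext V d (f g : V -> C) : (forall x, f x = g x) -> cbigO d f -> cbigO d g.
Proof. by move=> fg; have -> : f = g by apply/funext. Qed.

Lemma cbigO_Re V d (f : V -> C) : cbigO d f -> bigO d (fun x => Re (f x)).
Proof.
move=> h; apply: (bigO_bound (@metric_openT V) I _ h) => x _.
by rewrite [leRHS]ger0_norm ?cmod_ge0 // le_Re.
Qed.

Lemma cbigO_Im V d (f : V -> C) : cbigO d f -> bigO d (fun x => Im (f x)).
Proof.
move=> h; apply: (bigO_bound (@metric_openT V) I _ h) => x _.
by rewrite [leRHS]ger0_norm ?cmod_ge0 // le_Im.
Qed.

Lemma bigO_norm V d (f : V -> R) : bigO d f -> bigO d (fun x => `|f x|).
Proof. by move=> h; apply: (bigO_bound (@metric_openT V) I _ h) => x _; rewrite normr_id. Qed.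

Lemma bigO_cbigO V d (f : V -> C) :
  bigO d (fun x => Re (f x)) -> bigO d (fun x => Im (f x)) -> cbigO d f.
Proof.
move=> h1 h2.
apply: (bigO_bound (@metric_openT V) I _ (bigOD (bigO_norm h1) (bigO_norm h2))) => x _.
by rewrite (ger0_norm (cmod_ge0 _)) [leRHS]ger0_norm ?addr_ge0 // le_cmod.
Qed.

Lemma cbigO_comp V d (f : V -> C) (F : V -> V) L :
  frechet_diff F 0 L -> F 0 = 0 -> cbigO d f -> cbigO d (fun x => f (F x)).
Proof.
move=> [hL h] F0 [c c0 [e e0 he]]; have [M M0 hM] := hL.2.
have [r r0 hr] := h 1 ltr01.
have M1 : 0 < M + 1 by rewrite ltr_wpDl.
exists (c * (M + 1) ^+ d); first by rewrite mulr_ge0 // exprn_ge0 // ltW.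
exists (Num.min r (e / (M + 1))); first by rewrite lt_min r0 divr_gt0.
move=> x; rewrite lt_min => /andP[xr].
rewrite ltr_pdivlMr // => xe.
have H : `|F x| <= (M + 1) * `|x|.
  have := hr x; rewrite subr0 F0 subr0 => /(_ xr) H1; have := hM x.
  by have := ler_normD (F x - L x) (L x); rewrite subrK; lra.
apply: (le_trans (he _ _)); first by apply: le_lt_trans H _; rewrite mulrC.
rewrite -mulrA -exprMn ler_wpM2l // lerXn2r ?nnegrE // mulr_ge0 // ltW //.
Qed.

Lemma cbigO_exp V (f : V -> C) e : cbigO 1 f -> cbigO e (fun x => f x ^+ e).
Proof.
move=> hf; elim: e => [|e ih].
  by have := cbigO_cst V 1; congr cbigO; apply/funext => x; rewrite expr0.
by have := cbigOM hf ih; congr cbigO; apply/funext => x; rewrite exprS.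
Qed.

Lemma cbigO_prod V p (u : V -> 'I_p -> C) (m : 'I_p -> nat) (s : seq 'I_p) :
  (forall k, cbigO 1 (fun x => u x k)) ->
  cbigO (\sum_(k <- s) m k) (fun x => \prod_(k <- s) u x k ^+ m k).
Proof.
move=> hu; elim: s => [|j s ih].
  by have := cbigO_cst V 1; rewrite big_nil; congr cbigO; apply/funext => x; rewrite big_nil.
by have := cbigOM (cbigO_exp (m j) (hu j)) ih; rewrite big_cons; congr cbigO; apply/funext => x; rewrite big_cons.
Qed.

(** Telescoping: each difference gains [d] over the order of its factor. *)
Lemma cbigO_prod_sub V d p (u w : V -> 'I_p -> C) (m : 'I_p -> nat) :
  (forall k, cbigO 1 (fun x => u x k)) -> (forall k, cbigO 1 (fun x => w x k)) ->
  (forall k, cbigO d.+1 (fun x => u x k - w x k)) ->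
  cbigO (\sum_k m k + d) (fun x => \prod_k u x k ^+ m k - \prod_k w x k ^+ m k).
Proof.
move=> hu hw hd.
have hXd k e : cbigO (e + d) (fun x => u x k ^+ e - w x k ^+ e).
  elim: e => [|e ih].
    by have := cbigO_zero V (0 + d); congr cbigO; apply/funext => x; rewrite !expr0 subrr.
  have h1 := cbigOM (hd k) (cbigO_exp e (hu k)).
  have h2 := cbigOM (hw k) ih.
  rewrite addSn addnC -addSn in h1; have := cbigOD h1 h2.
  congr cbigO; apply/funext => x; rewrite !exprS; ring.
elim: (index_enum _) => [|k s ih].
  by have := cbigO_zero V (\sum_(k <- [::]) m k + d); congr cbigO; apply/funext => x; rewrite !big_nil subrr.
have h1 := cbigOM (hXd k (m k)) (cbigO_prod m s hu).
have h2 := cbigOM (cbigO_exp (m k) (hw k)) ih.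
rewrite big_cons.
have e1 : (m k + d + \sum_(j <- s) m j = m k + \sum_(j <- s) m j + d)%N by rewrite addnAC.
rewrite e1 in h1; rewrite addnA in h2; have := cbigOD h1 h2.
congr cbigO; apply/funext => x; rewrite !big_cons; ring.
Qed.

End ComplexValued.

Section Coordinates.
Context (R : realType).
Local Notation C := (R[i]).

(** For square [V] this is the change of variables of the theorem; rectangular
    [V] give part of the eigen-coordinates. *)
Definition ecoord p n (V : 'M[C]_(p, n)) (x : 'rV[R]_n) : 'rV[C]_p := complexify x *m V^T.

Lemma ecoordE p n (V : 'M[C]_(p, n)) x k :
  ecoord V x 0 k = \sum_i real_complex R (x 0 i) * V k i.
Proof. by rewrite mxE; apply: eq_bigr => i _; rewrite !mxE. Qed.

Lemma complexifyD m n (a b : 'M[R]_(m, n)) : complexify (a + b) = complexify a + complexify b.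
Proof. exact: map_mxD. Qed.

Lemma complexifyZ m n (c : R) (b : 'M[R]_(m, n)) :
  complexify (c *: b) = real_complex R c *: complexify b.
Proof. exact: map_mxZ. Qed.

Lemma ecoordD p n (V : 'M[C]_(p, n)) x y : ecoord V (x + y) = ecoord V x + ecoord V y.
Proof. by rewrite /ecoord complexifyD mulmxDl. Qed.

Lemma ecoordZ p n (V : 'M[C]_(p, n)) (c : R) x :
  ecoord V (c *: x) = real_complex R c *: ecoord V x.
Proof. by rewrite /ecoord complexifyZ -scalemxAl. Qed.

Lemma ecoord0 p n (V : 'M[C]_(p, n)) : ecoord V 0 = 0.
Proof. by rewrite -(scale0r 0) ecoordZ scale0r. Qed.

Lemma ecoordN p n (V : 'M[C]_(p, n)) x : ecoord V (- x) = - ecoord V x.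
Proof. by rewrite -scaleN1r ecoordZ rmorphN rmorph1 scaleN1r. Qed.

Lemma bounded_linear_ecoord_Re p n (V : 'M[C]_(p, n)) k : bounded_linear (fun x => Re (ecoord V x 0 k)).
Proof.
have := bounded_linear_mulmx (\matrix_(i < n, j < 1) Re (V k i)).
move=> /(bounded_linear_comp (@bounded_linear_coord R 1 0)); congr bounded_linear; apply/funext => x /=.
rewrite ecoordE mxE; elim/big_rec2: _ => // i y1 y2 _ ->.
by rewrite mxE ReD ReM Re_real Im_real mul0r subr0.
Qed.

Lemma bounded_linear_ecoord_Im p n (V : 'M[C]_(p, n)) k : bounded_linear (fun x => Im (ecoord V x 0 k)).
Proof.
have := bounded_linear_mulmx (\matrix_(i < n, j < 1) Im (V k i)).
move=> /(bounded_linear_comp (@bounded_linear_coord R 1 0)); congr bounded_linear; apply/funext => x /=.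
rewrite ecoordE mxE; elim/big_rec2: _ => // i y1 y2 _ ->.
by rewrite mxE ImD ImM Re_real Im_real mul0r addr0.
Qed.

Lemma cCk_ecoord k p n (V : 'M[C]_(p, n)) (W : normedModType R) (A : set W)
   (f : W -> 'rV[R]_n) j : Ck k A f -> cCk k A (fun x => ecoord V (f x) 0 j).
Proof.
move=> h; split; [exact: (Ck_linl (bounded_linear_ecoord_Re V j))|exact: (Ck_linl (bounded_linear_ecoord_Im V j))].
Qed.

Lemma cbigO_ecoord p n (V : 'M[C]_(p, n)) k : cbigO 1 (fun x => ecoord V x 0 k).
Proof.
apply: bigO_cbigO; apply: bigO_bounded_linear; [exact: bounded_linear_ecoord_Re|exact: bounded_linear_ecoord_Im].
Qed.

Lemma ecoord_inv n (V : 'M[C]_n) (x : 'rV[R]_n) i : V \in unitmx ->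
  real_complex R (x 0 i) = \sum_k (invmx V) i k * ecoord V x 0 k.
Proof.
move=> uV; have : ecoord V x *m (invmx V)^T = complexify x.
  by rewrite /ecoord -mulmxA -trmx_mul mulVmx // trmx1 mulmx1.
move=> /matrixP/(_ 0 i); rewrite mxE [in RHS]mxE => <-.
by apply: eq_bigr => k _; rewrite [X in _ * X]mxE mulrC.
Qed.

Lemma ecoord_norm n (V : 'M[C]_n) : V \in unitmx ->
  exists2 c : R, 0 < c & forall x, `|x| <= c * \sum_k cmod (ecoord V x 0 k).
Proof.
move=> uV; pose M := \sum_i \sum_k cmod ((invmx V) i k).
have M0 : 0 <= M by do 2!apply: sumr_ge0 => ? _; exact: cmod_ge0.
exists (M + 1) => [|x]; first by rewrite ltr_wpDl.
have S0 : 0 <= \sum_k cmod (ecoord V x 0 k) by apply: sumr_ge0 => ? _; exact: cmod_ge0.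
apply: (@le_trans _ _ (M * \sum_k cmod (ecoord V x 0 k))); last by rewrite ler_wpM2r // lerDl.
apply: rV_norm_le => [|i]; first exact: mulr_ge0.
rewrite -cmod_real (ecoord_inv _ _ uV); apply: (le_trans (cmod_sum _ _)).
apply: (@le_trans _ _ ((\sum_k cmod ((invmx V) i k)) * \sum_k cmod (ecoord V x 0 k))).
  rewrite mulr_suml; apply: ler_sum => k _; rewrite cmodM ler_wpM2l ?cmod_ge0 //.
  by rewrite (bigD1 k) //= lerDl; apply: sumr_ge0 => ? _; exact: cmod_ge0.
apply: ler_wpM2r => //; rewrite /M [leRHS](bigD1 i) //= lerDl.
by do 2!apply: sumr_ge0 => ? _; exact: cmod_ge0.
Qed.

Definition cDk n k (A : set 'rV[R]_n) (f : 'rV[R]_n -> C) :=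
  Dk k A (fun x => Re (f x)) /\ Dk k A (fun x => Im (f x)).

Definition supp_in n (P : mpoly.multinom n -> Prop) (p : mpoly.mpoly n C) :=
  forall m, m \in mpoly.msupp p -> P m.

Lemma supp_scale n P c (p : mpoly.mpoly n C) : supp_in P p -> supp_in P (c *: p).
Proof. by move=> h m /mpoly.msuppZ_le/h. Qed.

Lemma supp_add n P (p q : mpoly.mpoly n C) : supp_in P p -> supp_in P q -> supp_in P (p + q).
Proof. by move=> h k m /mpoly.msuppD_le; rewrite mem_cat => /orP[/h|/k]. Qed.

Lemma supp_sum n P (I : eqType) (s : seq I) (Q : pred I) (p : I -> mpoly.mpoly n C) :
  (forall i, i \in s -> Q i -> supp_in P (p i)) -> supp_in P (\sum_(i <- s | Q i) p i).
Proof.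
move=> h; rewrite big_seq_cond; elim/big_rec: _ => [|i q /andP[is_ Qi] hq].
  by move=> m; rewrite mpoly.msupp0.
exact: (supp_add (h i is_ Qi) hq).
Qed.

Lemma supp_X n (P : mpoly.multinom n -> Prop) m : P m -> supp_in P (mpoly.mpolyX C m).
Proof. by move=> h m'; rewrite mpoly.msuppX inE => /eqP ->. Qed.

Definition homp n d := supp_in (fun m : mpoly.multinom n => mpoly.mdeg m = d).

Lemma homp_mul n d e (p q : mpoly.mpoly n C) : homp d p -> homp e q -> homp (d + e) (p * q).
Proof.
move=> h k m /mpoly.msuppM_le/allpairsP[[m1 m2] /= [/h <- /k <- ->]].
exact: mpoly.mdegD.
Qed.

Lemma mevM n (w : 'I_n -> C) (p q : mpoly.mpoly n C) :
  mpoly.meval w (p * q) = mpoly.meval w p * mpoly.meval w q.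
Proof. exact: mpoly.mevalM. Qed.

(** Real coordinates are linear forms in the coordinates given by an invertible [V]. *)
Lemma hpoly_homp n (V : 'M[C]_n) e (q : 'rV[R]_n -> R) : V \in unitmx -> hpoly e q ->
  exists2 p : mpoly.mpoly n C, homp e p &
    forall x, real_complex R (q x) = mpoly.meval (ecoord V x 0) p.
Proof.
move=> uV; elim: e q => [|e ih] q /=.
  case=> c hc; exists (real_complex R c *: 1) => [|x]; last by rewrite mpoly.mevalZ mpoly.meval1 mulr1 hc.
  by apply: supp_scale => m; rewrite mpoly.msupp1 inE => /eqP ->; exact: mpoly.mdeg0.
case=> g hg hq.
have /fin_all_exists[P hP] i : exists p : mpoly.mpoly n C, homp e p /\
    forall x, real_complex R (g i x) = mpoly.meval (ecoord V x 0) p.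
  by have [p p1 p2] := ih _ (hg i); exists p.
pose l i : mpoly.mpoly n C := \sum_k (invmx V) i k *: mpoly.mpolyX C (mpoly.mnm1 k).
exists (\sum_i l i * P i) => [|x].
  apply: supp_sum => i _ _; rewrite -add1n; apply: homp_mul (hP i).1.
  apply: supp_sum => k _ _; apply: supp_scale; by apply: supp_X; rewrite mpoly.mdeg1.
rewrite hq (raddf_sum (real_complex R)) (raddf_sum (mpoly.meval _)).
apply: eq_bigr => i _; apply: (etrans (rmorphM (real_complex R) _ _)).
apply: etrans (esym (mevM _ _ _)); rewrite -(hP i).2; congr (_ * _).
apply: (etrans (ecoord_inv x i uV)); rewrite (raddf_sum (mpoly.meval _)).
by apply: eq_bigr => k _; rewrite /= mpoly.mevalZ mpoly.mevalXU.
Qed.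

Lemma leading_homp n (V : 'M[C]_n) e (f : 'rV[R]_n -> C) (A : set 'rV[R]_n) :
  V \in unitmx -> metric_open A -> A 0 -> cDk e.+1 A f -> cbigO e f ->
  exists2 p : mpoly.mpoly n C, homp e p &
    cbigO e.+1 (fun x => f x - mpoly.meval (ecoord V x 0) p).
Proof.
move=> uV oA A0 [h1 h2] hf.
have [q1 /(hpoly_homp uV)[p1 hp1 E1] o1] := leading_part oA A0 h1 (cbigO_Re hf).
have [q2 /(hpoly_homp uV)[p2 hp2 E2] o2] := leading_part oA A0 h2 (cbigO_Im hf).
exists (p1 + (Complex 0 1 : C) *: p2); first by apply: supp_add => //; apply: supp_scale.
have c1 : cbigO e.+1 (fun x => real_complex R (Re (f x) - q1 x)).
  by apply: bigO_cbigO => //=; have := cbigO_zero 'rV[R]_n e.+1; apply: cbigO_Im.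
have c2 : cbigO e.+1 (fun x => (Complex 0 1 : C) * real_complex R (Im (f x) - q2 x)).
  apply: cbigO_scale.
  by apply: bigO_cbigO => //=; have := cbigO_zero 'rV[R]_n e.+1; apply: cbigO_Im.
apply: cbigO_ext (cbigOD c1 c2) => x.
rewrite mpoly.mevalD mpoly.mevalZ -E1 -E2.
case: (f x) => a b; rewrite /=.
by apply: complex_eq; rewrite !(ReD, ImD, ReM, ImM, ReN, ImN) /=; ring.
Qed.

End Coordinates.

(** * Spectral bounds and real structures *)

Section SpectralBounds.
Context (R : realType).
Local Notation C := (R[i]).

Lemma bigmine_le (I : finType) (f : I -> \bar R) i :
  (\big[mine/+oo%E]_k f k <= f i)%E.
Proof. exact: bigmin_le_cond. Qed.

Lemma le_bigmaxe (I : finType) (f : I -> \bar R) i :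
  (f i <= \big[maxe/-oo%E]_k f k)%E.
Proof. exact: (le_bigmax_cond -oo%E f). Qed.

(** By the conventions on extended reals the quotient is [+oo] if one of the
    first eigenvalues vanishes, in particular if the spectral radius does;
    otherwise multiply by the negative logarithm of the spectral radius. *)
Lemma beth_bound n nu (le_nu_n : (nu <= n)%N) (mu : 'I_n -> C) (s : nat) (k0 : 'I_n) :
  (forall k, cmod (mu k) <= cmod (mu k0)) -> cmod (mu k0) < 1 ->
  (beth le_nu_n mu < (s%:R)%:E)%E ->
  forall j : 'I_nu, cmod (mu k0) ^+ s < cmod (mu (widen_ord le_nu_n j)).
Proof.
move=> hk0 lt1; rewrite /beth.
set m := (\big[mine/+oo]_(k < nu) _)%E; set D := (\big[maxe/-oo]_(k < n) _)%E => hb j.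
have mj : (m <= lne (cmod (mu (widen_ord le_nu_n j)))%:E)%E by exact: bigmine_le.
have D0 : (lne (cmod (mu k0))%:E <= D)%E by exact: le_bigmaxe.
have DE : D = lne (cmod (mu k0))%:E.
  apply/eqP; rewrite eq_le D0 andbT; apply/bigmax_leP; split=> [|k _]; first exact: leNye.
  by rewrite lee_lne ?in_itv /= ?leey ?andbT ?lee_fin ?cmod_ge0 //; exact: hk0.
have [z0|z0] := eqVneq (cmod (mu k0)) 0.
  have mN : m = -oo%E.
    by apply/eqP; rewrite -leeNy_eq; apply: (le_trans mj); rewrite le0_lneNy // lee_fin -z0; exact: hk0.
  by move: hb; rewrite mN DE z0 le0_lneNy // inveNy mulNyNy ltNge leey.
have p0 : 0 < cmod (mu k0) by rewrite lt_def z0 cmod_ge0.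
move: hb; rewrite DE lne_EFin //.
have ln0 : ln (cmod (mu k0)) < 0 by rewrite ln_lt0 // p0.
rewrite inver (negPf (ltr0_neq0 ln0)).
case: m mj => [r| |] mj.
- rewrite -EFinM lte_fin ltr_ndivrMr // => hr.
  have aj : 0 < cmod (mu (widen_ord le_nu_n j)).
    rewrite lt_def cmod_ge0 andbT; apply/negP => /eqP e0.
    by move: mj; rewrite e0 le0_lneNy.
  move: mj; rewrite lne_EFin // lee_fin => mj.
  rewrite -ltr_ln ?posrE ?exprn_gt0 // lnXn // -mulr_natl.
  exact: lt_le_trans mj.
- move: mj; rewrite leye_eq => /eqP.
  have [a0|a0] := eqVneq (cmod (mu (widen_ord le_nu_n j))) 0; first by rewrite a0 le0_lneNy.
  by rewrite lne_EFin // lt_def a0 cmod_ge0.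
by rewrite mulNyr ltr0_sg ?invr_lt0 // EFinN mulN1e /= ltNge leey.
Qed.

Lemma exp_gap (nu : nat) (a : 'I_nu -> R) (rho : R) s : 0 <= rho < 1 ->
  (forall j, rho ^+ s < a j) -> exists q, [/\ rho < q, q < 1 & forall j, q ^+ s < a j].
Proof.
move=> /andP[r0 r1] h.
pose a0 := \big[Num.min/(rho ^+ s + 1)]_j a j.
have ha0 : rho ^+ s < a0.
  by rewrite /a0; elim/big_ind: _ => // [|x y x0 y0]; rewrite ?ltrDl ?ltr01 // lt_min x0.
have ha j : a0 <= a j by exact: bigmin_le_cond.
have c : {for rho, continuous (fun t : R => t ^+ s)} by apply: exprn_continuous.
have g0 : 0 < (a0 - rho ^+ s) / 2 by rewrite divr_gt0 // subr_gt0.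
have /cont_at_continuous/(_ _ g0)[d d0 hd] := c.
pose q := rho + Num.min d (1 - rho) / 2.
have m0 : 0 < Num.min d (1 - rho) by rewrite lt_min d0 subr_gt0.
have md : Num.min d (1 - rho) <= d by rewrite ge_min lexx.
have m1 : Num.min d (1 - rho) <= 1 - rho by rewrite ge_min lexx orbT.
exists q; split; [rewrite /q; lra|rewrite /q; lra|] => j.
apply: lt_le_trans (ha j).
have e : q - rho = Num.min d (1 - rho) / 2 by rewrite /q addrC addKr.
have H := hd q; rewrite e gtr0_norm ?divr_gt0 // in H.
have {}H := H ltac:(lra); have := ler_norm (q ^+ s - rho ^+ s); lra.
Qed.

End SpectralBounds.

Section RealStructures.
Context (R : realType).
Local Notation C := (R[i]).
Local Notation conjm := (map_mx (@conjc R)).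

Lemma poly_nat_nonroot (q : {poly C}) : q != 0 -> exists t : nat, q.[t%:R] != 0.
Proof.
move=> q0; apply: contrapT => /forallNP h.
have : (size [seq (i%:R : C) | i <- iota 0 (size q)] < size q)%N.
  apply: max_poly_roots => //.
    by apply/allP => x /mapP[i _ ->]; rewrite /root; apply: contrapT => /negP; apply: h.
  rewrite map_inj_uniq ?iota_uniq // => i j /eqP.
  by rewrite eqr_nat => /eqP.
by rewrite size_map size_iota ltnn.
Qed.

(** Along [c = 1 + i t] the determinant is a polynomial in [t].  At [t = - i] the
    matrix is twice the identity, so the polynomial is nonzero and does not
    vanish at some natural number. *)
Lemma hilbert90 n (M : 'M[C]_n) : exists c : C, c%:M + conjc c *: M \in unitmx.
Proof.
(* The matrix for the complex parameter [t]; conjugation of [c] replaces [i] by [- i]. *)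
pose N : 'M[{poly C}]_n := (1 + (Complex 0 1 : C) *: 'X)%:M + (1 - (Complex 0 1 : C) *: 'X) *: map_mx polyC M.
have hN (z : C) : map_mx (horner_eval z) N =
    (1 + (Complex 0 1 : C) * z)%:M + (1 - (Complex 0 1 : C) * z) *: M.
  apply/matrixP => i j; rewrite !mxE /horner_eval /=.
  by rewrite !hornerE hornerMn !hornerE.
have detN0 : \det N != 0.
  apply/eqP => d0; have := det_map_mx (horner_eval (Complex 0 (-1) : C)) N.
  rewrite hN d0 rmorph0 (_ : (Complex 0 1 : C) * Complex 0 (-1) = 1); last first.
    by apply: complex_eq; rewrite ?ReM ?ImM /=; ring.
  rewrite subrr scale0r addr0 det_scalar => /eqP; rewrite expf_eq0 => /andP[_].
  by rewrite -(natrD _ 1 1) pnatr_eq0.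
have [t ht] := poly_nat_nonroot detN0.
exists (1 + (Complex 0 1 : C) * t%:R).
have tr : (t%:R : C) = real_complex R t%:R by rewrite rmorph_nat.
have -> : conjc (1 + (Complex 0 1 : C) * t%:R) = 1 - (Complex 0 1 : C) * t%:R.
  by rewrite tr; apply: complex_eq; rewrite /= !(mul0r, mulr0, mul1r, mulr1, subr0, add0r, addr0, oppr0).
by rewrite unitmxE -hN det_map_mx unitfE.
Qed.

Definition tau_mx n (tau : 'I_n -> 'I_n) : 'M[C]_n := \matrix_(i, j) (j == tau i)%:R.

Lemma tau_mxE n m (tau : 'I_n -> 'I_n) (A : 'M[C]_(n, m)) i j :
  (tau_mx tau *m A) i j = A (tau i) j.
Proof.
rewrite mxE (bigD1 (tau i)) //= mxE eqxx mul1r big1 ?addr0 // => k ki.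
by rewrite mxE (negPf ki) mul0r.
Qed.

Lemma conjm_mul m n p (A : 'M[C]_(m, n)) (B : 'M[C]_(n, p)) : conjm (A *m B) = conjm A *m conjm B.
Proof. exact: map_mxM. Qed.

Lemma conjmK m n (A : 'M[C]_(m, n)) : conjm (conjm A) = A.
Proof. by apply/matrixP => i j; rewrite !mxE conjcK. Qed.

Lemma conjm_tau n (tau : 'I_n -> 'I_n) : conjm (tau_mx tau) = tau_mx tau.
Proof. by apply/matrixP => i j; rewrite !mxE conjc_nat. Qed.

Lemma tau_mx_sqr n (tau : 'I_n -> 'I_n) : involutive tau -> tau_mx tau *m tau_mx tau = 1%:M.
Proof.
by move=> h; apply/matrixP => i j; rewrite tau_mxE !mxE h eq_sym.
Qed.

Lemma conjm_complexify m n (A : 'M[R]_(m, n)) : conjm (complexify A) = complexify A.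
Proof. by apply/matrixP => i j; rewrite !mxE conjc_real. Qed.

(** Conjugation acts on the space through a matrix [M] in the given basis. *)
Lemma conjugation_matrix nu n (V : 'M[C]_(nu, n)) (A : 'M[R]_n) (D : 'M[C]_nu) :
  row_free V -> V *m complexify A = D *m V -> (conjm V <= V)%MS ->
  exists M, [/\ conjm V = M *m V, conjm M *m M = 1%:M & conjm D *m M = M *m D].
Proof.
move=> fV hA /submxP[M hM]; exists M; split=> //.
  apply: (row_free_inj fV); rewrite mul1mx -mulmxA -hM.
  by rewrite -conjm_mul -hM conjmK.
apply: (row_free_inj fV); rewrite -!mulmxA -hM -hA.
by rewrite [RHS]mulmxA -hM -[complexify A]conjm_complexify -(conjm_mul V) hA conjm_mul.
Qed.

(** With [conj V = M V] and [Pi] the permutation matrix of the pairing, put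
    [P = c + conj c Pi M].  Then [conj P M = Pi P], which is the required
    symmetry of [P V]; moreover [P] commutes with the matrix of eigenvalues, and
    it is invertible for a suitable [c]. *)
Lemma symmetric_eigenbasis nu n (V : 'M[C]_(nu, n)) (A : 'M[R]_n) (d : 'I_nu -> C) tau :
  row_free V -> V *m complexify A = diag_mx (\row_k d k) *m V ->
  (conjm V <= V)%MS -> conj_pairing d tau ->
  exists P : 'M[C]_nu, [/\ P \in unitmx,
    forall k l, (P *m V) (tau k) l = conjc ((P *m V) k l) &
    (P *m V) *m complexify A = diag_mx (\row_k d k) *m (P *m V)].
Proof.
move=> fV hA hc [tau2 htau _].
have [M [hM MM hD]] := conjugation_matrix fV hA hc; set D := diag_mx _ in hA hD *.
pose Pi := tau_mx tau.
have Pi2 : Pi *m Pi = 1%:M := tau_mx_sqr tau2.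
have DPi : D *m Pi = Pi *m conjm D.
  apply/matrixP => i j; rewrite tau_mxE mul_diag_mx !mxE htau.
  have -> : (j == tau i) = (i == tau j) by rewrite -(inj_eq (inv_inj tau2)) tau2 eq_sym.
  rewrite -[tau i == j](inj_eq (inv_inj tau2)) tau2.
  by case: (i == tau j); rewrite ?mulr1n ?mulr0n ?conjcK ?conjc0 ?mulr1 ?mulr0.
have [c hu] := hilbert90 (Pi *m M).
pose P := c%:M + conjc c *: (Pi *m M).
have PD : P *m D = D *m P.
  rewrite mulmxDl mulmxDr scalar_mxC -scalemxAl -scalemxAr; congr (_ + _ *: _).
  by rewrite -mulmxA -hD mulmxA -DPi mulmxA.
have hcP : conjm P *m M = Pi *m P.
  rewrite /P map_mxD map_scalar_mx map_mxZ conjm_mul /= conjcK (conjm_tau tau).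
  rewrite mulmxDl mulmxDr mul_scalar_mx mul_mx_scalar -scalemxAl -scalemxAr -mulmxA MM.
  by rewrite mulmx1 mulmxA Pi2 mul1mx addrC.
exists P; split=> //.
- move=> k l; rewrite -(tau_mxE tau (P *m V)) mulmxA -hcP -mulmxA -hM -conjm_mul.
  by rewrite mxE.
- by rewrite -mulmxA hA mulmxA PD mulmxA.
Qed.

(** The case [M = Pi] of the same construction. *)
Lemma real_structure nu (tau : 'I_nu -> 'I_nu) : involutive tau ->
  exists T : 'M[C]_nu, T \in unitmx /\ forall k l, T (tau k) l = conjc (T k l).
Proof.
move=> tau2; have [c hu] := hilbert90 (tau_mx tau).
exists (c%:M + conjc c *: tau_mx tau); split=> // k l.
rewrite !mxE rmorphD rmorphMn rmorphM /= conjcK conjc_nat tau2 addrC.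
by rewrite [l == k]eq_sym [tau k == l]eq_sym !mulr_natr.
Qed.

(** The preimage of a symmetric vector satisfies the same linear equations as
    its conjugate, hence is real. *)
Lemma real_coordinates nu (tau : 'I_nu -> 'I_nu) (T : 'M[C]_nu) (u : 'rV[C]_nu) :
  involutive tau -> T \in unitmx -> (forall k l, T (tau k) l = conjc (T k l)) ->
  (forall k, u 0 (tau k) = conjc (u 0 k)) ->
  ecoord T (map_mx (@complex.Re R) (u *m (invmx T)^T)) = u.
Proof.
move=> tau2 uT hT hu.
set x := u *m _.
have xT : x *m T^T = u by rewrite /x -mulmxA -trmx_mul mulmxV // trmx1 mulmx1.
have cu : conjm u = u *m (tau_mx tau)^T.
  by apply/rowP => k; rewrite mxE -hu -[in RHS](trmxK u) -trmx_mul mxE tau_mxE mxE.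
have cT : conjm T = tau_mx tau *m T.
  by apply/matrixP => i j; rewrite tau_mxE mxE -hT.
have uTt : T^T \in unitmx by rewrite unitmx_tr.
have utau : (tau_mx tau)^T \in unitmx.
  by rewrite unitmx_tr; apply: (mulmx1_unit (tau_mx_sqr tau2)).1.
have cx : conjm x = x.
  have : conjm (x *m T^T) = x *m T^T *m (tau_mx tau)^T by rewrite xT cu.
  rewrite conjm_mul -map_trmx cT trmx_mul mulmxA.
  by move=> /(can_inj (mulmxK utau))/(can_inj (mulmxK uTt)).
have -> : complexify (map_mx (@complex.Re R) x) = x -> ecoord T (map_mx (@complex.Re R) x) = u.
  by move=> h; rewrite /ecoord h.
  by [].
clearbody x; apply/rowP => k; rewrite !mxE; have /rowP/(_ k) := cx; rewrite mxE.
case: (x 0 k) => a b [] h; apply: complex_eq => //=.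
by move: h; lra.
Qed.

(** Similar matrices have the same characteristic polynomial, so the multiset of
    eigenvalues is closed under conjugation. *)
Lemma diag_conj_perm nu (M : 'M[C]_nu) (d : 'I_nu -> C) : M \in unitmx ->
  diag_mx (\row_k conjc (d k)) *m M = M *m diag_mx (\row_k d k) ->
  forall z, count (fun k => d k == z) (enum 'I_nu) = count (fun k => d k == conjc z) (enum 'I_nu).
Proof.
move=> uM h z.
have hp (e : 'I_nu -> C) : char_poly (diag_mx (\row_k e k)) = \prod_(a <- [seq e k | k <- enum 'I_nu]) ('X - a%:P).
  rewrite char_poly_trig ?diag_mx_is_trig // big_map big_enum /=.
  by apply: eq_bigr => k _; rewrite !mxE eqxx mulr1n.
have E : char_poly (diag_mx (\row_k conjc (d k))) = char_poly (diag_mx (\row_k d k)).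
  have uM' : \det (map_mx polyC M) != 0.
    by rewrite det_map_mx polyC_eq0 -unitfE -unitmxE.
  apply: (mulIf uM'); rewrite /char_poly [RHS]mulrC -!det_mulmx.
  congr (\det _); rewrite /char_poly_mx mulmxBl mulmxBr scalar_mxC -!map_mxM h.
  by [].
move: E; rewrite !hp => /prod_XsubC_eq/permP/(_ (pred1 (conjc z))).
rewrite !count_map => E; rewrite -E.
by apply: eq_count => k /=; rewrite (inj_eq (can_inj (@conjcK R))).
Qed.

(** Match the k-th index with eigenvalue [z] with the k-th index with eigenvalue
    [conj z]; for real [z] this is the identity. *)
Lemma conj_pairing_exists nu (d : 'I_nu -> C) :
  (forall z, count (fun k => d k == z) (enum 'I_nu) = count (fun k => d k == conjc z) (enum 'I_nu)) ->
  exists tau, conj_pairing d tau.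
Proof.
move=> h; pose cls z := [seq k <- enum 'I_nu | d k == z].
have hs z : size (cls z) = size (cls (conjc z)) by rewrite !size_filter h.
have uc z : uniq (cls z) by rewrite filter_uniq ?enum_uniq.
have mc k : k \in cls (d k) by rewrite mem_filter eqxx mem_enum.
pose tau k := nth k (cls (conjc (d k))) (index k (cls (d k))).
have ik k : (index k (cls (d k)) < size (cls (conjc (d k))))%N by rewrite -hs index_mem mc.
have dt k : d (tau k) = conjc (d k).
  by have := mem_nth k (ik k); rewrite mem_filter => /andP[/eqP].
exists tau; split=> // k.
  rewrite {1}/tau dt conjcK /tau index_uniq //.
  rewrite (set_nth_default k) ?nth_index //; rewrite index_mem //.
by move=> e; rewrite /tau e nth_index.
Qed.

End RealStructures.

(** * The linear functional equation *)

Section Conjugacy.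
Context (R : realType).
Local Notation C := (R[i]).

(** A homogeneous function of degree one that is the leading part of a function
    with zero derivative vanishes, as seen along rays. *)
Lemma zero_derivative_order n (A : set 'rV[R]_n) (g : 'rV[R]_n -> R) :
  metric_open A -> A 0 -> Dk 2 A g -> g 0 = 0 -> frechet_diff g 0 (fun=> 0) -> bigO 2 g.
Proof.
move=> oA A0 hT g0 hg.
have o1 : bigO 1 g.
  have [d d0 hd] := hg.2 1 ltr01; exists 1 => //; exists d => // x xd.
  by have := hd x; rewrite subr0 g0 !subr0 expr1; apply.
have [p hp [K K0 [e e0 he]]] := leading_part oA A0 hT o1.
suff p0 x : p x = 0 by exists K => //; exists e => // x /he; rewrite p0 subr0.
apply/eqP; rewrite -normr_le0; apply/ler_addgt0Pr => c c0; rewrite add0r.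
have x1 : 0 < `|x| + 1 by rewrite ltr_wpDl.
have [d d0 hd] := hg.2 (c / 2 / (`|x| + 1)) ltac:(by rewrite !divr_gt0).
pose t := Num.min (Num.min e d / (`|x| + 1)) (c / 2 / ((K + 1) * (`|x| + 1) ^+ 2)).
have K1 : 0 < K + 1 by rewrite ltr_wpDl.
have t0 : 0 < t by rewrite lt_min !divr_gt0 ?lt_min ?e0 // mulr_gt0 // exprn_gt0.
have txm : `|t *: x| < Num.min e d.
  rewrite normrZ (gtr0_norm t0).
  apply: (@lt_le_trans _ _ (t * (`|x| + 1))); first by rewrite ltr_pM2l // ltrDl.
  by rewrite -ler_pdivlMr // ge_min lexx.
move: txm; rewrite lt_min => /andP[/he H1 /[dup] txd].
rewrite -[X in `|X| < d]subr0 => /hd; rewrite g0 !subr0 => H2.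
move: H1; rewrite (hpoly_hom _ _ hp) expr1 normrZ exprMn (gtr0_norm t0) => H1.
have H3 : t * `|p x| <= K * (t ^+ 2 * `|x| ^+ 2) + c / 2 / (`|x| + 1) * (t * `|x|).
  rewrite -{1}(gtr0_norm t0) -normrM -[t * p x](subrK (g (t *: x))); rewrite distrC in H1.
  move: H2; rewrite normrZ (gtr0_norm t0) => H2.
  by apply: (le_trans (ler_normD _ _)); apply: lerD.
have H4 : `|p x| <= K * (t * `|x| ^+ 2) + c / 2 / (`|x| + 1) * `|x|.
  rewrite -(ler_pM2l t0); apply: (le_trans H3); rewrite le_eqVlt; apply/orP; left.
  by apply/eqP; ring.
apply: (le_trans H4); rewrite [leRHS](_ : c = c / 2 + c / 2); last by lra.
have nx := normr_ge0 x.
apply: lerD.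
  have tb : t <= c / 2 / ((K + 1) * (`|x| + 1) ^+ 2) by rewrite ge_min lexx orbT.
  apply: (@le_trans _ _ ((K + 1) * (t * (`|x| + 1) ^+ 2))).
    rewrite ler_pM ?mulr_ge0 ?exprn_ge0 ?(ltW t0) ?lerDl // ler_wpM2l ?(ltW t0) //.
    by rewrite lerXn2r ?nnegrE ?addr_ge0 // lerDl.
  by rewrite mulrCA -ler_pdivlMr // mulr_gt0 // exprn_gt0.
rewrite -mulrA ler_piMr ?divr_ge0 ?(ltW c0) //.
by rewrite mulrC ler_pdivrMr // mul1r lerDl.
Qed.

Lemma cbigO_zero_derivative n (A : set 'rV[R]_n) (f : 'rV[R]_n -> C) :
  metric_open A -> A 0 -> cCk 2 A f -> f 0 = 0 -> frechet_diff (fun x => Re (f x)) 0 (fun=> 0) ->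
  frechet_diff (fun x => Im (f x)) 0 (fun=> 0) -> cbigO 2 f.
Proof.
move=> oA A0 [h1 h2] f0 d1 d2; apply: bigO_cbigO.
  by apply: (zero_derivative_order oA A0 (Ck_Dk h1)) => //; rewrite f0.
by apply: (zero_derivative_order oA A0 (Ck_Dk h2)) => //; rewrite f0.
Qed.

(** The solution is [- sum_i m^(-i-1) h o F^i].  Its real and imaginary parts are
    combinations of four real sums along orbits, to which the smoothness result
    applies. *)
Lemma cohomological_solution n k d (N : 'rV[R]_n -> R) A F (h : 'rV[R]_n -> C) (q : R) (m : C) :
  eqnorm N -> metric_open A -> A 0 -> 0 <= q < 1 -> q ^+ d < cmod m -> contraction_Ck k q N A F ->
  (d <= k)%N -> cCk k A h -> cbigO d h ->
  exists2 e : R, 0 < e & (forall x, N x < e -> A x) /\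
    exists w, [/\ cCk k [set x | N x < e] w, cbigO d w &
      forall x, N x < e -> N (F x) < e /\ w (F x) = m * w x + h x].
Proof.
move=> hN oA A0 hq qm hF dk [h1 h2] ho.
have q0 : 0 <= q by case/andP: hq.
have cm0 : 0 < cmod m by apply: le_lt_trans qm; exact: exprn_ge0.
have m0 : m != 0 by rewrite -cmod_gt0.
pose l := (cmod m)^-1; have l0 : 0 <= l by rewrite invr_ge0 ltW.
have lq : l * q ^+ d < 1 by rewrite mulrC ltr_pdivrMr // mul1r.
have ht : 0 <= l * q ^+ d < 1 by rewrite lq mulr_ge0 // exprn_ge0.
pose c i : C := - m^-1 ^+ i.+1.
have hc i : cmod (c i) <= l * l ^+ i by rewrite cmodN cmodX cmodV exprS.
have hcr i : `|Re (c i)| <= l * l ^+ i by apply: (le_trans (le_Re _)).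
have hci i : `|Im (c i)| <= l * l ^+ i by apply: (le_trans (le_Im _)).
have [e0 e00 he0] := contraction_Ck_contr hF.
have claim (a : nat -> R) (g : 'rV[R]_n -> R) : (forall i, `|a i| <= l * l ^+ i) ->
    Ck k A g -> bigO d g -> exists2 e : R, 0 < e &
    [/\ Ck k [set x | N x < e] (orbit_sum a F g), bigO d (orbit_sum a F g) &
      forall x, N x < e -> A x /\ cvgn (series (fun i => a i * g (iter i F x)))].
  move=> ha hg og; have hK := Ck_order_Ck oA A0 dk hg og.
  have [e1 e10 [_ H1]] := orbit_sum_Ck hN oA A0 hq l0 lq ha hF hK.
  have H2 := orbit_sum_order hN oA A0 hq l0 lq ha (contraction_Ck_contr hF) og.
  have [e2 e20 [K K0 H3]] := orbit_bound hN oA A0 hq l0 ha (contraction_Ck_contr hF) og.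
  exists (Num.min e1 e2); first by rewrite lt_min e10.
  split=> //; first by apply: Ck_sub H1 => x /=; rewrite lt_min => /andP[].
  move=> x; rewrite lt_min => /andP[_ xe]; split; first by have [] := H3 x 0%N xe.
  by apply: (geo_series_cvg ht (K := K)) => i; have [] := H3 x i xe.
have [e1 e10 [T1 O1 C1]] := claim _ _ hcr h1 (cbigO_Re ho).
have [e2 e20 [T2 O2 C2]] := claim _ _ hcr h2 (cbigO_Im ho).
have [e3 e30 [T3 O3 C3]] := claim _ _ hci h1 (cbigO_Re ho).
have [e4 e40 [T4 O4 C4]] := claim _ _ hci h2 (cbigO_Im ho).
pose e := Num.min e0 (Num.min (Num.min e1 e2) (Num.min e3 e4)).
have heE x : N x < e -> [/\ N x < e0, N x < e1, N x < e2, N x < e3 & N x < e4].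
  by rewrite !lt_min => /andP[-> /andP[/andP[-> ->] /andP[-> ->]]].
exists e; first by rewrite !lt_min e00 e10 e20 e30.
split; first by move=> x /heE[_ /C1[]].
pose a i := Re (c i); pose b i := Im (c i).
set hr := fun x => Re (h x) in T1 O1 C1 T3 O3 C3.
set hi := fun x => Im (h x) in T2 O2 C2 T4 O4 C4.
pose w x : C := Complex (orbit_sum a F hr x - orbit_sum b F hi x)
                        (orbit_sum a F hi x + orbit_sum b F hr x).
exists w; split.
- split; [apply: Ck_subr|apply: Ck_add].
  + by apply: Ck_sub T1 => x /= /heE[].
  + by apply: Ck_sub T4 => x /= /heE[].
  + by apply: Ck_sub T2 => x /= /heE[].
  + by apply: Ck_sub T3 => x /= /heE[].
- apply: bigO_cbigO => /=; last exact: bigOD.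
  have O4' : bigO d (fun x => - orbit_sum b F hi x).
    by apply: (bigO_bound (@metric_openT _ _) I _ O4) => x _; rewrite normrN.
  exact: (bigOD O1 O4').
move=> x xe; have Fe : N (F x) < e.
  have [/he0 H _ _ _ _] := heE x xe; apply: le_lt_trans H _.
  apply: le_lt_trans xe; apply: ler_piMl; first exact: eqnorm_ge0.
  by case/andP: hq => _ /ltW.
split=> //; have [x0 x1 x2 x3 x4] := heE x xe; have [y0 y1 y2 y3 y4] := heE _ Fe.
have cS i : c i.+1 = m^-1 * c i by rewrite /c [in LHS]exprS mulrN.
have aS i : a i.+1 = Re m^-1 * a i + (- Im m^-1) * b i.
  by rewrite mulNr; apply: (etrans (congr1 (@complex.Re R) (cS i))); apply: (etrans (ReM _ _)).
have bS i : b i.+1 = Re m^-1 * b i + Im m^-1 * a i by apply: (etrans (congr1 (@complex.Im R) (cS i))); exact: ImM.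
have E1 := orbit_sum_shift (h := hr) aS (C1 x x1).2 (C1 _ y1).2 (C3 _ y3).2.
have E2 := orbit_sum_shift (h := hi) aS (C2 x x2).2 (C2 _ y2).2 (C4 _ y4).2.
have E3 := orbit_sum_shift (h := hr) bS (C3 x x3).2 (C3 _ y3).2 (C1 _ y1).2.
have E4 := orbit_sum_shift (h := hi) bS (C4 x x4).2 (C4 _ y4).2 (C2 _ y2).2.
have key : w x = - m^-1 * h x + m^-1 * w (F x).
  have a0 : a 0%N = - Re m^-1 by rewrite /a /c expr1 ReN.
  have b0 : b 0%N = - Im m^-1 by rewrite /b /c expr1 ImN.
  apply: complex_eq; rewrite !(ReD, ImD, ReM, ImM, ReN, ImN) /w /=.
    rewrite E1 E4 a0 b0 /hr /hi; ring.
  rewrite E2 E3 a0 b0 /hr /hi; ring.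
rewrite key mulrDr !mulrA mulrN mulfV // mulN1r mul1r addrAC addNr add0r.
by [].
Qed.

(** * Polynomial approximation of the conjugacy *)

Definition mtuple n (f : 'I_n -> nat) : mpoly.multinom n := mpoly.Multinom (mktuple f).

Lemma mtupleE n (f : 'I_n -> nat) i : mtuple f i = f i.
Proof. exact: mpoly.mnmE. Qed.

Lemma meval_agree n (p : mpoly.mpoly n C) (f g : 'I_n -> C) :
  (forall m k, m \in mpoly.msupp p -> m k != 0%N -> f k = g k) ->
  mpoly.meval f p = mpoly.meval g p.
Proof.
move=> h; rewrite !mpoly.mevalE; apply: eq_big_seq => m hm; congr (_ * _).
apply: eq_bigr => k _; have [->//|/(h m k hm)-> //] := eqVneq (m k) 0%N.
Qed.

Lemma linear_part_order n (V : 'M[C]_n) A (F L : 'rV[R]_n -> 'rV[R]_n) (mu : C) k :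
  metric_open A -> A 0 -> F 0 = 0 -> Ck 2 A F -> frechet_diff F 0 L ->
  (forall x, ecoord V (L x) 0 k = mu * ecoord V x 0 k) ->
  cbigO 2 (fun x => ecoord V (F x) 0 k - mu * ecoord V x 0 k).
Proof.
move=> oA A0 F0 hF hL hmu.
have hs (g : 'rV[R]_n -> R) : bounded_linear g ->
    frechet_diff (fun x => g (F x) + - g (L x)) 0 (fun=> 0).
  move=> hg; have h1 := frechet_diff_linl hg hL.
  have h2 : frechet_diff (fun x => - g (L x)) 0 (fun v => - g (L v)).
    apply/strict_diff_frechet_diff/bounded_linear_strict_diff; have := bounded_linear_scale (-1) (bounded_linear_comp hg hL.1).
    by congr bounded_linear; apply/funext => v; rewrite /= scaleN1r.
  by apply: frechet_diff_ext (frechet_diff_add h1 h2) _ => v; rewrite subrr.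
apply: (cbigO_zero_derivative oA A0).
- apply: cCk_subr; first exact: cCk_ecoord.
  by apply: cCk_scale; apply: cCk_ecoord; apply/Ck_lin/bounded_linear_id.
- by rewrite F0 !ecoord0 mxE mulr0 subr0.
- have := hs _ (bounded_linear_ecoord_Re V k); congr frechet_diff; apply/funext => x.
  by rewrite hmu ReD ReN.
- have := hs _ (bounded_linear_ecoord_Im V k); congr frechet_diff; apply/funext => x.
  by rewrite hmu ImD ImN.
Qed.

Definition restr n nu (le_nu : (nu <= n)%N) (m : mpoly.multinom n) : mpoly.multinom nu :=
  mtuple (fun k => m (widen_ord le_nu k)).

Lemma prod_restr n nu (le_nu : (nu <= n)%N) (m : mpoly.multinom n) (w : 'I_n -> C) :
  (forall k : 'I_n, (nu <= k)%N -> m k = 0%N) ->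
  \prod_k w k ^+ m k = \prod_k w (widen_ord le_nu k) ^+ restr le_nu m k.
Proof.
move=> m0; rewrite (bigID (fun k : 'I_n => (k < nu)%N)) /= [X in _ * X]big1 ?mulr1; last first.
  by move=> k; rewrite -leqNgt => /m0 ->; rewrite expr0.
by rewrite (big_ord_narrow le_nu); apply: eq_bigr => k _; rewrite mtupleE.
Qed.

Lemma mdeg_restr n nu (le_nu : (nu <= n)%N) (m : mpoly.multinom n) :
  (forall k : 'I_n, (nu <= k)%N -> m k = 0%N) -> mpoly.mdeg (restr le_nu m) = mpoly.mdeg m.
Proof.
move=> m0; rewrite !mpoly.mdegE [RHS](bigID (fun k : 'I_n => (k < nu)%N)) /=.
rewrite [X in (_ + X)%N]big1 ?addn0; last by move=> k; rewrite -leqNgt => /m0 ->.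
by rewrite (big_ord_narrow le_nu); apply: eq_bigr => k _; rewrite mtupleE.
Qed.

Lemma cbigO_prod_restr n nu (le_nu : (nu <= n)%N) (V : 'M[C]_n) (u : 'I_nu -> 'rV[R]_n -> C)
   (m : mpoly.multinom n) :
  (forall k, cbigO 2 (fun x => u k x - ecoord V x 0 (widen_ord le_nu k))) ->
  (forall k : 'I_n, (nu <= k)%N -> m k = 0%N) ->
  cbigO (mpoly.mdeg m).+1
    (fun x => \prod_k ecoord V x 0 k ^+ m k - \prod_k u k x ^+ restr le_nu m k).
Proof.
move=> u2 m0; pose Y x k := ecoord V x 0 (widen_ord le_nu k).
have Y1 k : cbigO 1 (fun x => Y x k) by exact: cbigO_ecoord.
have u1 k : cbigO 1 (u k).
  have := cbigOD (cbigO_le (leqnSn 1) (u2 k)) (Y1 k).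
  by apply: cbigO_ext => x; rewrite subrK.
have Yu k : cbigO 2 (fun x => Y x k - u k x).
  by have := cbigON (u2 k); apply: cbigO_ext => x; rewrite opprB.
have := cbigO_prod_sub (w := fun x k => u k x) (restr le_nu m) Y1 u1 Yu.
rewrite -mpoly.mdegE mdeg_restr // addn1; apply: cbigO_ext => x.
by rewrite (prod_restr le_nu (ecoord V x 0)).
Qed.

Lemma cbigO_prod_linear n (V : 'M[C]_n) A (F L : 'rV[R]_n -> 'rV[R]_n) (mu : 'I_n -> C)
   (m : mpoly.multinom n) :
  metric_open A -> A 0 -> F 0 = 0 -> Ck 2 A F -> frechet_diff F 0 L ->
  (forall x k, ecoord V (L x) 0 k = mu k * ecoord V x 0 k) ->
  cbigO (mpoly.mdeg m).+1 (fun x => \prod_k ecoord V (F x) 0 k ^+ m k -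
     (\prod_k mu k ^+ m k) * \prod_k ecoord V x 0 k ^+ m k).
Proof.
move=> oA A0 F0 hF hL hmu.
have Y1 k : cbigO 1 (fun x => ecoord V x 0 k) by exact: cbigO_ecoord.
have YF1 k : cbigO 1 (fun x => ecoord V (F x) 0 k) by exact: (cbigO_comp hL F0 (Y1 k)).
have muY k : cbigO 1 (fun x => mu k * ecoord V x 0 k) by apply: cbigO_scale.
have lin k : cbigO 2 (fun x => ecoord V (F x) 0 k - mu k * ecoord V x 0 k).
  by apply: (linear_part_order oA A0 F0 hF hL).
have := cbigO_prod_sub m YF1 muY lin; rewrite -mpoly.mdegE addn1.
apply: cbigO_ext => x; congr (_ - _); rewrite -big_split.
by apply: eq_bigr => k _; rewrite exprMn.
Qed.

(** Degree by degree, the leading part of the defect is removed: nonresonant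
    monomials are absorbed in the change of coordinates, resonant ones are put
    into the conjugate dynamics.  Replacing there [y] by [u] only changes terms of
    higher degree. *)
Lemma approximate_conjugacy n nu (le_nu : (nu <= n)%N) r sigma (V : 'M[C]_n) A
   (F L : 'rV[R]_n -> 'rV[R]_n) (mu : 'I_n -> C) (j : 'I_n) (u : 'I_nu -> 'rV[R]_n -> C) :
  V \in unitmx -> metric_open A -> A 0 -> F 0 = 0 -> Ck r A F -> (2 <= sigma <= r)%N -> frechet_diff F 0 L ->
  (forall x k, ecoord V (L x) 0 k = mu k * ecoord V x 0 k) ->
  (forall k, cCk r A (u k)) ->
  (forall k, cbigO 2 (fun x => u k x - ecoord V x 0 (widen_ord le_nu k))) ->
  (forall m : mpoly.multinom n, (2 <= mpoly.mdeg m < sigma)%N ->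
     \prod_k mu k ^+ m k = mu j -> forall k : 'I_n, (nu <= k)%N -> m k = 0%N) ->
  exists (a : mpoly.mpoly n C) (s : mpoly.mpoly nu C),
    [/\ cbigO 2 (fun x => mpoly.meval (ecoord V x 0) a - ecoord V x 0 j),
        supp_in (fun m => (2 <= mpoly.mdeg m < sigma)%N /\
                          \prod_k mu (widen_ord le_nu k) ^+ m k = mu j) s &
        cbigO sigma (fun x => mpoly.meval (ecoord V (F x) 0) a
          - mu j * mpoly.meval (ecoord V x 0) a - mpoly.meval (u^~ x) s)].
Proof.
move=> uV oA A0 F0 hF /andP[s2 sr] hL hmu hu u2 hres.
pose Y x := ecoord V x 0 : 'I_n -> C.
pose Err (a : mpoly.mpoly n C) (s : mpoly.mpoly nu C) x :=
  mpoly.meval (Y (F x)) a - mu j * mpoly.meval (Y x) a - mpoly.meval (u^~ x) s.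
have r2 : (2 <= r)%N := leq_trans s2 sr.
have Y1 k : cbigO 1 (fun x => Y x k) by exact: cbigO_ecoord.
have lin k : cbigO 2 (fun x => Y (F x) k - mu k * Y x k).
  by apply: (linear_part_order oA A0 F0 (Ck_le r2 hF) hL).
have TErr a s : cCk r A (Err a s).
  apply: cCk_subr; last by apply: cCk_meval.
  apply: cCk_subr; first by apply: cCk_meval => i; exact: cCk_ecoord.
  by apply: cCk_scale; apply: cCk_meval => i; apply: cCk_ecoord; apply/Ck_lin/bounded_linear_id.
suff H d : (d.+2 <= sigma)%N -> exists (a : mpoly.mpoly n C) (s : mpoly.mpoly nu C),
    [/\ cbigO 2 (fun x => mpoly.meval (Y x) a - Y x j),
        supp_in (fun m => (2 <= mpoly.mdeg m < sigma)%N /\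
                          \prod_k mu (widen_ord le_nu k) ^+ m k = mu j) s &
        cbigO d.+2 (Err a s)].
  have e : (sigma - 2).+2 = sigma by rewrite -addn2 subnK.
  by have := H (sigma - 2)%N; rewrite e => /(_ (leqnn _))[a [s h]]; exists a, s.
elim: d => [|d ih] ds.
  exists (mpoly.mpolyX C (mpoly.mnm1 j)), 0; split.
  - apply: cbigO_ext (cbigO_zero _ 2) => x; by rewrite mpoly.mevalXU subrr.
  - by move=> m; rewrite mpoly.msupp0.
  - by apply: cbigO_ext (lin j) => x; rewrite /Err !mpoly.mevalXU mpoly.meval0 subr0.
have [a [s [ha hs he]]] := ih (ltnW ds).
have hT : cDk d.+3 A (Err a s).
  by have [t1 t2] := TErr a s; split; apply: Ck_Dk; apply: (Ck_le (leq_trans ds sr)).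
have [p hp he2] := leading_homp uV oA A0 hT he.
pose lam (m : mpoly.multinom n) := \prod_k mu k ^+ m k.
pose cf m := mpoly.mcoeff m p.
(* The correction of a nonresonant coefficient divides by the nonzero [lam m - mu j]. *)
pose b m := - (cf m / (lam m - mu j)).
pose rs := restr le_nu.
have mdg m : m \in mpoly.msupp p -> (2 <= mpoly.mdeg m < sigma)%N by move=> /hp ->.
have m0 m : m \in mpoly.msupp p -> lam m = mu j -> forall k : 'I_n, (nu <= k)%N -> m k = 0%N.
  by move=> hm lm; apply: hres => //; exact: mdg.
exists (a + \sum_(m <- mpoly.msupp p | lam m != mu j) b m *: mpoly.mpolyX C m).
exists (s + \sum_(m <- mpoly.msupp p | lam m == mu j) cf m *: mpoly.mpolyX C (rs m)).
have mono k (G : 'I_k -> C) (I : seq (mpoly.multinom n)) (Q : pred _) (c : _ -> C) (f : _ -> mpoly.multinom k) :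
   mpoly.meval G (\sum_(m <- I | Q m) c m *: mpoly.mpolyX C (f m)) =
   \sum_(m <- I | Q m) c m * \prod_i G i ^+ f m i.
  rewrite (raddf_sum (mpoly.meval _)); apply: eq_bigr => m _.
  by rewrite /= mpoly.mevalZ mpoly.mevalX.
have Yd m : m \in mpoly.msupp p -> cbigO d.+2 (fun x => \prod_k Y x k ^+ m k).
  by move=> hm; have := cbigO_prod m (index_enum 'I_n) Y1; rewrite -mpoly.mdegE (hp m hm).
split.
- have o2 : cbigO 2 (fun x => \sum_(m <- mpoly.msupp p | lam m != mu j) b m * \prod_k Y x k ^+ m k).
    under [fun x => _]funext => x do rewrite big_seq_cond.
    apply: cbigO_sum => m /andP[hm _]; apply: cbigO_scale.
    exact: (cbigO_le _ (Yd m hm)).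
  apply: cbigO_ext (cbigOD ha o2) => x; by rewrite mpoly.mevalD mono addrAC.
- apply: supp_add => //; apply: supp_sum => m hm /eqP lm; apply: supp_scale; apply: supp_X.
  have hm0 := m0 m hm lm; split; first by rewrite mdeg_restr ?mdg.
  by rewrite -lm; exact: esym (prod_restr le_nu mu hm0).
have o1 : cbigO d.+3 (fun x => \sum_(m <- mpoly.msupp p | lam m != mu j)
    b m * (\prod_k Y (F x) k ^+ m k - lam m * \prod_k Y x k ^+ m k)).
  under [fun x => _]funext => x do rewrite big_seq_cond.
  apply: cbigO_sum => m /andP[hm _]; apply: cbigO_scale.
  by have := cbigO_prod_linear m oA A0 F0 (Ck_le r2 hF) hL hmu; rewrite (hp m hm).
have o2 : cbigO d.+3 (fun x => \sum_(m <- mpoly.msupp p | lam m == mu j)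
    cf m * (\prod_k Y x k ^+ m k - \prod_k u k x ^+ rs m k)).
  under [fun x => _]funext => x do rewrite big_seq_cond.
  apply: cbigO_sum => m /andP[hm /eqP lm]; apply: cbigO_scale.
  by have := cbigO_prod_restr u2 (m0 m hm lm); rewrite (hp m hm).
apply: cbigO_ext (cbigOD (cbigOD he2 o1) o2) => x.
have alg (z1 z2 z3 z4 z5 z6 z7 z8 l : C) : z1 - l * z2 - z3 - (z4 + z5) +
    (z6 - l * z7 + z5) + (z4 - z8) = z1 + z6 - l * (z2 + z7) - (z3 + z8) by ring.
rewrite /Err !mpoly.mevalD !mono.
have -> : mpoly.meval (ecoord V x 0) p =
   \sum_(m <- mpoly.msupp p | lam m == mu j) cf m * \prod_k Y x k ^+ m k +
   \sum_(m <- mpoly.msupp p | lam m != mu j) cf m * \prod_k Y x k ^+ m k.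
  by rewrite mpoly.mevalE (bigID (fun m => lam m == mu j)).
have -> : \sum_(m <- mpoly.msupp p | lam m != mu j)
     b m * (\prod_k Y (F x) k ^+ m k - lam m * \prod_k Y x k ^+ m k) =
   \sum_(m <- mpoly.msupp p | lam m != mu j) b m * \prod_k Y (F x) k ^+ m k
   - mu j * \sum_(m <- mpoly.msupp p | lam m != mu j) b m * \prod_k Y x k ^+ m k
   + \sum_(m <- mpoly.msupp p | lam m != mu j) cf m * \prod_k Y x k ^+ m k.
  rewrite mulr_sumr -sumrB -big_split; apply: eq_bigr => m lm /=.
  have l0 : lam m - mu j != 0 by rewrite subr_eq0.
  by rewrite /b; move: (lam m) (mu j) (cf m) (\prod_k Y (F x) k ^+ m k) (\prod_k Y x k ^+ m k) l0 => z1 z2 z3 z4 z5 l0; field.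
have -> : \sum_(m <- mpoly.msupp p | lam m == mu j)
     cf m * (\prod_k Y x k ^+ m k - \prod_k u k x ^+ rs m k) =
   \sum_(m <- mpoly.msupp p | lam m == mu j) cf m * \prod_k Y x k ^+ m k -
   \sum_(m <- mpoly.msupp p | lam m == mu j) cf m * \prod_k u k x ^+ rs m k.
  by rewrite -sumrB; apply: eq_bigr => m _; rewrite mulrBr.
exact: alg.
Qed.

(** * Triangular normal form *)

Lemma contraction_Ck_sub k q (V : normedModType R) (N : V -> R) (A B : set V) (F : V -> V) :
  (forall x, A x -> B x) -> contraction_Ck k q N B F -> contraction_Ck k q N A F.
Proof.
elim: k V N A B F => [|k ih] V N A B F AB [h1 h2]; split=> //.
  by move=> x /AB/h2.
case: h2 => F1 h2 h3; exists F1 => [x /AB/h2 //|].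
by apply: ih h3 => p; apply: AB.
Qed.

(** Both the coefficients and the variables are conjugated, the latter by
    exchanging the members of conjugate pairs. *)
Definition conj_poly n (tau : 'I_n -> 'I_n) (p : mpoly.mpoly n C) : mpoly.mpoly n C :=
  \sum_(m <- mpoly.msupp p)
     conjc (mpoly.mcoeff m p) *: mpoly.mpolyX C (mtuple (fun k => m (tau k))).

Lemma meval_conj_poly n (tau : 'I_n -> 'I_n) (p : mpoly.mpoly n C) (f : 'I_n -> C) :
  involutive tau -> (forall k, f (tau k) = conjc (f k)) ->
  mpoly.meval f (conj_poly tau p) = conjc (mpoly.meval f p).
Proof.
move=> tau2 hf; rewrite [in RHS]mpoly.mevalE (raddf_sum (mpoly.meval f)) (raddf_sum (@conjc R)).
apply: eq_bigr => m _ /=; rewrite mpoly.mevalZ mpoly.mevalX rmorphM; congr (_ * _).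
rewrite rmorph_prod [RHS](reindex_inj (inv_inj tau2)).
by apply: eq_bigr => k _; rewrite mtupleE rmorphXn /= -hf tau2.
Qed.

Lemma supp_conj_poly n (tau : 'I_n -> 'I_n) (P Q : mpoly.multinom n -> Prop) p :
  (forall m, P m -> Q (mtuple (fun k => m (tau k)))) -> supp_in P p ->
  supp_in Q (conj_poly tau p).
Proof.
by move=> PQ hp; apply: supp_sum => m /hp Pm _; apply: supp_scale; apply: supp_X; exact: PQ.
Qed.

Section NormalForm.
Context (n nu : nat) (le_nu : (nu <= n)%N) (r sigma : nat) (V : 'M[C]_n)
  (A : set 'rV[R]_n) (F L : 'rV[R]_n -> 'rV[R]_n) (mu : 'I_n -> C)
  (N : 'rV[R]_n -> R) (q : R) (tau : 'I_nu -> 'I_nu).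
Local Notation iota := (widen_ord le_nu).
Local Notation y j := (fun x => ecoord V x 0 (iota j)).
Context (uV : V \in unitmx) (oA : metric_open A) (A0 : A 0) (F0 : F 0 = 0) (hF : Ck r A F)
  (hs : (2 <= sigma <= r)%N) (hL : frechet_diff F 0 L)
  (hmu : forall x k, ecoord V (L x) 0 k = mu k * ecoord V x 0 k)
  (hN : eqnorm N) (hq : 0 <= q < 1) (hFC : contraction_Ck r q N A F)
  (hgap : forall j : 'I_nu, q ^+ sigma < cmod (mu (iota j)))
  (hres : forall (j : 'I_nu) (m : mpoly.multinom n), (2 <= mpoly.mdeg m < sigma)%N ->
     \prod_k mu k ^+ m k = mu (iota j) -> forall k : 'I_n, (nu <= k)%N -> m k = 0%N)
  (mu1 : forall k, cmod (mu k) < 1)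
  (tau_pair : conj_pairing (fun k => mu (iota k)) tau)
  (tau_y : forall k x, ecoord V x 0 (iota (tau k)) = conjc (ecoord V x 0 (iota k))).

Definition resonant j (m : mpoly.multinom nu) :=
  (2 <= mpoly.mdeg m < sigma)%N /\ \prod_k mu (iota k) ^+ m k = mu (iota j).

Lemma solve_component (j : 'I_nu) (u : 'I_nu -> 'rV[R]_n -> C) (e0 : R) :
  0 < e0 -> (forall x, N x < e0 -> A x) ->
  (forall k, cCk r [set x | N x < e0] (u k)) ->
  (forall k, cbigO 2 (fun x => u k x - y k x)) ->
  exists (e : R) (w : 'rV[R]_n -> C) (s : mpoly.mpoly nu C),
    [/\ 0 < e <= e0, cCk r [set x | N x < e] w, cbigO 2 (fun x => w x - y j x),
      supp_in (resonant j) s &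
      forall x, N x < e -> w (F x) = mu (iota j) * w x + mpoly.meval (u^~ x) s].
Proof.
move=> e00 eA hu u2; case/andP: (hs) => s2 sr.
pose D := [set x | N x < e0]; have oD : metric_open D by apply: metric_open_eqnorm.
have D0 : D 0 by rewrite /D /= (eqnorm0 hN).
have hFD : Ck r D F by apply: Ck_sub hF.
have [a [s [ha hsupp he]]] :=
  approximate_conjugacy uV oD D0 F0 hFD hs hL hmu hu u2 (hres (j := j)).
have TY (f : 'rV[R]_n -> 'rV[R]_n) : Ck r D f -> cCk r D (fun x => mpoly.meval (ecoord V (f x) 0) a).
  by move=> hf; apply: cCk_meval => i; exact: cCk_ecoord.
have Tid : Ck r D (fun x : 'rV[R]_n => x) by apply/Ck_lin/bounded_linear_id.
have hT : cCk r D (fun x => - (mpoly.meval (ecoord V (F x) 0) a -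
    mu (iota j) * mpoly.meval (ecoord V x 0) a - mpoly.meval (u^~ x) s)).
  apply: cCk_opp; apply: cCk_subr; last by apply: cCk_meval.
  by apply: cCk_subr; [exact: TY|apply: cCk_scale; exact: TY].
have [e e_gt0 [eD [w [Tw ow hw]]]] :=
  cohomological_solution hN oD D0 hq (hgap j) (contraction_Ck_sub eA hFC) sr hT (cbigON he).
exists (Num.min e e0), (fun x => mpoly.meval (ecoord V x 0) a + w x), s.
have ee x : N x < Num.min e e0 -> N x < e by rewrite lt_min => /andP[].
split=> //.
- by rewrite lt_min e_gt0 e00 ge_min lexx orbT.
- apply: cCk_add; last by apply: cCk_sub Tw.
  by apply: cCk_sub (TY _ Tid) => x /= /ee /eD.
- apply: cbigO_ext (cbigOD ha (cbigO_le s2 ow)) => x; by rewrite addrAC.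
- move=> x /ee /hw[_ ->].
  have alg (z1 z2 z3 z4 l : C) : z1 + (l * z2 - (z1 - l * z3 - z4)) = l * (z3 + z2) + z4 by ring.
  exact: alg.
Qed.

(** Counts the components on which the equation of component [j] may depend. *)
Definition modulus_rank (j : 'I_nu) := #|[pred k | cmod (mu (iota j)) < cmod (mu (iota k))]|.

(** A product of at least two numbers of modulus less than 1 has smaller modulus
    than each of them. *)
Lemma resonant_modulus j m k : resonant j m -> m k != 0%N ->
  cmod (mu (iota j)) < cmod (mu (iota k)).
Proof.
move=> [/andP[m2 _] hm] mk.
have q0 : 0 <= q by case/andP: hq.
have mu0 i : 0 < cmod (mu (iota i)) by apply: le_lt_trans (hgap i); exact: exprn_ge0.
have mn i : cmod (mu (iota i)) ^+ m i <= 1 by rewrite exprn_ile1 ?cmod_ge0 // ltW.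
have bp (P : pred 'I_nu) : \prod_(i | P i) cmod (mu (iota i) ^+ m i) <= 1.
  suff /andP[] : 0 <= \prod_(i | P i) cmod (mu (iota i) ^+ m i) <= 1 by [].
  elim/big_rec: _ => [|i z _ /andP[z0 z1]]; first by rewrite ler01 lexx.
  by rewrite cmodX mulr_ge0 ?mulr_ile1 ?mn // ?exprn_ge0 ?cmod_ge0.
rewrite -hm cmod_prod (bigD1 k) //= cmodX.
have [k2|k1] := leqP 2 (m k).
  apply: (@le_lt_trans _ _ (cmod (mu (iota k)) ^+ m k)).
    by rewrite ler_piMr // ?exprn_ge0 ?cmod_ge0.
  by rewrite -[ltRHS]expr1 ltr_iXn2l.
have mk1 : m k = 1%N by apply/eqP; rewrite eqn_leq -ltnS k1 lt0n.
have [i ik mi] : exists2 i, i != k & m i != 0%N.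
  apply: contrapT => h; move: m2; rewrite mpoly.mdegE (bigD1 k) //= big1 ?addn0 ?mk1 //.
  by move=> i ik; apply: contrapT => /eqP mi; apply: h; exists i.
rewrite mk1 expr1 gtr_pMr // (bigD1 i) //= cmodX.
apply: (@le_lt_trans _ _ (cmod (mu (iota i)) ^+ m i)).
  by rewrite ler_piMr ?exprn_ge0 ?cmod_ge0.
by rewrite exprn_ilt1 ?cmod_ge0.
Qed.

Lemma modulus_rank_lt j k : cmod (mu (iota j)) < cmod (mu (iota k)) ->
  (modulus_rank k < modulus_rank j)%N.
Proof.
move=> jk; apply: proper_card; apply/properP; split.
  by apply/fintype.subsetP => i; rewrite !inE; exact: lt_trans.
by exists k; rewrite !inE // ltxx.
Qed.

Lemma modulus_rank_tau j : modulus_rank (tau j) = modulus_rank j.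
Proof.
by case: tau_pair => _ ht _; apply: eq_card => k; rewrite !inE ht cmod_conj.
Qed.

(** Induction on the rank [c] of the modulus: the equation for a component of
    rank [c] involves only components of smaller rank, which are already
    solved.  Averaging the solution for [j] with the conjugate of the one for
    [tau j] keeps the equation and makes the family symmetric. *)
Lemma triangular_normal_form c : exists (e : R) (u : 'I_nu -> 'rV[R]_n -> C)
    (s : 'I_nu -> mpoly.mpoly nu C),
  [/\ 0 < e /\ forall x, N x < e -> A x /\ N (F x) <= q * N x,
    forall j, cCk r [set x | N x < e] (u j) /\ cbigO 2 (fun x => u j x - y j x),
    forall j x, u (tau j) x = conjc (u j x),
    forall j, supp_in (resonant j) (s j) /\
      forall f, (forall k, f (tau k) = conjc (f k)) ->
        mpoly.meval f (s (tau j)) = conjc (mpoly.meval f (s j)) &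
    forall j x, (modulus_rank j < c)%N -> N x < e ->
      u j (F x) = mu (iota j) * u j x + mpoly.meval (u^~ x) (s j)].
Proof.
case: (tau_pair) => tau2 htau _.
elim: c => [|c [e [u [s [[e0 eA] hu usym hsup ueq]]]]].
  have [e1 e10 h1] := contraction_Ck_contr hFC; have [e2 e20 h2] := oA A0.
  have [_ _ _ [b b0 hb]] := hN.
  exists (Num.min e1 (e2 / b)), (fun j => y j), (fun=> 0); split=> //.
  - split=> [|x]; first by rewrite lt_min e10 divr_gt0.
    rewrite lt_min => /andP[x1 x2]; split; last exact: h1.
    apply: h2; rewrite subr0; apply: le_lt_trans (hb x) _.
    by rewrite mulrC -ltr_pdivlMr.
  - move=> j; split; first by apply: cCk_ecoord; apply/Ck_lin/bounded_linear_id.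
    by apply: cbigO_ext (cbigO_zero _ 2) => x; rewrite subrr.
  - move=> j; split=> [m|f _]; first by rewrite mpoly.msupp0.
    by rewrite mpoly.meval0 conjc0.
have /boolp.choice[p hp] (j : 'I_nu) : exists p : R * ('rV[R]_n -> C) * mpoly.mpoly nu C,
    [/\ 0 < p.1.1 <= e, cCk r [set x | N x < p.1.1] p.1.2,
      cbigO 2 (fun x => p.1.2 x - y j x), supp_in (resonant j) p.2 &
      forall x, N x < p.1.1 ->
        p.1.2 (F x) = mu (iota j) * p.1.2 x + mpoly.meval (u^~ x) p.2].
  have [e' [w [t ht]]] := solve_component j e0 (fun x xe => (eA x xe).1)
     (fun k => (hu k).1) (fun k => (hu k).2).
  by exists (e', w, t).
pose e' := \big[Num.min/e]_j (p j).1.1.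
have e'0 : 0 < e'.
  by rewrite /e'; elim/big_ind: _ => // [a b a0 b0|j _]; [rewrite lt_min a0|have [/andP[]] := hp j].
have e'e : e' <= e by rewrite /e'; elim/big_rec: _ => // j a _ ae; rewrite ge_min ae orbT.
have e'p j : e' <= (p j).1.1 by exact: bigmin_le_cond.
pose half : C := 2^-1.
have half2 : half + half = 1 by rewrite /half -mulr2n -[_ *+ 2]mulr_natr mulVf // pnatr_eq0.
have halfc : conjc half = half.
  by rewrite /half (_ : (2^-1 : C) = real_complex R 2^-1) ?conjc_real // fmorphV rmorph_nat.
clearbody half.
pose u' j x := if modulus_rank j == c then half * ((p j).1.2 x + conjc ((p (tau j)).1.2 x)) else u j x.
pose s' j := if modulus_rank j == c then half *: ((p j).2 + conj_poly tau (p (tau j)).2) else s j.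
have res_tau j m : resonant (tau j) m -> resonant j (mtuple (fun k => m (tau k))).
  move=> [hm1 hm2]; split.
    move: hm1; rewrite !mpoly.mdegE [X in (_ <= X < _)%N -> _](reindex_inj (inv_inj tau2)).
    by under [X in _ -> (_ <= X < _)%N]eq_bigr => k _ do rewrite mtupleE.
  have -> : mu (iota j) = conjc (mu (iota (tau j))) by rewrite htau conjcK.
  rewrite -hm2 rmorph_prod [RHS](reindex_inj (inv_inj tau2)).
  apply: eq_bigr => k _; rewrite mtupleE rmorphXn /=.
  by rewrite -htau tau2.
exists e', u', s'; split.
- by split=> // x xe; apply: eA; exact: lt_le_trans xe e'e.
- move=> j; have [_ T1 o1 _ _] := hp j; have [_ T2 o2 _ _] := hp (tau j).
  rewrite /u'; case: eqP => _; last first.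
    split; last exact: (hu j).2.
    by apply: cCk_sub (hu j).1 => x /= xe; exact: lt_le_trans xe e'e.
  split.
    apply: cCk_scale; apply: cCk_add; first by apply: cCk_sub T1 => x /= xe; exact: lt_le_trans xe _.
    by apply: cCk_conj; apply: cCk_sub T2 => x /= xe; exact: lt_le_trans xe _.
  apply: cbigO_ext (cbigO_scale half (cbigOD o1 (cbigO_conj o2))) => x /=.
  rewrite rmorphB /= tau_y conjcK.
  have alg (h a b z : C) : h + h = 1 -> h * (a - z + (b - z)) = h * (a + b) - z.
    by move=> h1; rewrite -[z in RHS]mul1r -h1; ring.
  exact: alg.
- move=> j x; rewrite /u' modulus_rank_tau; case: eqP => _ //.
  by rewrite tau2 rmorphM rmorphD /= halfc conjcK addrC.
- move=> j; rewrite /s' modulus_rank_tau; case: eqP => _; last exact: hsup.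
  have [_ _ _ S1 _] := hp j; have [_ _ _ S2 _] := hp (tau j); split.
    apply: supp_scale; apply: supp_add => //; apply: supp_conj_poly S2 => m; exact: res_tau.
  move=> f hf; rewrite !mpoly.mevalZ !mpoly.mevalD !meval_conj_poly // tau2.
  by rewrite rmorphM rmorphD /= halfc conjcK addrC.
move=> j x jc xe.
have agree (t : mpoly.mpoly nu C) i : (modulus_rank i <= c)%N -> supp_in (resonant i) t ->
    mpoly.meval (u'^~ x) t = mpoly.meval (u^~ x) t.
  move=> ic ht; apply: meval_agree => m k /ht hm mk.
  have := modulus_rank_lt (resonant_modulus hm mk); rewrite /u'.
  by case: eqP => // ->; rewrite ltnNge ic.
rewrite /s'; case: (eqVneq (modulus_rank j) c) => jc'; last first.
  have jlt : (modulus_rank j < c)%N by rewrite ltn_neqAle jc' -ltnS.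
  rewrite (agree _ j) ?(ltnW jlt) //; last exact: (hsup j).1.
  rewrite /u' (negPf jc'); apply: ueq => //; exact: lt_le_trans xe e'e.
have [_ _ _ S1 E1] := hp j; have [_ _ _ S2 E2] := hp (tau j).
rewrite (agree _ j) ?jc' //; last first.
  apply: supp_scale; apply: supp_add => //; apply: supp_conj_poly S2 => m; exact: res_tau.
rewrite /u' jc' eqxx E1 ?E2 ?(lt_le_trans xe) // mpoly.mevalZ mpoly.mevalD.
rewrite meval_conj_poly // rmorphD rmorphM /= htau conjcK.
have alg (h l a b z1 z2 : C) : h * (l * a + z1 + (l * b + z2)) = l * (h * (a + b)) + h * (z1 + z2) by ring.
exact: alg.
Qed.

End NormalForm.

End Conjugacy.

(** * Real polynomial maps from complex coordinates *)

Section RealNormalForm.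
Context (R : realType).
Local Notation C := (R[i]).

Definition deg_le n d := fun m : mpoly.multinom n => (mpoly.mdeg m <= d)%N.

Lemma supp_weaken n (P Q : mpoly.multinom n -> Prop) (p : mpoly.mpoly n C) :
  (forall m, P m -> Q m) -> supp_in P p -> supp_in Q p.
Proof. by move=> PQ h m /h/PQ. Qed.

Lemma supp_mul n d e (p q : mpoly.mpoly n C) :
  supp_in (deg_le d) p -> supp_in (deg_le e) q -> supp_in (deg_le (d + e)) (p * q).
Proof.
move=> h k m /mpoly.msuppM_le/allpairsP[[m1 m2] /= [/h h1 /k h2 ->]].
by rewrite /deg_le mpoly.mdegD leq_add.
Qed.

Lemma supp_msize (K : nzRingType) n d (p : mpoly.mpoly n K) :
  (forall m, m \in mpoly.msupp p -> (mpoly.mdeg m <= d)%N) -> (mpoly.msize p <= d.+1)%N.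
Proof.
by move=> h; rewrite mpoly.msizeE; apply/bigmax_leqP_seq => m hm _; exact: h.
Qed.

(** Complex-valued polynomial functions of a real vector; degrees are kept as
    bounds. *)
Definition cpoly nu d (f : 'rV[R]_nu -> C) := exists2 P : mpoly.mpoly nu C,
  supp_in (deg_le d) P & forall z, f z = mpoly.meval (fun k => real_complex R (z 0 k)) P.

Lemma cpoly_cst nu d c : cpoly d (fun _ : 'rV[R]_nu => c).
Proof.
exists (c *: mpoly.mpolyX C (mpoly.mnm0 : mpoly.multinom nu)) => [|z].
  by apply: supp_scale; apply: supp_X; rewrite /deg_le mpoly.mdeg0.
rewrite mpoly.mevalZ mpoly.mevalX big1 ?mulr1 // => i _.
by rewrite mpoly.mnm0E expr0.
Qed.

Lemma cpoly_add nu d (f g : 'rV[R]_nu -> C) :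
  cpoly d f -> cpoly d g -> cpoly d (fun z => f z + g z).
Proof.
move=> [P hP fP] [Q hQ gQ]; exists (P + Q); first exact: supp_add.
by move=> z; rewrite mpoly.mevalD fP gQ.
Qed.

Lemma cpoly_scale nu d c (f : 'rV[R]_nu -> C) : cpoly d f -> cpoly d (fun z => c * f z).
Proof.
move=> [P hP fP]; exists (c *: P); first exact: supp_scale.
by move=> z; rewrite mpoly.mevalZ fP.
Qed.

Lemma cpoly_mul nu d e (f g : 'rV[R]_nu -> C) :
  cpoly d f -> cpoly e g -> cpoly (d + e) (fun z => f z * g z).
Proof.
move=> [P hP fP] [Q hQ gQ]; exists (P * Q); first exact: supp_mul.
by move=> z; rewrite mevM fP gQ.
Qed.

Lemma cpoly_le nu d e (f : 'rV[R]_nu -> C) : (d <= e)%N -> cpoly d f -> cpoly e f.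
Proof.
move=> de [P hP fP]; exists P => //; apply: supp_weaken hP => m md.
exact: leq_trans md de.
Qed.

Lemma cpoly_sum nu d I (s : seq I) (f : I -> 'rV[R]_nu -> C) :
  (forall i, cpoly d (f i)) -> cpoly d (fun z => \sum_(i <- s) f i z).
Proof.
move=> h; elim: s => [|i s ih].
  by have := @cpoly_cst nu d 0; congr cpoly; apply/funext => z; rewrite big_nil.
by have := cpoly_add (h i) ih; congr cpoly; apply/funext => z; rewrite big_cons.
Qed.

Lemma cpoly_ecoord p nu (T : 'M[C]_(p, nu)) j : cpoly 1 (fun z => ecoord T z 0 j).
Proof.
suff h l : cpoly 1 (fun z : 'rV[R]_nu => T j l * real_complex R (z 0 l)).
  have := cpoly_sum (index_enum 'I_nu) h; congr cpoly; apply/funext => z.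
  by rewrite ecoordE; apply: eq_bigr => l _; rewrite mulrC.
apply: cpoly_scale; exists (mpoly.mpolyX C (mpoly.mnm1 l)) => [|z].
  by apply: supp_X; rewrite /deg_le mpoly.mdeg1.
by rewrite mpoly.mevalXU.
Qed.

Lemma cpoly_monomial nu p (f : 'rV[R]_nu -> 'I_p -> C) (m : 'I_p -> nat) (s : seq 'I_p) :
  (forall k, cpoly 1 (fun z => f z k)) ->
  cpoly (\sum_(k <- s) m k) (fun z => \prod_(k <- s) f z k ^+ m k).
Proof.
move=> h; have hX k e : cpoly e (fun z => f z k ^+ e).
  elim: e => [|e ih]; first by have := @cpoly_cst nu 0 1; congr cpoly; apply/funext => z.
  by have := cpoly_mul (h k) ih; congr cpoly; apply/funext => z; rewrite exprS.
elim: s => [|k s ih].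
  by have := @cpoly_cst nu 0 1; rewrite big_nil; congr cpoly; apply/funext => z; rewrite big_nil.
by have := cpoly_mul (hX k (m k)) ih; rewrite big_cons; congr cpoly; apply/funext => z; rewrite big_cons.
Qed.

Lemma cpoly_meval nu p d (f : 'rV[R]_nu -> 'I_p -> C) (P : mpoly.mpoly p C) :
  (forall k, cpoly 1 (fun z => f z k)) -> supp_in (deg_le d) P ->
  cpoly d (fun z => mpoly.meval (f z) P).
Proof.
move=> h; rewrite /supp_in => hP.
have -> : (fun z => mpoly.meval (f z) P) = (fun z => \sum_(m <- mpoly.msupp P)
    mpoly.mcoeff m P * \prod_(i < p) f z i ^+ m i).
  by apply/funext => z; rewrite mpoly.mevalE.
elim: (mpoly.msupp P) hP => [|m s ih] hP.
  by have := @cpoly_cst nu d 0; congr cpoly; apply/funext => z; rewrite big_nil.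
have h1 := cpoly_scale (mpoly.mcoeff m P) (cpoly_monomial m (index_enum 'I_p) h).
have md : (\sum_(i < p) m i <= d)%N by rewrite -mpoly.mdegE; apply: hP; rewrite mem_head.
have h2 : cpoly d _ := ih (fun m' hm' => hP m' (mem_behead (s := m :: s) hm')).
have := cpoly_add (cpoly_le md h1) h2.
by congr cpoly; apply/funext => z; rewrite big_cons.
Qed.

Lemma cpoly_Re nu d (f : 'rV[R]_nu -> C) : cpoly d f -> exists2 P : mpoly.mpoly nu R,
  (mpoly.msize P <= d.+1)%N & forall z, Re (f z) = mpoly.meval (z 0) P.
Proof.
move=> [Q hQ fQ].
exists (\sum_(m <- mpoly.msupp Q) Re (mpoly.mcoeff m Q) *: mpoly.mpolyX R m) => [|z].
  apply: supp_msize => m /mpoly.msupp_sum_le/flatten_mapP[m' hm'].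
  by move=> /mpoly.msuppZ_le; rewrite mpoly.msuppX inE => /eqP ->; apply: hQ; rewrite mem_filter in hm'.
rewrite fQ mpoly.mevalE (raddf_sum (mpoly.meval (z 0))).
have -> (s : seq (mpoly.multinom nu)) (g : _ -> C) : Re (\sum_(m <- s) g m) = \sum_(m <- s) Re (g m).
  by elim: s => [|m s ih]; rewrite ?big_nil // !big_cons ReD ih.
apply: eq_bigr => m _ /=; rewrite mpoly.mevalZ mpoly.mevalX.
have -> : \prod_i real_complex R (z 0 i) ^+ m i = real_complex R (\prod_i z 0 i ^+ m i).
  by rewrite rmorph_prod; apply: eq_bigr => i _; rewrite rmorphXn.
by rewrite ReM Re_real Im_real mulr0 subr0.
Qed.

(** * Real maps with prescribed eigen-coordinates *)

Definition real_form nu p (T : 'M[C]_nu) (g : 'I_nu -> 'rV[R]_p -> C) (x : 'rV[R]_p) : 'rV[R]_nu :=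
  map_mx (@complex.Re R) ((\row_j g j x) *m (invmx T)^T).

Lemma real_formE nu p (T : 'M[C]_nu) (g : 'I_nu -> 'rV[R]_p -> C) x i :
  real_form T g x 0 i = Re (\sum_j g j x * invmx T i j).
Proof. by rewrite mxE; congr Re; rewrite mxE; apply: eq_bigr => j _; rewrite !mxE. Qed.

Lemma bigO2_frechet_diff (W : normedModType R) (f : W -> R) : bigO 2 f -> frechet_diff f 0 (fun=> 0).
Proof.
move=> [c c0 [e e0 h]]; split; first exact: bounded_linear_zero.
have f0 : f 0 = 0.
  by apply/eqP; rewrite -normr_le0; apply: (le_trans (h 0 _)); rewrite ?normr0 ?expr0n ?mulr0.
move=> r r0; have c1 : 0 < c + 1 by rewrite ltr_wpDl.
exists (Num.min e (r / (c + 1))) => [|x]; first by rewrite lt_min e0 divr_gt0.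
rewrite !subr0 lt_min f0 !subr0 => /andP[/h H xr]; apply: (le_trans H).
rewrite expr2 mulrA ler_wpM2r //; move: xr; rewrite ltr_pdivlMr // => xr.
by apply: ltW; apply: le_lt_trans xr; rewrite mulrC ler_wpM2l // lerDl.
Qed.

Lemma jacobian_of_frechet_diff n m (f : 'rV[R]_n -> 'rV[R]_m) x K :
  frechet_diff f x K -> forall v, K v = v *m (Jac f x)^T.
Proof. by move=> /frechet_diff_diff[_ h] v; rewrite /Jac trmxK /jacobian mul_rV_lin1 h. Qed.

Section Symmetric.
Context (nu : nat) (tau : 'I_nu -> 'I_nu) (T : 'M[C]_nu).
Context (tau2 : involutive tau) (uT : T \in unitmx)
  (Tsym : forall k l, T (tau k) l = conjc (T k l)).

Lemma ecoord_sym p (W : 'M[C]_(nu, p)) x k :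
  (forall k l, W (tau k) l = conjc (W k l)) ->
  ecoord W x 0 (tau k) = conjc (ecoord W x 0 k).
Proof.
move=> hW; rewrite !ecoordE (raddf_sum (@conjc R)); apply: eq_bigr => l _ /=.
rewrite hW rmorphM; congr (_ * _); exact: esym (conjc_real _).
Qed.

Lemma ecoord_real_form p (g : 'I_nu -> 'rV[R]_p -> C) x j :
  (forall j, g (tau j) x = conjc (g j x)) -> ecoord T (real_form T g x) 0 j = g j x.
Proof.
move=> hg; have -> := real_coordinates (u := \row_j g j x) tau2 uT Tsym; first by rewrite mxE.
by move=> k; rewrite !mxE.
Qed.

Lemma real_form_Ck p k (A : set 'rV[R]_p) (g : 'I_nu -> 'rV[R]_p -> C) :
  (forall j, cCk k A (g j)) -> Ck k A (real_form T g).
Proof.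
move=> hg.
have -> : real_form T g = fun x => \sum_i (Re (\sum_j g j x * invmx T i j)) *: delta_mx 0 i.
  apply/funext => x; rewrite {1}(rV_delta_sum (real_form T g x)).
  by apply: eq_bigr => i _; rewrite real_formE.
apply: Ck_sum => i; apply: Ck_scale; last exact: Ck_cst.
have [h _] : cCk k A (fun x => \sum_j g j x * invmx T i j).
  by apply: cCk_sum => j; apply: cCk_mul => //; exact: cCk_cst.
exact: h.
Qed.

(** In the coordinates [T] the map agrees with the linear map [W] up to second
    order, so their derivatives coincide. *)
Lemma real_form_derivative p (A : set 'rV[R]_p) (g : 'I_nu -> 'rV[R]_p -> C) (W : 'M[C]_(nu, p)) :
  metric_open A -> A 0 -> (forall j, cCk 1 A (g j)) ->
  (forall j, cbigO 2 (fun x => g j x - ecoord W x 0 j)) ->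
  (forall j x, g (tau j) x = conjc (g j x)) ->
  real_form T g 0 = 0 /\ T *m complexify (Jac (real_form T g) 0) = W.
Proof.
move=> oA A0 hT hW gsym.
have g0 j : g j 0 = 0.
  have [c c0 [e e0 h]] := hW j; have := h 0; rewrite normr0 => /(_ e0).
  rewrite ecoord0 mxE subr0 expr0n mulr0 normr_le0 cmod_eq0 => /eqP; exact.
split.
  by apply/rowP => i; rewrite real_formE mxE big1 // => j _; rewrite g0 mul0r.
have [f1 h1 _] := real_form_Ck hT.
have hK := strict_diff_frechet_diff (h1 0 A0).
set G := real_form T g in hK *.
set K := (fun v => f1 (0, v)) in hK.
have KJ := jacobian_of_frechet_diff hK; set J := (Jac G 0)^T in KJ.
have key v j : ecoord T (v *m J) 0 j = ecoord W v 0 j.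
  have gE x : ecoord T (G x) 0 j = g j x by exact: ecoord_real_form.
  apply: complex_eq.
    have d1 := frechet_diff_linl (bounded_linear_ecoord_Re T j) hK.
    have d2 := frechet_diff_add (bigO2_frechet_diff (cbigO_Re (hW j)))
      (strict_diff_frechet_diff (bounded_linear_strict_diff 0 (bounded_linear_ecoord_Re W j))).
    have d3 : frechet_diff (fun x => Re (ecoord T (G x) 0 j)) 0 (fun v => 0 + Re (ecoord W v 0 j)).
      by move: d2; congr frechet_diff; apply/funext => x; rewrite -ReD subrK gE.
    by have := frechet_diff_uniq d1 d3 v; rewrite KJ add0r.
  have d1 := frechet_diff_linl (bounded_linear_ecoord_Im T j) hK.
  have d2 := frechet_diff_add (bigO2_frechet_diff (cbigO_Im (hW j)))
    (strict_diff_frechet_diff (bounded_linear_strict_diff 0 (bounded_linear_ecoord_Im W j))).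
  have d3 : frechet_diff (fun x => Im (ecoord T (G x) 0 j)) 0 (fun v => 0 + Im (ecoord W v 0 j)).
    by move: d2; congr frechet_diff; apply/funext => x; rewrite -ImD subrK gE.
  by have := frechet_diff_uniq d1 d3 v; rewrite KJ add0r.
have E : complexify J *m T^T = W^T.
  apply/row_matrixP => i; rewrite !rowE mulmxA.
  have -> : delta_mx 0 i = complexify (delta_mx 0 i : 'rV[R]_p) by rewrite /complexify map_delta_mx.
  have := key (delta_mx 0 i); rewrite /ecoord /complexify map_mxM => H.
  by apply/rowP => j; exact: H.
apply: trmx_inj; rewrite -E trmx_mul /J; congr (_ *m _).
by apply/matrixP => a b; rewrite !mxE.
Qed.

End Symmetric.

(** * Submersions and spectral data *)

(** Compose the derivative at a nearby point with a right inverse of the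
    derivative at the origin: the result is close to the identity, hence
    invertible. *)
Lemma submersion_near n nu (A : set 'rV[R]_n) (U : 'rV[R]_n -> 'rV[R]_nu) :
  metric_open A -> A 0 -> (forall x, A x -> exists K, strict_diff U x K) -> row_free (Jac U 0) ->
  submersion_near0 U.
Proof.
move=> oA A0 hU fJ; have [K0 hK0] := hU 0 A0.
have K0E := jacobian_of_frechet_diff (strict_diff_frechet_diff hK0); set J := (Jac U 0)^T in K0E.
have fuJ : row_full J by rewrite /row_full /J mxrank_tr.
have BJ := mulVpmx fuJ; set B := pinvmx J in BJ.
have [M M0 hM] := (bounded_linear_mulmx B).2.
have M1 : 0 < M + 1 by rewrite ltr_wpDl.
have [d d0 hd] := strict_diff_close hK0 (divr_gt0 (ltr0n R 1) (mulr_gt0 (ltr0n R 2) M1)).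
have [d' d'0 hA] := oA 0 A0.
apply/near0P; exists (Num.min d d') => [|x]; first by rewrite lt_min d0.
rewrite -{1}(subr0 x) lt_min => /andP[xd /hA Ax]; have [K hK] := hU x Ax.
have hf := strict_diff_frechet_diff hK; split; first exact: (frechet_diff_diff hf).1.
have KE := jacobian_of_frechet_diff hf; set Jx := (Jac U x)^T in KE.
suff fB : row_free (B *m Jx).
  rewrite /row_free eqn_leq rank_leq_row /=.
  have := mxrankM_maxr B Jx; rewrite (eqP (fB : \rank (B *m Jx) == nu)).
  by rewrite /Jx mxrank_tr.
apply: inj_row_free => z hz; apply/eqP; rewrite -normr_le0.
have := hd x K xd hf (z *m B).
have -> : K (z *m B) - K0 (z *m B) = - z.
  have e1 : K (z *m B) = 0 by apply: (etrans (KE _)); rewrite -mulmxA; exact: hz.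
  have e2 : K0 (z *m B) = z by apply: (etrans (K0E _)); rewrite -mulmxA BJ mulmx1.
  by apply: (etrans (congr2 (fun a b => a - b) e1 e2)); exact: sub0r.
rewrite normrN => H.
have H2 : 1 / (2 * (M + 1)) * `|z *m B| <= `|z| / 2.
  have := hM z; have -> : 1 / (2 * (M + 1)) * `|z *m B| = `|z *m B| / (M + 1) / 2.
    by field; rewrite gt_eqF.
  move=> H1; rewrite ler_pM2r ?invr_gt0 // ler_pdivrMr // mulrC.
  by apply: (le_trans H1); rewrite ler_wpM2r // lerDl.
have := le_trans H H2; have := normr_ge0 z; lra.
Qed.

Lemma row_free_rowsub n nu (le_nu : (nu <= n)%N) (V : 'M[C]_n) :
  row_free V -> row_free (rowsub (widen_ord le_nu) V).
Proof.
move=> fV; apply: inj_row_free => z; rewrite -[V]mul1mx -mul_rowsub_mx mulmxA => hz.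
have hz' : z *m rowsub (widen_ord le_nu) 1%:M = 0 by apply: (row_free_inj fV); rewrite hz mul0mx.
apply/rowP => i; have /rowP/(_ (widen_ord le_nu i)) := hz'.
rewrite !mxE => <-; rewrite (bigD1 i) //= big1 => [|k ki].
  by rewrite !mxE eqxx mulr1 addr0.
rewrite !mxE (_ : _ == _ = false) ?mulr0 //; apply/negbTE.
by apply: contra ki => /eqP/(congr1 val)/= /val_inj ->.
Qed.

(** Only the first [nu] eigenvectors are changed; they keep their span. *)
Lemma adapted_basis n nu (le_nu : (nu <= n)%N) (mu : 'I_n -> C) (v : 'I_n -> 'rV[C]_n)
   (A : 'M[R]_n) (tau : 'I_nu -> 'I_nu) :
  (forall k, v k *m complexify A = mu k *: v k) -> row_free (\matrix_(k < n) v k) ->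
  (map_mx conjc (Estar le_nu v) <= Estar le_nu v)%MS ->
  conj_pairing (fun k => mu (widen_ord le_nu k)) tau ->
  exists V : 'M[C]_n, [/\ V \in unitmx,
    forall k, row k V *m complexify A = mu k *: row k V,
    forall k l, V (widen_ord le_nu (tau k)) l = conjc (V (widen_ord le_nu k) l) &
    (rowsub (widen_ord le_nu) V == Estar le_nu v)%MS].
Proof.
move=> hv fv hE htau; set E := Estar le_nu v in hE *; set V0 := \matrix_k v k in fv.
have E0 : E = rowsub (widen_ord le_nu) V0 by apply/matrixP => i j; rewrite !mxE.
have fE : row_free E by rewrite E0; exact: row_free_rowsub.
have eigE : E *m complexify A = diag_mx (\row_k mu (widen_ord le_nu k)) *m E.
  apply/row_matrixP => i; rewrite row_mul !rowK hv mul_diag_mx.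
  by apply/rowP => j; rewrite !mxE.
have [P [uP Psym Peig]] := symmetric_eigenbasis fE eigE hE htau.
pose W := P *m E.
(* Indices below [nu] take the symmetrized rows, the others keep theirs. *)
pose V : 'M[C]_n := \matrix_k (if insub (k : nat) is Some i then row i W else v k).
have Vl i : row (widen_ord le_nu i) V = row i W.
  by rewrite rowK (_ : insub _ = Some i) //; exact: (valK i).
have Vr (k : 'I_n) : (nu <= k)%N -> row k V = v k.
  by move=> h; rewrite rowK insubN // -leqNgt.
have VW : rowsub (widen_ord le_nu) V = W.
  by apply/row_matrixP => i; rewrite row_rowsub Vl.
have WE : (W == E)%MS.
  by apply/eqmxP/eqmxMfull; rewrite row_full_unit.
exists V; split.
- rewrite -row_full_unit -sub1mx.
  have fV0 : row_full V0 by move: fv; rewrite row_free_unit row_full_unit.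
  apply: (submx_trans (B := V0)); first by rewrite sub1mx.
  apply/row_subP => k; rewrite rowK.
  have [h|h] := leqP nu k; first by rewrite -(Vr k h) row_sub.
  have -> : v k = row (Ordinal h) E.
    by rewrite rowK; congr v; apply: val_inj.
  apply: submx_trans (row_sub _ _) _; apply: (submx_trans (B := W)); first by case/andP: WE.
  by apply/row_subP => i; rewrite -Vl row_sub.
- move=> k; have [h|h] := leqP nu k; first by rewrite (Vr k h) hv.
  have -> : k = widen_ord le_nu (Ordinal h) by apply: val_inj.
  rewrite Vl -row_mul Peig -/W.
  by apply/rowP => j; rewrite mxE mul_diag_mx !mxE.
- move=> k l; have := Psym k l; rewrite -/W -VW.
  by rewrite ![rowsub _ _ _ _]mxE.
- by rewrite VW.
Qed.

Lemma ecoord_bound p n (V : 'M[C]_(p, n)) :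
  exists2 M : R, 0 <= M & forall x j, cmod (ecoord V x 0 j) <= M * `|x|.
Proof.
have /boolp.choice[M hM] (j : 'I_p) : exists M, 0 <= M /\ forall x, cmod (ecoord V x 0 j) <= M * `|x|.
  have [M1 M10 h1] := (bounded_linear_ecoord_Re V j).2; have [M2 M20 h2] := (bounded_linear_ecoord_Im V j).2.
  exists (M1 + M2); split=> [|x]; first exact: addr_ge0.
  by apply: (le_trans (le_cmod _)); rewrite mulrDl lerD.
exists (\sum_j M j) => [|x j]; first by apply: sumr_ge0 => j _; have [] := hM j.
apply: (le_trans ((hM j).2 x)); rewrite ler_wpM2r // (bigD1 j) //= lerDl.
by apply: sumr_ge0 => i _; have [] := hM i.
Qed.

(** The sum of the moduli of the eigen-coordinates contracts exactly at the
    spectral radius, and any larger rate is available for the map itself. *)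
Lemma adapted_norm n nu (le_nu : (nu <= n)%N) sigma k (mu : 'I_n -> C) (V : 'M[C]_n)
   (F L : 'rV[R]_n -> 'rV[R]_n) :
  (0 < n)%N -> V \in unitmx -> (forall j, cmod (mu j) < 1) ->
  (beth le_nu mu < (sigma%:R)%:E)%E -> F 0 = 0 -> Ck k.+1 setT F -> strict_diff F 0 L ->
  (forall x j, ecoord V (L x) 0 j = mu j * ecoord V x 0 j) ->
  exists N q, [/\ eqnorm N, 0 <= q < 1, contraction_Ck k.+1 q N setT F &
    forall j : 'I_nu, q ^+ sigma < cmod (mu (widen_ord le_nu j))].
Proof.
move=> n0 uV mu1 hb F0 hF hL hmu.
pose N x := \sum_j cmod (ecoord V x 0 j).
have hN : eqnorm N.
  split.
  - move=> a x; rewrite /N mulr_sumr; apply: eq_bigr => j _.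
    by rewrite ecoordZ mxE cmodM cmod_real.
  - move=> x y; rewrite /N -big_split; apply: ler_sum => j _.
    by rewrite ecoordD mxE cmodD.
  - have [M M0 hM] := ecoord_bound V.
    have nM : 0 <= n%:R * M by rewrite mulr_ge0.
    exists (n%:R * M + 1) => [|x]; first by rewrite ltr_wpDl.
    apply: (@le_trans _ _ (n%:R * M * `|x|)); last by rewrite ler_wpM2r // lerDl.
    apply: (@le_trans _ _ (\sum_(j < n) M * `|x|)); first exact: ler_sum.
    by rewrite sumr_const card_ord -mulrA mulr_natl.
  - exact: ecoord_norm.
pose j0 : 'I_n := [arg max_(j > Ordinal n0) cmod (mu j)]%O.
have hj0 j : cmod (mu j) <= cmod (mu j0) by rewrite /j0; case: arg_maxP => // i _; exact.
have [q [rq q1 hq]] := exp_gap (rho := cmod (mu j0)) ltac:(by rewrite cmod_ge0 mu1)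
   (beth_bound hj0 (mu1 j0) hb).
exists N, q; split=> //.
  by rewrite q1 andbT; apply: le_trans (ltW rq); exact: cmod_ge0.
apply: (Ck_contraction_Ck hN (@metric_openT _ _) I F0 hL (rho := cmod (mu j0))) => //; last by rewrite cmod_ge0.
move=> x; rewrite /N mulr_sumr; apply: ler_sum => j _.
by rewrite hmu cmodM ler_wpM2r ?cmod_ge0.
Qed.

(** * Existence of the foliation *)

Lemma ecoord_eigen n (V : 'M[C]_n) (A : 'M[R]_n) (m : C) k x :
  row k V *m complexify A = m *: row k V ->
  ecoord V (x *m A^T) 0 k = m * ecoord V x 0 k.
Proof.
have e y : ecoord V y 0 k = (row k V *m (complexify y)^T) 0 0.
  by rewrite ecoordE mxE; apply: eq_bigr => i _; rewrite !mxE mulrC.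
move=> h; rewrite !e.
have -> : (complexify (x *m A^T))^T = complexify A *m (complexify x)^T.
  by rewrite /complexify map_mxM trmx_mul map_trmx trmxK.
by rewrite mulmxA h -scalemxAl mxE.
Qed.

Lemma near_ball n (N : 'rV[R]_n -> R) (e : R) (P : 'rV[R]_n -> Prop) : eqnorm N -> 0 < e ->
  (forall x, N x < e -> P x) -> \forall x \near (0 : 'rV[R]_n), P x.
Proof.
move=> [_ _ [c c0 hc] _] e0 h; apply/near0P; exists (e / c) => [|x xe]; first by rewrite divr_gt0.
by apply: h; apply: le_lt_trans (hc x) _; rewrite mulrC -ltr_pdivlMr.
Qed.

Lemma spectral_setting n nu (le_nu : (nu <= n)%N) k sigma (F : 'rV[R]_n -> 'rV[R]_n)
   (mu : 'I_n -> C) (V : 'M[C]_n) :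
  (0 < n)%N -> class_C k.+1 [set: 'rV[R]_n] F -> F 0 = 0 -> V \in unitmx ->
  (forall j, row j V *m complexify (Jac F 0) = mu j *: row j V) ->
  (forall j, cmod (mu j) < 1) -> (beth le_nu mu < (sigma%:R)%:E)%E ->
  exists L N q, [/\ strict_diff F 0 L, forall x j, ecoord V (L x) 0 j = mu j * ecoord V x 0 j,
    eqnorm N /\ 0 <= q < 1, Ck k.+1 setT F /\ contraction_Ck k.+1 q N setT F &
    forall j : 'I_nu, q ^+ sigma < cmod (mu (widen_ord le_nu j))].
Proof.
move=> n0 hF F0 uV hV mu1 hb.
have TF : Ck k.+1 setT F := class_C_Ck (@metric_openT _ _) hF.
have [f1 h1 _] := TF; have hL := h1 0 I.
have hmu x j : ecoord V (f1 (0, x)) 0 j = mu j * ecoord V x 0 j.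
  by rewrite (jacobian_of_frechet_diff (strict_diff_frechet_diff hL)) (ecoord_eigen _ (hV j)).
have [N [q [hN hq hFC hgap]]] := adapted_norm n0 uV mu1 hb F0 TF hL hmu.
by exists (fun x => f1 (0, x)), N, q.
Qed.

Theorem normal_form_foliation n nu r sigma (le_nu : (nu <= n)%N)
    (F : 'rV[R]_n -> 'rV[R]_n) (mu : 'I_n -> C) (v : 'I_n -> 'rV[C]_n) (tau : 'I_nu -> 'I_nu) :
  (0 < nu)%N -> class_C r [set: 'rV[R]_n] F -> F 0 = 0 ->
  (forall k, v k *m complexify (Jac F 0) = mu k *: v k) ->
  row_free (\matrix_(k < n) v k) ->
  (map_mx conjc (Estar le_nu v) <= Estar le_nu v)%MS ->
  (forall k, cmod (mu k) < 1) -> (2 <= sigma <= r)%N ->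
  (beth le_nu mu < (sigma%:R)%:E)%E ->
  (forall (j : 'I_nu) (m : mpoly.multinom n), (2 <= mpoly.mdeg m < sigma)%N ->
     \prod_k mu k ^+ m k = mu (widen_ord le_nu j) -> forall k : 'I_n, (nu <= k)%N -> m k = 0%N) ->
  conj_pairing (fun k => mu (widen_ord le_nu k)) tau ->
  let mu' := fun k : 'I_nu => mu (widen_ord le_nu k) in
  exists (U : 'rV[R]_n -> 'rV[R]_nu) (S : 'rV[R]_nu -> 'rV[R]_nu) (T : 'M[C]_nu),
    [/\ submersion_near0 U, tangent_to (Estar le_nu v) U, class_C_near0 r U,
      invariance_equation F U S & [/\ polynomial_map (sigma - 1) S,
      eigen_coordinates mu' tau S T & resonant_form (sigma - 1) mu' S T]].
Proof.
move=> nu0 hF F0 hv fv hE mu1 hs hb hres htau mu'.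
have n0 : (0 < n)%N := leq_trans nu0 le_nu.
have [tau2 mutau _] := htau.
have [V [uV hV Vsym VE]] := adapted_basis hv fv hE htau.
have r0 : (0 < r)%N by case/andP: hs => s2 /(leq_trans s2)/ltnW.
case: r r0 hF hs => // k _ hF hs.
have [L [N [q [hL hmu [hN hq] [TF hFC] hgap]]]] := spectral_setting n0 hF F0 uV hV mu1 hb.
set r := k.+1 in hF hs TF hFC *.
have y_sym j x : ecoord V x 0 (widen_ord le_nu (tau j)) = conjc (ecoord V x 0 (widen_ord le_nu j)).
  rewrite !ecoordE (raddf_sum (@conjc R)); apply: eq_bigr => l _ /=.
  by rewrite Vsym rmorphM; congr (_ * _); exact: esym (conjc_real _).
have [e [u [s [[e0 eA] hu usym hsup ueq]]]] :=
  triangular_normal_form uV (@metric_openT _ _) I F0 TF hs (strict_diff_frechet_diff hL) hmu hN hq hFC hgap hres mu1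
    htau y_sym nu.+1.
have {}ueq j x : N x < e -> u j (F x) = mu' j * u j x + mpoly.meval (u^~ x) (s j).
  by apply: ueq; rewrite ltnS /modulus_rank (leq_trans (max_card _)) // card_ord.
have [T [uT Tsym]] := @real_structure R nu tau tau2.
pose W := rowsub (widen_ord le_nu) V.
have WE x j : ecoord W x 0 j = ecoord V x 0 (widen_ord le_nu j).
  by rewrite !ecoordE; apply: eq_bigr => l _; rewrite [W _ _]mxE.
pose D := [set x | N x < e]; have oD : metric_open D by apply: metric_open_eqnorm.
have D0 : D 0 by rewrite /D /= (eqnorm0 hN).
pose U := real_form T u.
have TU : Ck r D U by apply: real_form_Ck => j; exact: (hu j).1.
have [U0 JU] : U 0 = 0 /\ T *m complexify (Jac U 0) = W.
  apply: (real_form_derivative tau2 uT Tsym oD D0) => // j.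
    by apply: cCk_le (hu j).1.
  by apply: cbigO_ext (hu j).2 => x; rewrite WE.
have fW : row_free W by apply: row_free_rowsub; rewrite row_free_unit.
have JUE : complexify (Jac U 0) = invmx T *m W by rewrite -JU mulmxA mulVmx // mul1mx.
have rU : row_free (Jac U 0).
  have fT : row_full T by rewrite row_full_unit.
  rewrite /row_free -(mxrank_map (real_complex R)).
  rewrite -(eqmxMfull (map_mx (real_complex R) (Jac U 0)) fT).
  by rewrite [X in \rank X]JU.
pose st j z := mu' j * ecoord T z 0 j + mpoly.meval (ecoord T z 0) (s j).
have zsym z j : ecoord T z 0 (tau j) = conjc (ecoord T z 0 j) by exact: ecoord_sym.
have stsym j z : st (tau j) z = conjc (st j z).
  rewrite /st rmorphD rmorphM /= -zsym (hsup j).2 //; congr (_ * _ + _).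
  exact: mutau.
pose S := real_form T st.
have SE z j : ecoord T (S z) 0 j = st j z by apply: ecoord_real_form.
have UE x j : ecoord T (U x) 0 j = u j x by apply: ecoord_real_form.
have [S0 JS] : S 0 = 0 /\ T *m complexify (Jac S 0) = diag_mx (\row_j mu' j) *m T.
  have Tz j : cCk 1 setT (fun z : 'rV[R]_nu => ecoord T z 0 j).
    by apply: cCk_ecoord; apply/Ck_lin/bounded_linear_id.
  apply: (real_form_derivative tau2 uT Tsym (@metric_openT _ _) I) => // j.
    by apply: cCk_add; [exact: cCk_scale|exact: cCk_meval].
  have : cbigO 2 (fun z : 'rV[R]_nu => mpoly.meval (ecoord T z 0) (s j)).
    under [fun x => _]funext => x do rewrite mpoly.mevalE big_seq_cond.
    apply: cbigO_sum => m /andP[/(hsup j).1[/andP[m2 _] _] _]; apply: cbigO_scale.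
    apply: (cbigO_le m2); rewrite mpoly.mdegE; apply: cbigO_prod => l; exact: cbigO_ecoord.
  apply: cbigO_ext => z; rewrite /st [X in _ = _ + X](_ : _ = - (mu' j * ecoord T z 0 j)).
    by rewrite addrAC subrr add0r.
  congr (- _); rewrite !ecoordE mulr_sumr; apply: eq_bigr => l _.
  by rewrite mul_diag_mx !mxE mulrCA.
have s_deg j : supp_in (deg_le (sigma - 1)) (s j).
  by apply: supp_weaken (hsup j).1 => m [/andP[_ m2] _]; rewrite /deg_le subn1 -ltnS prednK //; case/andP: hs => /ltnW.
have s1 : (1 <= sigma - 1)%N by rewrite subn_gt0; case/andP: hs.
exists U, S, T; split.
- apply: (submersion_near oD D0) => // x Dx.
  by have [f1 h1 _] := TU; exists (fun v => f1 (x, v)); exact: h1.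
- split=> //; rewrite JUE; apply/andP; split.
    by apply: submx_trans (submxMl _ _) _; case/andP: VE.
  apply: (submx_trans (B := W)); first by case/andP: VE.
  by rewrite -[W in (W <= _)%MS]mul1mx -(mulmxV uT) -mulmxA submxMl.
- exists D; last exact: Ck_class_C.
  by split => //; exact: opopen.
- apply: (near_ball hN e0) => x xe; congr (map_mx _ (_ *m _)).
  apply/rowP => j; rewrite !mxE ueq // /st UE; congr (_ + _).
  by apply: mpoly.meval_eq => i; rewrite UE.
split.
- have hS i : cpoly (sigma - 1) (fun z => \sum_j st j z * invmx T i j).
    apply: cpoly_sum => j.
    have : cpoly (sigma - 1) (st j).
      apply: cpoly_add; first exact: (cpoly_scale _ (cpoly_le s1 (cpoly_ecoord T j))).
      by apply: cpoly_meval => // l; exact: cpoly_ecoord.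
    by move=> /(cpoly_scale (invmx T i j)); congr cpoly; apply/funext => z; rewrite mulrC.
  have /boolp.choice[P hP] i : exists P : mpoly.mpoly nu R, (mpoly.msize P <= (sigma - 1).+1)%N /\
      forall z, Re (\sum_j st j z * invmx T i j) = mpoly.meval (z 0) P.
    by have [P P1 P2] := cpoly_Re (hS i); exists P.
  exists P => [j|z j]; first exact: (hP j).1.
  by rewrite -(hP j).2 real_formE.
- split=> //.
  by rewrite JS -mulmxA mulmxV // mulmx1.
pose Q j : mpoly.mpoly nu C := mu' j *: mpoly.mpolyX C (mpoly.mnm1 j) + s j.
exists Q; split.
- move=> j; apply: supp_msize; apply: (supp_add (P := deg_le (sigma - 1))) => //.
  by apply: supp_scale; apply: supp_X; rewrite /deg_le mpoly.mdeg1.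
- move=> z j; rewrite mpoly.mevalD mpoly.mevalZ mpoly.mevalXU; exact: SE.
- move=> j m m2; rewrite -mpoly.mcoeff_msupp => /mpoly.msuppD_le; rewrite mem_cat => /orP[|].
    by move=> /mpoly.msuppZ_le; rewrite mpoly.msuppX inE => /eqP me; move: m2; rewrite me mpoly.mdeg1.
  by move=> /(hsup j).1[].
Qed.

End RealNormalForm.

(** * Dynamics on the leaf space *)

Section Uniqueness.
Context (R : realType).
Local Notation C := (R[i]).
Local Notation Y V x k := (ecoord V x 0 k).

Lemma strict_diff_Ck1 (V W : normedModType R) (A : set V) (f : V -> W) :
  metric_open A -> (forall x, A x -> exists K, strict_diff f x K) -> Ck 1 A f.
Proof.
move=> oA h.
pose K x : V -> W := if pselect (exists K, strict_diff f x K) is left e then projT1 (cid e) else fun=> 0.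
have hK x : A x -> strict_diff f x (K x).
  by move=> Ax; rewrite /K; case: pselect => [e|]; [exact: projT2 (cid e)|move=> /(_ (h x Ax))].
exists (fun p => K p.1 p.2) => // -[x v] /= Ax e e0.
have v1 : 0 < `|v| + 1 by rewrite ltr_wpDl.
have [d d0 hd] := strict_diff_close (hK x Ax) (divr_gt0 (divr_gt0 e0 (ltr0n R 2)) v1).
have [d' d'0 hA] := oA x Ax; have [M M0 hM] := (hK x Ax).1.2.
have M1 : 0 < M + 1 by rewrite ltr_wpDl.
exists (Num.min (Num.min d d') (Num.min 1 (e / 2 / (M + 1)))).
  by rewrite !lt_min d0 d'0 ltr01 !divr_gt0.
move=> [y w] yw; have := le_lt_trans (le_norm1 ((y, w) - (x, v))) yw.
have := le_lt_trans (le_norm2 ((y, w) - (x, v))) yw => /=.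
rewrite !lt_min => /andP[_ /andP[w1 w2]] /andP[/andP[y1 y2] _].
have H1 := hd y _ y1 (strict_diff_frechet_diff (hK y (hA y y2))) w.
have H2 := hM (w - v).
rewrite -(subrKA (K x w)) -(bounded_linearB w v (hK x Ax).1).
apply: (le_trans (ler_normD _ _)).
have -> : e = e / 2 + e / 2 by lra.
apply: lerD.
  apply: (le_trans H1); rewrite mulrAC ler_pdivrMr // ler_wpM2l ?divr_ge0 ?(ltW e0) //.
  have := ler_normD (w - v) v; rewrite subrK; lra.
apply: (le_trans H2); apply: (@le_trans _ _ ((M + 1) * `|w - v|)).
  by rewrite ler_wpM2r // lerDl.
by rewrite mulrC -ler_pdivlMr // ltW.
Qed.

Lemma times_differentiable_strict_diff n m k (A : set 'rV[R]_n) (f : 'rV[R]_n -> 'rV[R]_m) :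
  metric_open A -> times_differentiable k.+2 A f -> forall x, A x -> exists K, strict_diff f x K.
Proof.
move=> oA [h1 h2] x Ax.
exists (fun v : 'rV[R]_n => \sum_i v 0 i *: 'D_(delta_mx 0 i) f x).
apply: (strict_diff_of_partials (g := fun i y => 'D_(delta_mx 0 i) f y) oA Ax) => [y Ay|i].
  have hy := differentiable_frechet_diff (h1 y Ay).
  apply: (frechet_diff_ext hy) => v; rewrite [LHS](bounded_linear_deltaE v hy.1).
  by apply: eq_bigr => i _; rewrite deriveE //; exact: h1.
exact: frechet_diff_cont (differentiable_frechet_diff ((h2 (delta_mx 0 i)).1 x Ax)).
Qed.

Lemma row_free_basis_change (K : fieldType) nu n (W X : 'M[K]_(nu, n)) : row_free W -> (W <= X)%MS ->
  exists2 T, T \in unitmx & T *m X = W.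
Proof.
move=> fW /submxP[T hT]; exists T; last by rewrite hT.
rewrite -row_free_unit /row_free eqn_leq rank_leq_row /=.
by have := mxrankM_maxl T X; rewrite -hT (eqP (fW : \rank W == nu)).
Qed.

Lemma ecoord_comp n nu p (T : 'M[C]_(p, nu)) (X : 'M[R]_(nu, n)) W :
  T *m complexify X = W -> forall x, ecoord T (x *m X^T) = ecoord W x.
Proof.
move=> <- x; rewrite /ecoord trmx_mul mulmxA; congr (_ *m _).
by rewrite /complexify map_mxM map_trmx.
Qed.

(** The conjugate dynamics is arbitrary, but near the origin it must be [U o F]
    read on a section of [U]; so it is strictly differentiable there, with the
    eigenvalues of the invariant space. *)
Lemma conjugate_strict n nu (A : set 'rV[R]_n) (U : 'rV[R]_n -> 'rV[R]_nu)
   (F L : 'rV[R]_n -> 'rV[R]_n) S (T : 'M[C]_nu) (W : 'M[C]_(nu, n)) (mu : 'I_nu -> C) :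
  metric_open A -> A 0 -> U 0 = 0 -> (forall x, A x -> exists K, strict_diff U x K) -> row_free (Jac U 0) ->
  F 0 = 0 -> strict_diff F 0 L -> invariance_equation F U S ->
  T \in unitmx -> T *m complexify (Jac U 0) = W ->
  (forall x j, Y W (L x) j = mu j * Y W x j) ->
  forall eps : R, 0 < eps -> exists2 rho : R, 0 < rho & forall x x0, `|x| < rho -> `|x0| < rho ->
    forall j, cmod (Y T (U (F x)) j - Y T (U (F x0)) j - mu j * (Y T (U x) j - Y T (U x0) j))
      <= eps * \sum_i cmod (Y T (U x) i - Y T (U x0) i).
Proof.
move=> oA A0 U0 hU fJ F0 hF inv uT TW hmu eps eps0.
have [K0 hK0] := hU 0 A0; have K0E := jacobian_of_frechet_diff (strict_diff_frechet_diff hK0).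
have {hK0} hU0 : strict_diff U 0 (fun v => v *m (Jac U 0)^T) by apply: strict_diff_ext hK0 _.
set J := (Jac U 0)^T in K0E hU0.
have fuJ : row_full J by rewrite /row_full /J mxrank_tr.
have BJ := mulVpmx fuJ; set B := pinvmx J in BJ.
have [GJ [g [d [rho [[d0 rho0 hg1 hg2 hg3] g0 hg4 hg5]]]]] := straighten oA A0 U0 hU hU0 BJ.
(* The map [z |-> g (z *m B)] is a section of [U]. *)
pose Sl z := U (F (g (z *m B))).
have hSl : strict_diff Sl 0 (fun z => L (z *m B) *m J).
  have h1 : strict_diff (fun z => z *m B) 0 (fun z => z *m B) := bounded_linear_strict_diff 0 (bounded_linear_mulmx B).
  have h2 : strict_diff g (0 *m B) id by rewrite mul0mx.
  have h3 : strict_diff F (g (0 *m B)) L by rewrite mul0mx g0.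
  have h4 : strict_diff U (F (g (0 *m B))) (fun v => v *m J) by rewrite mul0mx g0 F0.
  have h5 := strict_diff_comp (f := g) (g := fun z => z *m B) h2 h1.
  have h6 := strict_diff_comp (f := F) (g := fun z => g (z *m B)) h3 h5.
  exact: (strict_diff_comp (f := U) (g := fun z => F (g (z *m B))) h4 h6).
have [M M0 hM] : exists2 M : R, 0 <= M & forall x j, cmod (Y T x j) <= M * `|x|.
  exact: ecoord_bound.
have [c c0 hc] := ecoord_norm uT.
have M1 : 0 < M + 1 by rewrite ltr_wpDl.
have [d1 d10 hd1] := hSl.2 (eps / ((M + 1) * c)) ltac:(by rewrite divr_gt0 // mulr_gt0).
have [d2 d20 hd2] := (near0P _).1 inv.
have [MB MB0 hMB] := (bounded_linear_mulmx B).2.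
have MB1 : 0 < MB + 1 by rewrite ltr_wpDl.
pose d3 := Num.min d1 (Num.min d (d2 / 2) / (MB + 1)).
have d30 : 0 < d3 by rewrite lt_min d10 divr_gt0 // lt_min d0 divr_gt0.
have [d4 d40 hd4] := strict_diff_cont hU0 (divr_gt0 d30 (ltr0n R 2)).
exists (Num.min d2 d4); first by rewrite lt_min d20.
have ESl x : `|x| < Num.min d2 d4 -> `|U x| < d1 /\ U (F x) = Sl (U x).
  rewrite lt_min => /andP[x2 x4]; have := hd4 x; rewrite U0 !subr0 => /(_ x4) Ux.
  have {}Ux : `|U x| < d3 by apply: le_lt_trans Ux _; rewrite ltr_pdivrMr // ltr_pMr // ltr1n.
  have [Ux1 Ux2] : `|U x| < d1 /\ `|U x *m B| < Num.min d (d2 / 2).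
    move: Ux; rewrite lt_min => /andP[-> H]; split=> //.
    apply: le_lt_trans (hMB _) _; apply: (@le_lt_trans _ _ ((MB + 1) * `|U x|)).
      by rewrite ler_wpM2r // lerDl.
    by rewrite mulrC -ltr_pdivlMr.
  split=> //; move: Ux2; rewrite lt_min => /andP[UB1 UB2].
  have [e1 e2 _] := hg1 _ UB1.
  have Us : U (g (U x *m B)) = U x by rewrite -(GJ (g _)) e1 -mulmxA BJ mulmx1.
  rewrite /Sl (hd2 x x2) (hd2 (g (U x *m B))) ?Us //.
  by apply: le_lt_trans e2 _; rewrite mulrC -ltr_pdivlMr.
move=> x x0 /ESl[Ux ->] /ESl[Ux0 ->] j.
have H := hd1 (U x) (U x0); rewrite !subr0 in H; have {}H := H Ux Ux0.
have -> : Y T (Sl (U x)) j - Y T (Sl (U x0)) j - mu j * (Y T (U x) j - Y T (U x0) j) =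
    Y T (Sl (U x) - Sl (U x0) - L ((U x - U x0) *m B) *m J) j.
  have eB (a b : 'rV[R]_nu) : Y T (a - b) j = Y T a j - Y T b j.
    by rewrite ecoordD ecoordN !mxE.
  rewrite [RHS]eB [in RHS]eB -(eB (U x)); congr (_ - _).
  rewrite (ecoord_comp TW (L ((U x - U x0) *m B))) hmu; congr (_ * _).
  by rewrite -(ecoord_comp TW) -mulmxA BJ mulmx1.
apply: (le_trans (hM _ _)); apply: (@le_trans _ _ ((M + 1) * (eps / ((M + 1) * c) * `|U x - U x0|))).
  by apply: ler_pM => //; rewrite lerDl.
have -> : (M + 1) * (eps / ((M + 1) * c) * `|U x - U x0|) = eps * (`|U x - U x0| / c).
  by field; rewrite !gt_eqF.
rewrite ler_pM2l // ler_pdivrMr // mulrC; apply: (le_trans (hc _)).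
rewrite ler_pM2l //; apply: ler_sum => i _.
by rewrite ecoordD ecoordN !mxE.
Qed.

(** * Homogeneous functions constant along leaves *)

Definition mono n (w : 'I_n -> C) (m : mpoly.multinom n) := \prod_k w k ^+ m k.

(** Doubling one coordinate on which two monomials differ eliminates one of
    them. *)
Lemma monomials_independent n (s : seq (mpoly.multinom n)) (c : mpoly.multinom n -> C) :
  uniq s -> (forall w : 'I_n -> C, \sum_(m <- s) c m * mono w m = 0) ->
  forall m, m \in s -> c m = 0.
Proof.
elim: s c => [|m0 s ih] c //= /andP[m0s us] h.
have cs m : m \in s -> c m = 0.
  move=> ms; have mm0 : m != m0 by apply: contraNneq m0s => <-.
  have [k hk] : exists k, m k != m0 k.
    apply: contrapT => hk; move/eqP: mm0; apply; apply/mpoly.mnmP => k.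
    by apply: contrapT => /eqP hk'; apply: hk; exists k.
  pose c' m := c m * (2 ^+ m k - 2 ^+ m0 k).
  have : c' m = 0.
    apply: ih ms => // w; pose w2 i := if i == k then 2 * w i else w i.
    have E m' : mono w2 m' = 2 ^+ m' k * mono w m'.
      rewrite /mono (bigD1 k) //= [in RHS](bigD1 k) //= /w2 eqxx exprMn -mulrA.
      by congr (_ * (_ * _)); apply: eq_bigr => i /negPf ->.
    have : \sum_(m <- m0 :: s) c m * mono w2 m - 2 ^+ m0 k * \sum_(m <- m0 :: s) c m * mono w m = 0.
      by rewrite !h mulr0 subr0.
    rewrite mulr_sumr -sumrB big_cons E /= mulrCA subrr add0r => H.
    rewrite -[RHS]H; apply: eq_bigr => m' _; rewrite E /c'.
    move: (c m') (mono w m') (2 ^+ m' k) (2 ^+ m0 k) => a b d e; ring.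
  move=> /eqP; rewrite mulf_eq0 subr_eq0 => /orP[/eqP //|/eqP e2].
  have : (2 ^ m k)%:R = (2 ^ m0 k)%:R :> C by rewrite !natrX.
  by move=> /eqP; rewrite eqr_nat eqn_exp2l // (negPf hk).
move=> m; rewrite inE => /orP[/eqP ->|/cs //].
have := h (fun=> 1); rewrite big_cons big_seq big1 => [|m' /cs ->]; last by rewrite mul0r.
by rewrite /mono big1 => [|k _]; rewrite ?expr1n // mulr1 addr0.
Qed.

(** The hypothesis extends from real to complex vectors: for vectors [a + t b]
    the difference of both sides is a polynomial in [t] vanishing at all
    natural numbers, hence also at [t = i].  Setting the transverse coordinates
    to zero then leaves a linear relation between distinct monomials. *)
Lemma no_transverse_monomials n nu (le_nu : (nu <= n)%N) (V : 'M[C]_n) (T : 'M[C]_nu)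
   (X : 'M[R]_(nu, n)) (s : seq (mpoly.multinom n)) (c : mpoly.multinom n -> C) :
  V \in unitmx -> T \in unitmx -> T *m complexify X = rowsub (widen_ord le_nu) V -> uniq s ->
  (forall xi xi0, xi *m X^T = xi0 *m X^T ->
    \sum_(m <- s) c m * mono (ecoord V xi 0) m = \sum_(m <- s) c m * mono (ecoord V xi0 0) m) ->
  forall m (k : 'I_n), m \in s -> (nu <= k)%N -> m k != 0%N -> c m = 0.
Proof.
move=> uV uT TX us h m k ms nk mk.
suff : (if [exists k : 'I_n, (nu <= k)%N && (m k != 0%N)] then c m else 0) = 0.
  by rewrite (_ : [exists _, _] = true) //; apply/existsP; exists k; rewrite nk.
(* Keep the coefficients of the monomials with a transverse coordinate. *)
pose c' (m : mpoly.multinom n) := if [exists k : 'I_n, (nu <= k)%N && (m k != 0%N)] then c m else 0.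
rewrite -/(c' m); apply: monomials_independent ms => // w.
(* The same point with its transverse coordinates set to zero. *)
pose w0 (i : 'I_n) := if (i < nu)%N then w i else 0.
have E m' : c' m' * mono w m' = c m' * mono w m' - c m' * mono w0 m'.
  rewrite /c'; case: ifP => [/existsP[i /andP[ni mi]]|/negbT].
    have -> : mono w0 m' = 0.
      by rewrite /mono (bigD1 i) //= /w0 ltnNge ni /= expr0n (negPf mi) mul0r.
    by rewrite mulr0 subr0.
  rewrite negb_exists => /forallP hm; rewrite mul0r (_ : mono w0 m' = mono w m') ?subrr //.
  apply: eq_bigr => i _; rewrite /w0; case: ltnP => // ni.
  by have := hm i; rewrite ni /= negbK => /eqP ->.
under eq_bigr => m' _ do rewrite E.
rewrite sumrB; apply/eqP; rewrite subr_eq0; apply/eqP.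
pose wr := \row_i w i; pose w0r := \row_i w0 i.
pose z := wr *m (invmx V)^T; pose z0 := w0r *m (invmx V)^T.
have zV (v : 'rV[C]_n) : v *m (invmx V)^T *m V^T = v.
  by rewrite -mulmxA -trmx_mul mulmxV // trmx1 mulmx1.
pose re (x : 'rV[C]_n) := map_mx (@complex.Re R) x.
pose im (x : 'rV[C]_n) := map_mx (@complex.Im R) x.
have reim (x : 'rV[C]_n) : complexify (re x) + (Complex 0 1 : C) *: complexify (im x) = x.
  by apply/rowP => i; rewrite !mxE; apply: complex_eq; rewrite !(ReD, ImD, ReM, ImM) /=; ring.
have zX : (z - z0) *m (complexify X)^T = 0.
  have uTt : T^T \in unitmx by rewrite unitmx_tr.
  apply: (can_inj (mulmxK uTt)); rewrite mul0mx -mulmxA -trmx_mul TX mulmxBl.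
  apply/rowP => i; rewrite !mxE.
  have e (v : 'rV[C]_n) : \sum_j (v *m (invmx V)^T) 0 j * (rowsub (widen_ord le_nu) V)^T j i = v 0 (widen_ord le_nu i).
    by rewrite -[in RHS](zV v) [RHS]mxE; apply: eq_bigr => j _; rewrite !mxE.
  by rewrite !e !mxE /w0 /= ltn_ord subrr.
have reX (x : 'rV[C]_n) : x *m (complexify X)^T = 0 -> re x *m X^T = 0 /\ im x *m X^T = 0.
  move=> hx; split; apply/rowP => i; have /rowP/(_ i) := hx; rewrite !mxE.
    move=> /(congr1 (@complex.Re R)) e0; apply: etrans e0.
    elim/big_rec2: _ => // j a b _ ->; rewrite ReD; congr (_ + _).
    by rewrite ReM !mxE Im_real Re_real mulr0 subr0.
  move=> /(congr1 (@complex.Im R)) e0; apply: etrans e0.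
  elim/big_rec2: _ => // j a b _ ->; rewrite ImD; congr (_ + _).
  by rewrite ImM !mxE Im_real Re_real mulr0 add0r.
have [hre him] := reX _ zX.
have reB (x y : 'rV[C]_n) : re (x - y) = re x - re y.
  by apply/rowP => i; rewrite !mxE ReD ReN.
have imB (x y : 'rV[C]_n) : im (x - y) = im x - im y.
  by apply/rowP => i; rewrite !mxE ImD ImN.
pose P (x : 'rV[C]_n) : {poly C} := \sum_(m <- s) (c m)%:P *
   \prod_i ((Y V (re x) i)%:P + (Y V (im x) i) *: 'X) ^+ m i.
have PE x t : (P x).[t] = \sum_(m <- s) c m * mono (fun i => Y V (re x) i + t * Y V (im x) i) m.
  rewrite /P horner_sum; apply: eq_bigr => m' _; rewrite hornerM hornerC; congr (_ * _).
  rewrite horner_prod; apply: eq_bigr => i _; rewrite horner_exp; congr (_ ^+ _).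
  by rewrite hornerD hornerC hornerZ hornerX mulrC.
clearbody P; have [zE z0E] : z = wr *m (invmx V)^T /\ z0 = w0r *m (invmx V)^T by [].
clearbody z z0 re im; have P0 : P z - P z0 = 0.
  apply: contrapT => /eqP/poly_nat_nonroot[t]; rewrite hornerD hornerN !PE.
  have tr : (t%:R : C) = real_complex R t%:R by rewrite rmorph_nat.
  have e x : \sum_(m <- s) c m * mono (fun i => Y V (re x) i + t%:R * Y V (im x) i) m =
      \sum_(m <- s) c m * mono (ecoord V (re x + t%:R *: im x) 0) m.
    apply: eq_bigr => m' _; congr (_ * _); apply: eq_bigr => i _.
    by rewrite ecoordD ecoordZ !mxE tr.
  have hz : (re z + t%:R *: im z) *m X^T = (re z0 + t%:R *: im z0) *m X^T.
    apply/eqP; rewrite -subr_eq0 -mulmxBl opprD addrACA -scalerBr -reB -imB mulmxDl hre.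
    by rewrite -scalemxAl him scaler0 addr0.
  move=> /eqP; apply; apply/eqP; rewrite subr_eq0; apply/eqP.
  exact: (etrans (e z) (etrans (h _ _ hz) (esym (e z0)))).
have PI x v : x = v *m (invmx V)^T -> (P x).[Complex 0 1] = \sum_(m <- s) c m * mono (v 0) m.
  move=> xv; rewrite PE; apply: eq_bigr => m' _; congr (_ * _); apply: eq_bigr => i _; congr (_ ^+ _).
  have -> : v = complexify (re x) *m V^T + (Complex 0 1 : C) *: (complexify (im x) *m V^T).
    by rewrite scalemxAl -mulmxDl reim xv zV.
  by rewrite [RHS]mxE; congr (_ + _); rewrite [RHS]mxE.
have := congr1 (fun p : {poly C} => p.[Complex 0 1]) P0; rewrite hornerD hornerN horner0.
rewrite (PI z wr zE) (PI z0 w0r z0E) => /eqP; rewrite subr_eq0 => /eqP H.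
have e (f : 'I_n -> C) : \sum_(m <- s) c m * mono ((\row_i f i : 'rV[C]_n) 0) m = \sum_(m <- s) c m * mono f m.
  by apply: eq_bigr => m' _; congr (_ * _); apply: eq_bigr => i _; rewrite mxE.
by move: H; rewrite !e.
Qed.

(** The rescaled curves [g (t xi) / t] converge to [xi], and homogeneity turns the
    estimate on leaves into one at fixed size. *)
Lemma leaf_leading n e (Q : 'rV[R]_n -> C) (g : 'rV[R]_n -> 'rV[R]_n)
    (leaf : 'rV[R]_n -> 'rV[R]_n -> Prop) (xi xi0 : 'rV[R]_n) (d : R) :
  (forall (t : R) x, Q (t *: x) = real_complex R (t ^+ e) * Q x) ->
  (forall x, cont_at (fun y => Re (Q y)) x /\ cont_at (fun y => Im (Q y)) x) ->
  g 0 = 0 -> frechet_diff g 0 id ->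
  0 < d -> (forall t : R, 0 < t < d -> leaf (g (t *: xi)) (g (t *: xi0))) ->
  (forall eps : R, 0 < eps -> exists2 rho : R, 0 < rho & forall x x0, `|x| < rho -> `|x0| < rho ->
     leaf x x0 -> cmod (Q x - Q x0) <= eps * (`|x| ^+ e + `|x0| ^+ e)) ->
  Q xi = Q xi0.
Proof.
move=> Qh Qc g0 hg d0 hleaf hQ.
apply/eqP; rewrite -subr_eq0 -cmod_eq0; apply/eqP/le_anti; rewrite cmod_ge0 andbT.
apply/ler_addgt0Pr => r r0; rewrite add0r.
pose K := (`|xi| + 1) ^+ e + (`|xi0| + 1) ^+ e.
have x1 : 0 < `|xi| + 1 by rewrite ltr_wpDl.
have x2 : 0 < `|xi0| + 1 by rewrite ltr_wpDl.
have K0 : 0 < K by rewrite addr_gt0 // exprn_gt0.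
have [rho rho0 hrho] := hQ _ (divr_gt0 (divr_gt0 r0 (ltr0n R 3)) K0).
have curve (x : 'rV[R]_n) (r' : R) : 0 < r' -> exists2 d' : R, 0 < d' &
    forall t, 0 < t < d' -> `|t^-1 *: g (t *: x) - x| < r'.
  move=> r'0; have c1 : 0 < `|x| + 1 by rewrite ltr_wpDl.
  have [d' d'0 hd'] := hg.2 (r' / 2 / (`|x| + 1)) ltac:(by rewrite !divr_gt0).
  exists (d' / (`|x| + 1)) => [|t /andP[t0 td]]; first by rewrite divr_gt0.
  have tx : `|t *: x - 0| < d'.
    rewrite subr0 normrZ (gtr0_norm t0); apply: le_lt_trans (_ : t * (`|x| + 1) < d').
      by rewrite ler_pM2l // lerDl.
    by rewrite -ltr_pdivlMr.
  have := hd' _ tx; rewrite g0 !subr0 => H.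
  have -> : t^-1 *: g (t *: x) - x = t^-1 *: (g (t *: x) - t *: x).
    by rewrite scalerBr scalerA mulVf ?scale1r // gt_eqF.
  have ti : 0 < t^-1 by rewrite invr_gt0.
  rewrite normrZ (gtr0_norm ti) mulrC ltr_pdivrMr //; apply: (le_lt_trans H).
  rewrite normrZ (gtr0_norm t0) mulrCA mulrC ltr_pM2r // mulrAC ltr_pdivrMr //.
  have := normr_ge0 x; nra.
have near (x : 'rV[R]_n) : exists2 d' : R, 0 < d' & forall t, 0 < t < d' ->
    cmod (Q (t^-1 *: g (t *: x)) - Q x) <= r / 3 /\ `|t^-1 *: g (t *: x)| <= `|x| + 1.
  have [cR cI] := Qc x; have r6 : 0 < r / 6 by rewrite divr_gt0.
  have [a a0 ha] := cR _ r6; have [b b0 hb] := cI _ r6.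
  have [d' d'0 hd'] := curve x (Num.min (Num.min a b) 1) ltac:(by rewrite !lt_min a0 b0 ltr01).
  exists d' => // t /hd'; rewrite !lt_min => /andP[/andP[/ha H1 /hb H2] H3]; split.
    apply: (le_trans (le_cmod _)); rewrite ReD ImD ReN ImN; lra.
  have := ler_normD (t^-1 *: g (t *: x) - x) x; rewrite subrK; lra.
have [d1 d10 h1] := near xi; have [d2 d20 h2] := near xi0.
pose t := Num.min (Num.min d (Num.min d1 d2)) (Num.min (rho / (`|xi| + 1)) (rho / (`|xi0| + 1))) / 2.
have t0 : 0 < t by rewrite divr_gt0 // !lt_min d0 d10 d20 !divr_gt0.
have : t < Num.min (Num.min d (Num.min d1 d2)) (Num.min (rho / (`|xi| + 1)) (rho / (`|xi0| + 1))).
  by rewrite /t; move: t0; rewrite /t; lra.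
rewrite !lt_min => /andP[/andP[td /andP[td1 td2]] /andP[tr1 tr2]]; clearbody t.
have [A1 A2] := h1 t ltac:(by rewrite t0 td1); have [B1 B2] := h2 t ltac:(by rewrite t0 td2).
have L := hleaf t ltac:(by rewrite t0 td).
have gE x : g (t *: x) = t *: (t^-1 *: g (t *: x)) by rewrite scalerA mulfV ?scale1r // gt_eqF.
set a := t^-1 *: g (t *: xi) in A1 A2; set b := t^-1 *: g (t *: xi0) in B1 B2.
have na : `|t *: a| <= t * (`|xi| + 1) by rewrite normrZ (gtr0_norm t0) ler_pM2l.
have nb : `|t *: b| <= t * (`|xi0| + 1) by rewrite normrZ (gtr0_norm t0) ler_pM2l.
have ga : `|t *: a| < rho by apply: (le_lt_trans na); rewrite -ltr_pdivlMr.
have gb : `|t *: b| < rho by apply: (le_lt_trans nb); rewrite -ltr_pdivlMr.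
have L' : leaf (t *: a) (t *: b) by rewrite /a /b -!gE.
clearbody a b.
have := hrho _ _ ga gb L'; rewrite !Qh -mulrBr cmodM cmod_real.
have te : 0 < t ^+ e by rewrite exprn_gt0.
rewrite (gtr0_norm te) => H.
have H2 : t ^+ e * cmod (Q a - Q b) <= t ^+ e * (r / 3).
  apply: (le_trans H); apply: (@le_trans _ _ (r / 3 / K * (t ^+ e * K))).
    rewrite ler_wpM2l ?divr_ge0 ?(ltW r0) ?(ltW K0) // /K mulrDr -!exprMn.
    by apply: lerD; rewrite lerXn2r ?nnegrE ?mulr_ge0 ?(ltW t0) ?(ltW x1) ?(ltW x2).
  by rewrite mulrCA mulfVK ?gt_eqF.
rewrite ler_pM2l // in H2.
have -> : Q xi - Q xi0 = (Q a - Q b) - (Q a - Q xi) + (Q b - Q xi0).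
  by move: (Q xi) (Q xi0) (Q a) (Q b) => *; ring.
apply: (le_trans (cmodD _ _)); have := cmodD (Q a - Q b) (- (Q a - Q xi)); rewrite cmodN; lra.
Qed.

(** * Comparison of two foliations *)

Lemma Dk_sum n k (A : set 'rV[R]_n) I (s : seq I) (f : I -> 'rV[R]_n -> R) (c : I -> R) :
  (forall i, Dk k A (f i)) -> Dk k A (fun x => \sum_(i <- s) c i * f i x).
Proof.
move=> h; elim: s => [|i s ih].
  by have := Ck_Dk (@Ck_cst _ _ k _ A 0); congr Dk; apply/funext => x; rewrite big_nil.
have := Dk_lin2 (c i) 1 (h i) ih; congr Dk; apply/funext => x.
by rewrite big_cons mul1r.
Qed.

Lemma cDk_sub n k (A : set 'rV[R]_n) (f g : 'rV[R]_n -> C) :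
  cDk k A f -> cDk k A g -> cDk k A (fun x => f x - g x).
Proof.
move=> [h1 h2] [h3 h4]; split.
  have := Dk_lin2 1 (-1) h1 h3; congr Dk; apply/funext => x; rewrite ReD ReN; ring.
have := Dk_lin2 1 (-1) h2 h4; congr Dk; apply/funext => x; rewrite ImD ImN; ring.
Qed.

Lemma cCk_cDk n k l (A : set 'rV[R]_n) (f : 'rV[R]_n -> C) :
  (k <= l)%N -> cCk l A f -> cDk k A f.
Proof. by move=> kl [h1 h2]; split; apply: Ck_Dk; exact: Ck_le kl _. Qed.

Lemma times_differentiable_cDk n m p k (A : set 'rV[R]_n) (f : 'rV[R]_n -> 'rV[R]_m)
    (T : 'M[C]_(p, m)) j :
  times_differentiable k A f -> cDk k A (fun x => Y T (f x) j).
Proof.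
move=> hf; have h i := times_differentiable_Dk i hf; split.
  have := Dk_sum (index_enum 'I_m) (fun i => Re (T j i)) h; congr Dk; apply/funext => x.
  rewrite ecoordE; elim/big_rec2: _ => // i a b _ ->.
  by rewrite ReD ReM Re_real Im_real mul0r subr0 mulrC.
have := Dk_sum (index_enum 'I_m) (fun i => Im (T j i)) h; congr Dk; apply/funext => x.
rewrite ecoordE; elim/big_rec2: _ => // i a b _ ->.
by rewrite ImD ImM Re_real Im_real mul0r addr0 mulrC.
Qed.

Lemma tangent_order n nu (A : set 'rV[R]_n) (U : 'rV[R]_n -> 'rV[R]_nu) (T : 'M[C]_nu)
   (W : 'M[C]_(nu, n)) j :
  metric_open A -> A 0 -> U 0 = 0 -> (exists K, strict_diff U 0 K) -> T *m complexify (Jac U 0) = W ->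
  cDk 2 A (fun x => Y T (U x) j) -> cbigO 2 (fun x => Y T (U x) j - Y W x j).
Proof.
move=> oA A0 U0 [K hK] TW hT.
have hKf := strict_diff_frechet_diff hK; have KE := jacobian_of_frechet_diff hKf.
have TK v : ecoord T (K v) = ecoord W v by rewrite KE (ecoord_comp TW).
have [t1 t2] : cDk 2 A (fun x => Y T (U x) j - Y W x j).
  apply: cDk_sub => //; apply: (cCk_cDk (leqnn 2)); apply: cCk_ecoord; exact/Ck_lin/bounded_linear_id.
have zero (P : C -> R) : {morph P : a b / a + b} -> {morph P : a / - a} ->
    bounded_linear (fun z => P (Y T z j)) -> bounded_linear (fun x => P (Y W x j)) ->
    frechet_diff (fun x => P (Y T (U x) j - Y W x j)) 0 (fun=> 0).
  move=> PD PN b1 b2; have d1 := frechet_diff_linl b1 hKf.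
  have d2 : frechet_diff (fun x => - P (Y W x j)) 0 (fun v => - P (Y W v j)).
    apply/strict_diff_frechet_diff/bounded_linear_strict_diff; have := bounded_linear_scale (-1) b2.
    by congr bounded_linear; apply/funext => v; rewrite /= scaleN1r.
  have := frechet_diff_add d1 d2.
  have -> : (fun v => P (Y T (K v) j) + - P (Y W v j)) = fun=> 0.
    by apply/funext => v; rewrite TK subrr.
  by congr frechet_diff; apply/funext => x; rewrite PD PN.
have f0 : Y T (U 0) j - Y W 0 j = 0 by rewrite U0 !ecoord0 !mxE subrr.
apply: bigO_cbigO; apply: (zero_derivative_order oA A0) => //.
- by rewrite f0.
- by apply: zero; [exact: ReD|exact: ReN|exact: bounded_linear_ecoord_Re..].
- by rewrite f0.
- by apply: zero; [exact: ImD|exact: ImN|exact: bounded_linear_ecoord_Im..].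
Qed.

Lemma bigO_sum (V : normedModType R) d I (s : seq I) (f : I -> V -> R) :
  (forall i, bigO d (f i)) -> bigO d (fun x => \sum_(i <- s) f i x).
Proof.
move=> h; elim: s => [|i s ih].
  by exists 0 => //; exists 1 => // x _; rewrite big_nil normr0 mul0r.
by have := bigOD (h i) ih; congr bigO; apply/funext => x; rewrite big_cons.
Qed.

Lemma cbigO_uniform (V : normedModType R) d p (f : 'I_p -> V -> C) : (forall i, cbigO d (f i)) ->
  exists2 c : R, 0 <= c & exists2 e : R, 0 < e &
    forall x, `|x| < e -> \sum_i cmod (f i x) <= c * `|x| ^+ d.
Proof.
move=> h; have [c c0 [e e0 he]] := bigO_sum (index_enum 'I_p) h.
exists c => //; exists e => // x /he; apply: le_trans; exact: ler_norm.
Qed.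

Lemma cmod_perturb (a b z : C) (X1 X2 Z : R) :
  cmod a <= X1 -> cmod b <= X2 -> cmod (a - b + z) <= Z -> cmod z <= Z + X1 + X2.
Proof.
move=> ha hb hz; have -> : z = (a - b + z) - a + b by ring.
apply: (le_trans (cmodD _ _)); have := cmodD (a - b + z) (- a); rewrite cmodN; lra.
Qed.

Section TwoFoliations.
Context (n nu : nat) (le_nu : (nu <= n)%N) (r sigma : nat) (V : 'M[C]_n) (D : set 'rV[R]_n)
  (F L : 'rV[R]_n -> 'rV[R]_n) (mu : 'I_n -> C) (U U' : 'rV[R]_n -> 'rV[R]_nu)
  (S S' : 'rV[R]_nu -> 'rV[R]_nu) (T T' : 'M[C]_nu).
Local Notation iota := (widen_ord le_nu).
Local Notation u j x := (Y T (U x) j).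
Local Notation w j x := (Y T' (U' x) j).
Context (uV : V \in unitmx) (oD : metric_open D) (D0 : D 0) (F0 : F 0 = 0) (hF : Ck 2 setT F)
  (hL : strict_diff F 0 L) (hmu : forall x k, Y V (L x) k = mu k * Y V x k)
  (hs : (2 <= sigma <= r)%N)
  (hres : forall (j : 'I_nu) (m : mpoly.multinom n), (2 <= mpoly.mdeg m < sigma)%N ->
     \prod_k mu k ^+ m k = mu (iota j) -> forall k : 'I_n, (nu <= k)%N -> m k = 0%N)
  (U0 : U 0 = 0) (hU : Ck r D U) (fU : row_free (Jac U 0)) (invU : invariance_equation F U S)
  (uT : T \in unitmx) (TU : T *m complexify (Jac U 0) = rowsub iota V)
  (U'0 : U' 0 = 0) (sU' : forall x, D x -> exists K, strict_diff U' x K)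
  (hU' : times_differentiable sigma D U') (fU' : row_free (Jac U' 0))
  (invU' : invariance_equation F U' S')
  (uT' : T' \in unitmx) (TU' : T' *m complexify (Jac U' 0) = rowsub iota V).

Let mu' k := mu (iota k).

Let sU x : D x -> exists K, strict_diff U x K.
Proof.
move=> Dx; have r1 : (1 <= r)%N by case/andP: hs => s2 /(leq_trans s2)/ltnW.
by have [f1 h1 _] := Ck_le r1 hU; exists (fun v => f1 (x, v)); exact: h1.
Qed.

Let WE x j : Y (rowsub iota V) x j = Y V x (iota j).
Proof. by rewrite !ecoordE; apply: eq_bigr => l _; rewrite [rowsub _ _ _ _]mxE. Qed.

Let hmuW x j : Y (rowsub iota V) (L x) j = mu' j * Y (rowsub iota V) x j.
Proof. by rewrite !WE hmu. Qed.

Let w_strict := conjugate_strict oD D0 U'0 sU' fU' F0 hL invU' uT' TU' hmuW.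

Let u_cCk j : cCk r D (fun x => u j x).
Proof. exact: cCk_ecoord. Qed.

Let u2 j : cbigO 2 (fun x => u j x - Y V x (iota j)).
Proof.
have r2 : (2 <= r)%N by case/andP: hs; exact: leq_trans.
have := tangent_order (j := j) oD D0 U0 (sU D0) TU (cCk_cDk r2 (u_cCk j)).
by apply: cbigO_ext => x; rewrite WE.
Qed.

Let w_cDk j : cDk sigma D (fun x => w j x).
Proof. exact: times_differentiable_cDk. Qed.

Let cDk_le k l f : (k <= l)%N -> cDk l D f -> cDk k D f.
Proof. by move=> kl [h1 h2]; split; exact: Dk_le kl _. Qed.

Let w2 j : cbigO 2 (fun x => w j x - Y V x (iota j)).
Proof.
have s2 : (2 <= sigma)%N by case/andP: hs.
have := tangent_order (j := j) oD D0 U'0 (sU' D0) TU' (cDk_le s2 (w_cDk j)).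
by apply: cbigO_ext => x; rewrite WE.
Qed.

Let leaf_image : exists2 rho : R, 0 < rho & forall x x0, `|x| < rho -> `|x0| < rho ->
  U x = U x0 -> U (F x) = U (F x0).
Proof.
have [d d0 hd] := (near0P _).1 invU; exists d => // x x0 /hd -> /hd ->.
by move=> ->.
Qed.

(** On a leaf of [U] the polynomial in [u] cancels in differences, so the
    linearized dynamics applies to [p] up to higher order;
    [p(mu y) - mu_j p(y)] is then constant along tangent leaves.  It therefore
    has no monomial with transverse coordinates, and such a monomial in [p]
    would be resonant. *)
Let transverse_part e (phi : 'I_nu -> mpoly.mpoly nu C) (p : 'I_nu -> mpoly.mpoly n C) :
  (2 <= e < sigma)%N ->
  (forall j, cbigO e (fun x => w j x - mpoly.meval (fun k => u k x) (phi j))) ->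
  (forall j, homp e (p j)) ->
  (forall j, cbigO e.+1 (fun x => w j x - mpoly.meval (fun k => u k x) (phi j)
      - mpoly.meval (ecoord V x 0) (p j))) ->
  forall j m (k : 'I_n), m \in mpoly.msupp (p j) -> (nu <= k)%N -> m k = 0%N.
Proof.
move=> he oE hp oE1 j m k hm nk.
pose E j x := w j x - mpoly.meval (fun k => u k x) (phi j).
pose c m := mpoly.mcoeff m (p j) * (mono mu m - mu' j).
(* The polynomial [p(mu y) - mu_j p(y)]. *)
pose Q x := \sum_(m <- mpoly.msupp (p j)) c m * mono (ecoord V x 0) m.
have Q_cCk : cCk 0 setT Q.
  apply: cCk_sum => m'; apply: cCk_scale; apply: cCk_prod => i; apply: cCk_exp.
  by apply: cCk_ecoord; exact/Ck_lin/bounded_linear_id.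
have Q_hom (t : R) x : Q (t *: x) = real_complex R (t ^+ e) * Q x.
  rewrite /Q mulr_sumr; rewrite big_seq_cond [RHS]big_seq_cond; apply: eq_bigr => m' /andP[hm' _].
  rewrite mulrCA; congr (_ * _); rewrite /mono -(hp j m' hm') mpoly.mdegE.
  have -> : real_complex R (t ^+ (\sum_i m' i)) = \prod_i real_complex R t ^+ m' i.
    by rewrite prodrXr rmorphXn.
  rewrite -big_split; apply: eq_bigr => i _; rewrite ecoordZ mxE exprMn.
  by [].
have oH : cbigO e.+1 (fun x => E j (F x) - mu' j * E j x - Q x).
  have o1 := cbigO_comp (strict_diff_frechet_diff hL) F0 (oE1 j).
  have o2 := cbigO_scale (mu' j) (oE1 j).
  have o3 : cbigO e.+1 (fun x => \sum_(m <- mpoly.msupp (p j)) mpoly.mcoeff m (p j) *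
      (mono (ecoord V (F x) 0) m - mono mu m * mono (ecoord V x 0) m)).
    under [fun x => _]funext => x do rewrite big_seq_cond.
    apply: cbigO_sum => m' /andP[hm' _]; apply: cbigO_scale.
    have := cbigO_prod_linear m' (@metric_openT _ _) I F0 hF (strict_diff_frechet_diff hL) hmu.
    by rewrite (hp j m' hm').
  apply: cbigO_ext (cbigOD (cbigOB o1 o2) o3) => x; rewrite -/(E j (F x)) -/(E j x).
  have -> : Q x = \sum_(m <- mpoly.msupp (p j)) mpoly.mcoeff m (p j) * (mono mu m * mono (ecoord V x 0) m)
      - mu' j * mpoly.meval (ecoord V x 0) (p j).
    rewrite mpoly.mevalE mulr_sumr -sumrB; apply: eq_bigr => m' _; rewrite /c -/(mono _ m').
    by move: (mpoly.mcoeff m' _) (mono mu m') (mono _ m') (mu' j) => *; ring.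
  have -> : \sum_(m <- mpoly.msupp (p j)) mpoly.mcoeff m (p j) *
      (mono (ecoord V (F x) 0) m - mono mu m * mono (ecoord V x 0) m) =
      mpoly.meval (ecoord V (F x) 0) (p j) -
      \sum_(m <- mpoly.msupp (p j)) mpoly.mcoeff m (p j) * (mono mu m * mono (ecoord V x 0) m).
    by rewrite mpoly.mevalE -sumrB; apply: eq_bigr => m' _; rewrite mulrBr.
  have alg (a1 a2 b1 b2 l s : C) : a1 - a2 - l * (b1 - b2) + (a2 - s) = a1 - l * b1 - (s - l * b2) by ring.
  exact: alg.
have Qleaf xi xi0 : xi *m (Jac U 0)^T = xi0 *m (Jac U 0)^T -> Q xi = Q xi0.
  move=> hxi; have [K0 hK0] := sU D0; have K0E := jacobian_of_frechet_diff (strict_diff_frechet_diff hK0).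
  have {hK0} hU0 : strict_diff U 0 (fun v => v *m (Jac U 0)^T) by apply: strict_diff_ext hK0 _.
  have fuJ : row_full (Jac U 0)^T by move: fU; rewrite /row_full mxrank_tr.
  have BJ := mulVpmx fuJ.
  have [GJ [g [d [rho [[d0 rho0 hg1 hg2 hg3] g0 hg4 hg5]]]]] := straighten oD D0 U0 sU hU0 BJ.
  pose t0 := d / (`|xi| + `|xi0| + 1).
  have n1 : 0 < `|xi| + `|xi0| + 1 by rewrite ltr_wpDl // addr_ge0.
  have t00 : 0 < t0 by rewrite divr_gt0.
  apply: (leaf_leading (leaf := fun x x0 => U x = U x0) Q_hom _ g0 (strict_diff_frechet_diff hg5) t00).
  - by case: Q_cCk => q1 q2 x; split; [exact: q1|exact: q2].
  - move=> t /andP[t_gt0 tt0].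
    have small x : `|x| < `|xi| + `|xi0| + 1 -> `|t *: x| < d.
      move=> xs; rewrite normrZ (gtr0_norm t_gt0); apply: lt_trans (_ : t * (`|xi| + `|xi0| + 1) < d).
        by rewrite ltr_pM2l.
      by rewrite -ltr_pdivlMr.
    have s1 : `|t *: xi| < d by apply: small; have := normr_ge0 xi0; lra.
    have s2 : `|t *: xi0| < d by apply: small; have := normr_ge0 xi; lra.
    have [e1 _ _] := hg1 _ s1; have [e2 _ _] := hg1 _ s2.
    by rewrite -(GJ (g (t *: xi))) -(GJ (g (t *: xi0))) e1 e2 -!scalemxAl hxi.
  move=> eps eps0.
  have [c1 c10 [r1 r10 h1]] := oH.
  have [c2 c20 [r2 r20 h2]] := cbigO_uniform oE.
  have [r3 r30 h3] := w_strict (divr_gt0 (divr_gt0 eps0 (ltr0n R 2)) (ltr_wpDl c20 ltr01)).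
  have [r4 r40 h4] := leaf_image.
  have c11 : 0 < c1 + 1 by rewrite ltr_wpDl.
  exists (Num.min (Num.min (Num.min r1 r2) (Num.min r3 r4)) (eps / 2 / (c1 + 1))).
    by rewrite !lt_min r10 r20 r30 r40 !divr_gt0.
  move=> x x0; rewrite !lt_min => /andP[/andP[/andP[x1 x2] /andP[x3 x4]] x5].
  move=> /andP[/andP[/andP[y1 y2] /andP[y3 y4]] y5] hx.
  have hFx := h4 x x0 x4 y4 hx.
  have dE i a b : U a = U b -> E i a - E i b = w i a - w i b.
    move=> ab; rewrite /E ab; move: (mpoly.meval _ _) (Y T' (U' a) i) (Y T' (U' b) i) => *; ring.
  have H3 := h3 x x0 x3 y3 j.
  rewrite -(dE j x x0 hx) -(dE j (F x) (F x0) hFx) in H3.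
  have H2 : \sum_i cmod (w i x - w i x0) <= c2 * (`|x| ^+ e + `|x0| ^+ e).
    rewrite mulrDr; apply: le_trans (lerD (h2 x x2) (h2 x0 y2)); rewrite -big_split.
    apply: ler_sum => i _; rewrite -(dE i x x0 hx) -[X in _ <= _ + X]cmodN; exact: cmodD.
  have K (z : 'rV[R]_n) : `|z| < eps / 2 / (c1 + 1) -> c1 * `|z| ^+ e.+1 <= eps / 2 * `|z| ^+ e.
    move=> hz; rewrite exprS mulrA ler_wpM2r ?exprn_ge0 //.
    apply: (@le_trans _ _ ((c1 + 1) * `|z|)); first by rewrite ler_wpM2r // lerDl.
    by rewrite mulrC -ler_pdivlMr // ltW.
  have Hx := le_trans (le_trans (ler_norm _) (h1 x x1)) (K x x5).
  have Hx0 := le_trans (le_trans (ler_norm _) (h1 x0 y1)) (K x0 y5).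
  have H4 : eps / 2 / (c2 + 1) * \sum_i cmod (w i x - w i x0) <= eps / 2 * (`|x| ^+ e + `|x0| ^+ e).
    apply: (le_trans (ler_wpM2l _ H2)); first by rewrite !divr_ge0 ?(ltW eps0) // addr_ge0.
    rewrite mulrA ler_wpM2r ?addr_ge0 ?exprn_ge0 // mulrAC ler_pdivrMr ?ltr_wpDl //.
    by rewrite ler_wpM2l ?divr_ge0 ?(ltW eps0) // lerDl.
  have alg (a1 a2 b1 b2 q1 q2 l : C) : a1 - a2 - l * (b1 - b2) =
      (a1 - l * b1 - q1) - (a2 - l * b2 - q2) + (q1 - q2) by ring.
  have H5 := le_trans H3 H4; rewrite (alg _ _ _ _ (Q x) (Q x0)) in H5.
  by apply: (le_trans (cmod_perturb Hx Hx0 H5)); rewrite le_eqVlt; apply/orP; left; apply/eqP; field.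
apply/eqP; rewrite -[_ == _]negbK; apply/negP => mk.
have c0 : c m = 0.
  exact: (no_transverse_monomials uV uT TU (mpoly.msupp_uniq (p j)) Qleaf hm nk mk).
have lm : mono mu m = mu' j.
  apply/eqP; rewrite -subr_eq0; move/eqP: c0; rewrite mulf_eq0.
  by move: hm; rewrite mpoly.mcoeff_msupp => /negPf ->.
by move: mk; rewrite (hres (j := j) (m := m) _ lm nk) // (hp j m hm).
Qed.

Let transverse_expansion d : (d.+2 <= sigma)%N -> exists phi : 'I_nu -> mpoly.mpoly nu C,
  forall j, cbigO d.+2 (fun x => w j x - mpoly.meval (fun k => u k x) (phi j)).
Proof.
elim: d => [|d ih] ds.
  exists (fun j => mpoly.mpolyX C (mpoly.mnm1 j)) => j.
  have := cbigOB (w2 j) (u2 j); apply: cbigO_ext => x; rewrite mpoly.mevalXU.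
  by rewrite opprB addrA subrK.
have [phi hphi] := ih (ltnW ds).
have hT j : cDk d.+3 D (fun x => w j x - mpoly.meval (fun k => u k x) (phi j)).
  apply: cDk_sub; first exact: cDk_le ds (w_cDk j).
  have dr : (d.+3 <= r)%N by case/andP: hs => _; exact: leq_trans.
  by apply: (cCk_cDk dr); apply: cCk_meval => i; exact: u_cCk.
have /boolp.choice[p hp] (j : 'I_nu) : exists p : mpoly.mpoly n C, homp d.+2 p /\
    cbigO d.+3 (fun x => w j x - mpoly.meval (fun k => u k x) (phi j) - mpoly.meval (ecoord V x 0) p).
  by have [p p1 p2] := leading_homp uV oD D0 (hT j) (hphi j); exists p.
have hm := transverse_part (e := d.+2) ds hphi (fun j => (hp j).1) (fun j => (hp j).2).
exists (fun j => phi j + \sum_(m <- mpoly.msupp (p j))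
   mpoly.mcoeff m (p j) *: mpoly.mpolyX C (restr le_nu m)) => j.
have o1 : cbigO d.+3 (fun x => \sum_(m <- mpoly.msupp (p j)) mpoly.mcoeff m (p j) *
    (\prod_k ecoord V x 0 k ^+ m k - \prod_k u k x ^+ restr le_nu m k)).
  under [fun x => _]funext => x do rewrite big_seq_cond.
  apply: cbigO_sum => m /andP[hm' _]; apply: cbigO_scale.
  have := cbigO_prod_restr u2 (fun k nk => hm j m k hm' nk).
  by rewrite ((hp j).1 m hm').
apply: cbigO_ext (cbigOD (hp j).2 o1) => x.
rewrite mpoly.mevalD (raddf_sum (mpoly.meval _)) mpoly.mevalE.
under [X in _ = _ - (_ + X)]eq_bigr => m _ do rewrite /= mpoly.mevalZ mpoly.mevalX.
under [X in _ + X = _]eq_bigr => m _ do rewrite mulrBr.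
rewrite sumrB.
have alg (a b c d' : C) : a - b - c + (c - d') = a - (b + d') by ring.
exact: alg.
Qed.

(** Along the orbits of two points of a leaf of the first foliation, the
    distance of their values under the second submersion is bounded below and
    above by geometric sequences that are incompatible unless it vanishes. *)
Lemma constant_on_leaves (N : 'rV[R]_n -> R) (q : R) : eqnorm N -> 0 <= q < 1 ->
  (exists2 e : R, 0 < e & forall x, N x < e -> N (F x) <= q * N x) ->
  (forall j : 'I_nu, q ^+ sigma < cmod (mu (iota j))) ->
  exists2 rho : R, 0 < rho & forall x x0, `|x| < rho -> `|x0| < rho ->
    U x = U x0 -> U' x = U' x0.
Proof.
move=> hN hq [e0 e00 hF0] hgap; have q0 : 0 <= q by case/andP: hq.
have s2 : (2 <= sigma)%N by case/andP: hs.
have [phi] := @transverse_expansion (sigma - 2)%N ltac:(by rewrite -addn2 subnK).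
have -> : (sigma - 2).+2 = sigma by rewrite -addn2 subnK.
pose E j x := w j x - mpoly.meval (fun k => u k x) (phi j); move=> oE.
have hE j : cbigO sigma (E j) := oE j.
have [c2 c20 [r2 r20 h2]] := cbigO_uniform hE.
pose a0 := \big[Num.min/(q ^+ sigma + 1)]_j cmod (mu' j).
have ha0 : q ^+ sigma < a0.
  rewrite /a0; elim/big_ind: _ => [|x y x0 y0|j _]; [by rewrite ltrDl|by rewrite lt_min x0|exact: hgap].
have a0j j : a0 <= cmod (mu' j) by exact: bigmin_le_cond.
(* [a0] is a lower bound for the moduli; [a] lies strictly between it and [q^sigma]. *)
pose eps := (a0 - q ^+ sigma) / 2; have eps0 : 0 < eps by rewrite divr_gt0 // subr_gt0.
pose a := a0 - eps.
have aq : q ^+ sigma < a by rewrite /a /eps; lra.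
have a_gt0 : 0 < a by apply: le_lt_trans aq; exact: exprn_ge0.
have nu1 : 0 < nu%:R + 1 :> R by rewrite ltr_wpDl.
have [r3 r30 h3] := w_strict (divr_gt0 eps0 nu1).
have [r4 r40 h4] := leaf_image.
pose Delta x x0 := \sum_i cmod (w i x - w i x0).
have Delta0 x x0 : 0 <= Delta x x0 by apply: sumr_ge0 => i _; exact: cmod_ge0.
(* The differences of [w] shrink at most by the factor [a]. *)
have grow x x0 : `|x| < r3 -> `|x0| < r3 -> a * Delta x x0 <= Delta (F x) (F x0).
  move=> x3 x03; have H j : a0 * cmod (w j x - w j x0) <=
      cmod (w j (F x) - w j (F x0)) + eps / (nu%:R + 1) * Delta x x0.
    apply: (@le_trans _ _ (cmod (mu' j * (w j x - w j x0)))).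
      by rewrite cmodM ler_wpM2r ?cmod_ge0.
    have := h3 x x0 x3 x03 j; rewrite -/(Delta x x0).
    move: (w j (F x) - w j (F x0)) (mu' j * (w j x - w j x0)) => z1 z2 hz.
    have -> : z2 = z1 - (z1 - z2) by rewrite opprB addrCA subrr addr0.
    by apply: (le_trans (cmodD _ _)); rewrite cmodN lerD2l.
  have : \sum_j (a0 * cmod (w j x - w j x0)) <=
      \sum_j (cmod (w j (F x) - w j (F x0)) + eps / (nu%:R + 1) * Delta x x0) by apply: ler_sum.
  rewrite -mulr_sumr big_split /= sumr_const card_ord -/(Delta x x0) -/(Delta (F x) (F x0)).
  have H2 : (eps / (nu%:R + 1) * Delta x x0) *+ nu <= eps * Delta x x0.
    rewrite -[leLHS]mulr_natl mulrA ler_wpM2r // mulrA ler_pdivrMr // mulrC ler_wpM2l ?(ltW eps0) //.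
    by rewrite lerDl.
  rewrite /a; move: (Delta x x0) (Delta (F x) (F x0)) H2 => A B H2 H3.
  rewrite mulrBl lerBlDr; apply: (le_trans H3); by rewrite lerD2l.
have [_ _ [c c0 hc] [b b0 hb]] := hN.
have N0 x : 0 <= N x by apply: eqnorm_ge0.
pose e := Num.min (Num.min e0 1) (Num.min (r2 / b) (Num.min (r3 / b) (r4 / b))).
have e_gt0 : 0 < e by rewrite !lt_min e00 ltr01 !divr_gt0.
have hFe x : N x < e -> N (F x) <= q * N x by rewrite !lt_min => /andP[/andP[/hF0]].
have inside x : N x < e -> [/\ N x < 1, `|x| < r2, `|x| < r3 & `|x| < r4].
  rewrite !lt_min => /andP[/andP[_ ->] /andP[x2 /andP[x3 x4]]].
  by split=> //; apply: le_lt_trans (hb x) _; rewrite mulrC -ltr_pdivlMr.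
exists (e / c) => [|x x0 xe x0e hx]; first by rewrite divr_gt0.
have toN y : `|y| < e / c -> N y < e.
  by move=> ye; apply: le_lt_trans (hc y) _; rewrite mulrC -ltr_pdivlMr.
have {}xe := toN x xe; have {}x0e := toN x0 x0e.
have orb y i := iter_contr hq N0 hFe (x := y) i.
have leaf i : U (iter i F x) = U (iter i F x0).
  elim: i => [|i ih] //=; apply: h4 => //.
    by have [_ _ _] := inside _ (orb x i xe).2.
  by have [_ _ _] := inside _ (orb x0 i x0e).2.
have lower i : a ^+ i * Delta x x0 <= Delta (iter i F x) (iter i F x0).
  elim: i => [|i ih] /=; first by rewrite mul1r.
  apply: le_trans (grow _ _ _ _); last 2 first.
  - by have [] := inside _ (orb x i xe).2.
  - by have [] := inside _ (orb x0 i x0e).2.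
  by rewrite exprS -mulrA ler_pM2l.
have pt y i : N y < e -> \sum_j cmod (E j (iter i F y)) <= c2 * b ^+ sigma * (q ^+ sigma) ^+ i.
  move=> ye; have [H1 H2] := orb y i ye; have [y1 y2 _ _] := inside _ H2.
  have [y1' _ _ _] := inside _ ye.
  apply: (le_trans (h2 _ y2)); rewrite -mulrA ler_wpM2l // exprAC -exprMn.
  rewrite lerXn2r ?nnegrE ?mulr_ge0 ?exprn_ge0 ?(ltW b0) //.
  apply: (le_trans (hb _)); rewrite ler_pM2l //; apply: (le_trans H1).
  by rewrite ler_piMr ?exprn_ge0 // ltW.
have upper i : Delta (iter i F x) (iter i F x0) <= 2 * (c2 * b ^+ sigma) * (q ^+ sigma) ^+ i.
  have -> : 2 * (c2 * b ^+ sigma) * (q ^+ sigma) ^+ i =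
    c2 * b ^+ sigma * (q ^+ sigma) ^+ i + c2 * b ^+ sigma * (q ^+ sigma) ^+ i by ring.
  apply: le_trans (lerD (pt x i xe) (pt x0 i x0e)); rewrite -big_split.
  apply: ler_sum => j _ /=; rewrite -[X in _ <= _ + X]cmodN.
  apply: le_trans (cmodD _ _); rewrite /E (leaf i).
  have alg (z1 z2 z3 : C) : z1 - z3 - (z2 - z3) = z1 - z2 by ring.
  by rewrite alg.
have th : 0 <= q ^+ sigma / a < 1.
  by rewrite divr_ge0 ?exprn_ge0 ?(ltW a_gt0) //= ltr_pdivrMr // mul1r.
have D_le0 : Delta x x0 <= 0.
  apply/ler_addgt0Pr => s s0; rewrite add0r.
  have [i hi] := geo_small (2 * (c2 * b ^+ sigma)) th s0.
  apply: le_trans hi; have ai : 0 < a ^+ i by rewrite exprn_gt0.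
  apply: (@le_trans _ _ (2 * (c2 * b ^+ sigma) * (q ^+ sigma / a) ^+ i)).
    rewrite expr_div_n [leRHS]mulrA ler_pdivlMr // mulrC.
    exact: le_trans (lower i) (upper i).
  have t1 : 0 < 1 - q ^+ sigma / a by rewrite subr_gt0; case/andP: th.
  rewrite ler_pdivlMr // ler_piMr //; last by rewrite gerBl; case/andP: th.
  rewrite !mulr_ge0 ?exprn_ge0 ?(ltW b0) //; by case/andP: th.
have [c' c'0 hc'] := ecoord_norm uT'.
apply/eqP; rewrite -subr_eq0 -normr_le0; apply: (le_trans (hc' _)).
rewrite pmulr_rle0 //; apply: le_trans D_le0; apply: ler_sum => i _.
by rewrite ecoordD ecoordN !mxE.
Qed.

End TwoFoliations.

(** * Uniqueness of the foliation *)

(** The factor is the map read on a section.  Its derivative at the origin is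
    invertible because both derivatives have the same kernel there. *)
Lemma constant_same_foliation n nu (A : set 'rV[R]_n) (U U' : 'rV[R]_n -> 'rV[R]_nu) (Q : 'M[R]_nu) :
  metric_open A -> A 0 -> U 0 = 0 -> U' 0 = 0 ->
  (forall x, A x -> exists K, strict_diff U x K) -> (forall x, A x -> exists K, strict_diff U' x K) ->
  row_free (Jac U 0) -> Q \in unitmx -> Q *m Jac U 0 = Jac U' 0 ->
  (exists2 rho : R, 0 < rho & forall x x0, `|x| < rho -> `|x0| < rho -> U x = U x0 -> U' x = U' x0) ->
  same_foliation U U'.
Proof.
move=> oA A0 U0 U'0 hU hU' fU uQ hQ [rho0 rho00 hconst].
have jac (W : 'rV[R]_n -> 'rV[R]_nu) : (exists K, strict_diff W 0 K) -> strict_diff W 0 (fun v => v *m (Jac W 0)^T).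
  move=> [K hK]; apply: (strict_diff_ext hK) => v; exact: (jacobian_of_frechet_diff (strict_diff_frechet_diff hK)).
have hU0 := jac U (hU 0 A0); have hU'0 := jac U' (hU' 0 A0).
rewrite -hQ trmx_mul in hU'0; set J := (Jac U 0)^T in hU0 hU'0.
have fuJ : row_full J by move: fU; rewrite /row_full mxrank_tr.
have BJ := mulVpmx fuJ; set B := pinvmx J in BJ.
have [GJ [g [d [rho [[d0 rho_gt0 hg1 hg2 hg3] g0 hg4 hg5]]]]] := straighten oA A0 U0 hU hU0 BJ.
have [M M0 hM] := (bounded_linear_mulmx B).2; have M1 : 0 < M + 1 by rewrite ltr_wpDl.
pose D := [set z : 'rV[R]_nu | `|z| < d / (M + 1)].
have oD : metric_open D by apply: metric_open_eqnorm; exact: eqnorm_normr.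
have D0 : D 0 by rewrite /D /= normr0 divr_gt0.
have DB z : D z -> `|z *m B| < d.
  move=> Dz; apply: le_lt_trans (hM z) _; apply: (@le_lt_trans _ _ ((M + 1) * `|z|)).
    by rewrite ler_wpM2r // lerDl.
  by rewrite mulrC -ltr_pdivlMr.
have linB z : strict_diff (fun z => z *m B) z (fun z => z *m B) := bounded_linear_strict_diff z (bounded_linear_mulmx B).
(* [U'] read on the section [z |-> g (z *m B)] of [U]. *)
pose Phi z := U' (g (z *m B)).
have hPhi z : D z -> exists K, strict_diff Phi z K.
  move=> /DB hz; have [_ _ /hU'[K1 hK1]] := hg1 _ hz; have [K2 hK2] := hg4 _ hz.
  have h := strict_diff_comp (f := g) (g := fun z => z *m B) hK2 (linB z).
  eexists; exact: (strict_diff_comp (f := U') (g := fun z => g (z *m B)) hK1 h).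
have Phi0 : Phi 0 = 0 by rewrite /Phi mul0mx g0.
have dPhi0 : strict_diff Phi 0 (fun z => z *m Q^T).
  have h1 : strict_diff g (0 *m B) id by rewrite mul0mx.
  have h2 : strict_diff U' (g (0 *m B)) (fun v => v *m (J *m Q^T)) by rewrite mul0mx g0.
  have h := strict_diff_comp (f := g) (g := fun z => z *m B) h1 (linB 0).
  apply: (strict_diff_ext (strict_diff_comp (f := U') (g := fun z => g (z *m B)) h2 h)) => v /=.
  by rewrite mulmxA -(mulmxA v) BJ mulmx1.
have open0 (r : R) (p : nat) : 0 < r -> open_nbhs (0 : 'rV[R]_p) [set z | `|z| < r].
  move=> r0; split; last by rewrite /= normr0.
  by apply: opopen; apply: metric_open_eqnorm; exact: eqnorm_normr.
have uQt : Q^T \in unitmx by rewrite unitmx_tr.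
(* Normalizing the derivative to the identity allows the inverse function theorem. *)
pose P := invmx Q^T.
have linP (f : 'rV[R]_nu -> 'rV[R]_nu) z K : strict_diff f z K -> strict_diff (fun z => f z *m P) z (fun v => K v *m P).
  move=> hf; exact: (strict_diff_comp (f := fun z => z *m P) (bounded_linear_strict_diff _ (bounded_linear_mulmx P)) hf).
have hPhi1 : exists g1 d1 rho1, [/\ local_inverse (fun z => Phi z *m P) g1 D d1 rho1, g1 0 = 0,
    forall xi, `|xi| < d1 -> exists K, strict_diff g1 xi K & strict_diff g1 0 id].
  apply: inverse_function => //.
  - by rewrite Phi0 mul0mx.
  - by move=> z /hPhi[K hK]; eexists; exact: linP hK.
  - by apply: (strict_diff_ext (linP _ _ _ dPhi0)) => v; rewrite -mulmxA mulmxV // mulmx1.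
have [g1 [d1 [rho1 [[d10 rho10 i1 i2 _] g10 i3 i4]]]] := hPhi1.
have [MP MP0 hMP] := (bounded_linear_mulmx P).2; have MP1 : 0 < MP + 1 by rewrite ltr_wpDl.
have DP (z : 'rV[R]_nu) : `|z| < d1 / (MP + 1) -> `|z *m P| < d1.
  move=> Dz; apply: le_lt_trans (hMP z) _; apply: (@le_lt_trans _ _ ((MP + 1) * `|z|)).
    by rewrite ler_wpM2r // lerDl.
  by rewrite mulrC -ltr_pdivlMr.
exists Phi.
  split=> //.
    exists D; first by apply: open0; rewrite divr_gt0.
    exact: (Ck_class_C oD (strict_diff_Ck1 oD hPhi)).
  exists (fun z => g1 (z *m P)); split.
  - by rewrite mul0mx g10.
  - have [oD1 _] := open0 (d1 / (MP + 1)) nu ltac:(by rewrite divr_gt0).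
    exists [set z | `|z| < d1 / (MP + 1)]; first by apply: open0; rewrite divr_gt0.
    apply: Ck_class_C (openop oD1) _; apply: strict_diff_Ck1 (openop oD1) _ => z /= /DP /i3[K hK].
    have hP : strict_diff (fun z : 'rV[R]_nu => z *m P) z (fun z => z *m P) := bounded_linear_strict_diff z (bounded_linear_mulmx P).
    by eexists; exact: (strict_diff_comp (f := g1) (g := fun z : 'rV[R]_nu => z *m P) hK hP).
  - by apply/near0P; exists rho1 => // z /i2[].
  - apply/near0P; exists (d1 / (MP + 1)) => [|z /DP hz]; first by rewrite divr_gt0.
    have [e1 _ _] := i1 _ hz; apply: (can_inj (mulmxK (_ : P \in unitmx))) => //.
    by rewrite unitmx_inv.
have r1 : 0 < Num.min (d / (M + 1)) (rho0 / 2 / (M + 1)) by rewrite lt_min !divr_gt0.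
have [d4 d40 hd4] := strict_diff_cont hU0 (divr_gt0 r1 (ltr0n R 2)).
apply/near0P; exists (Num.min rho0 d4) => [|x]; first by rewrite lt_min rho00.
rewrite lt_min => /andP[x1 x4]; have := hd4 x; rewrite U0 !subr0 => /(_ x4) Ux.
have : `|U x| < Num.min (d / (M + 1)) (rho0 / 2 / (M + 1)).
  by apply: le_lt_trans Ux _; rewrite ltr_pdivrMr // ltr_pMr // ltr1n.
rewrite lt_min => /andP[/DB Ux1 Ux2]; have [e1 e2 _] := hg1 _ Ux1.
apply: hconst => //; last by rewrite -(GJ (g _)) e1 -mulmxA BJ mulmx1.
apply: le_lt_trans e2 _; apply: (@le_lt_trans _ _ (2 * ((M + 1) * `|U x|))).
  rewrite ler_pM2l //; apply: (le_trans (hM _)); by rewrite ler_wpM2r // lerDl.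
by rewrite mulrC -ltr_pdivlMr // mulrC -ltr_pdivlMr.
Qed.

Theorem foliation_uniqueness n nu r sigma (le_nu : (nu <= n)%N)
    (F : 'rV[R]_n -> 'rV[R]_n) (mu : 'I_n -> C) (v : 'I_n -> 'rV[C]_n)
    (U U' : 'rV[R]_n -> 'rV[R]_nu) :
  (0 < nu)%N -> class_C r [set: 'rV[R]_n] F -> F 0 = 0 ->
  (forall k, v k *m complexify (Jac F 0) = mu k *: v k) ->
  row_free (\matrix_(k < n) v k) ->
  (forall k, cmod (mu k) < 1) -> (2 <= sigma <= r)%N ->
  (beth le_nu mu < (sigma%:R)%:E)%E ->
  (forall (j : 'I_nu) (m : mpoly.multinom n), (2 <= mpoly.mdeg m < sigma)%N ->
     \prod_k mu k ^+ m k = mu (widen_ord le_nu j) -> forall k : 'I_n, (nu <= k)%N -> m k = 0%N) ->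
  (exists S, invariance_equation F U S) -> tangent_to (Estar le_nu v) U -> class_C_near0 r U ->
  (exists S, invariance_equation F U' S) -> tangent_to (Estar le_nu v) U' ->
  times_differentiable_near0 sigma U' -> same_foliation U U'.
Proof.
move=> nu0 hF F0 hv fv mu1 hs hb hres [S invU] [U0 fU tU] [D1 D1o hU].
move=> [S' invU'] [U'0 fU' tU'] [D2 D2o hU'].
have n0 : (0 < n)%N := leq_trans nu0 le_nu.
pose V := \matrix_k v k.
have uV : V \in unitmx by rewrite -row_free_unit.
have hV k : row k V *m complexify (Jac F 0) = mu k *: row k V by rewrite rowK hv.
have r2 : (2 <= r)%N by case/andP: hs; exact: leq_trans.
case: r r2 hs hF hU => // k r2 hs hF hU.
have [L [N [q [hL hmu [hN hq] [TF hFC] hgap]]]] := spectral_setting n0 hF F0 uV hV mu1 hb.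
have EV : Estar le_nu v = rowsub (widen_ord le_nu) V by apply/matrixP => i j; rewrite !mxE.
have fE : row_free (rowsub (widen_ord le_nu) V) by apply: row_free_rowsub.
rewrite EV in tU tU'.
have [T uT TU] := row_free_basis_change fE (andP tU).2.
have [T' uT' TU'] := row_free_basis_change fE (andP tU').2.
have oD1 : metric_open D1 by apply: openop; case: D1o.
have oD2 : metric_open D2 by apply: openop; case: D2o.
pose D := D1 `&` D2.
have oD : metric_open D by apply: openop; apply: openI; [case: D1o|case: D2o].
have D0 : D 0 by split; [case: D1o|case: D2o].
have CkU : Ck k.+1 D U by apply: Ck_sub (class_C_Ck oD1 hU) => x [].
have sU x : D x -> exists K, strict_diff U x K.
  move=> Dx; have [f1 h1 _] := CkU; exists (fun v => f1 (x, v)); exact: h1.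
have sU' x : D x -> exists K, strict_diff U' x K.
  move=> [_ D2x]; case: (sigma) hs hU' => [|[|s]] //= _ hU'.
  exact: (times_differentiable_strict_diff oD2 hU').
have hU'D : times_differentiable sigma D U'.
  elim: sigma {hs hb hres hgap sU'} (U') hU' => [|s ih] f //= [h1 h2].
  by split=> [x [_ /h1]//|w]; apply: ih.
have hconst := constant_on_leaves uV oD D0 F0 (Ck_le r2 TF) hL hmu hs hres U0 CkU fU invU uT TU
  U'0 sU' hU'D fU' invU' uT' TU' hN hq (contraction_Ck_contr hFC) hgap.
have JJ : (Jac U' 0 <= Jac U 0)%MS.
  rewrite -(map_submx (real_complex R)); apply: (submx_trans (andP tU').1).
  exact: (andP tU).2.
have [Q uQ hQ] := row_free_basis_change fU' JJ.
exact: (constant_same_foliation oD D0 U0 U'0 sU sU' fU uQ hQ hconst).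
Qed.

End Uniqueness.

(** * Conjugate pairings of invariant spaces *)

Lemma times_differentiable_le (R : realType) n m k l (A : set 'rV[R]_n) (f : 'rV[R]_n -> 'rV[R]_m) :
  (k <= l)%N -> times_differentiable l A f -> times_differentiable k A f.
Proof.
elim: k l f => [|k ih] [|l] f //= kl [h1 h2]; split=> // v.
exact: ih (h2 v).
Qed.

Lemma conj_pairing_of_invariant (R : realType) nu n (E : 'M[R[i]]_(nu, n)) (A : 'M[R]_n)
    (d : 'I_nu -> R[i]) :
  row_free E -> E *m complexify A = diag_mx (\row_k d k) *m E ->
  (map_mx (@conjc R) E <= E)%MS -> exists tau, conj_pairing d tau.
Proof.
move=> fE hA hE; have [M [_ MM hM]] := conjugation_matrix fE hA hE.
apply: conj_pairing_exists; apply: (diag_conj_perm (mulmx1_unit MM).2).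
rewrite -hM; congr (_ *m _).
by apply/matrixP => i j; rewrite !mxE rmorphMn.
Qed.

Theorem theorem1 (R : realType) (n nu r sigma : nat)
    (nu_gt0 : (1 <= nu)%N) (le_nu_n : (nu <= n)%N)
    (F : 'rV[R]_n -> 'rV[R]_n)
    (F_Cr : class_C r [set: 'rV[R]_n] F) (F0 : F 0 = 0)
    (mu : 'I_n -> R[i]) (v : 'I_n -> 'rV[R[i]]_n)
    (v_eigen : forall k, v k *m complexify (Jac F 0) = mu k *: v k)
    (v_basis : row_free (\matrix_(k < n) v k))
    (E_conj : (map_mx conjc (Estar le_nu_n v) <= Estar le_nu_n v)%MS)
    (mu_lt1 : forall k, Normc.normc (mu k) < 1)
    (sigma_ge2 : (2 <= sigma)%N) (sigma_le_r : (sigma <= r)%N)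
    (beth_lt : (beth le_nu_n mu < (sigma%:R)%:E)%E)
    (nonresonance : forall (j : 'I_nu) (m : 'I_n -> nat),
      (exists l : 'I_n, (nu <= l)%N /\ m l <> 0%N) ->
      (2 <= \sum_(k < n) m k <= sigma - 1)%N ->
      \prod_(k < n) mu k ^+ m k <> mu (widen_ord le_nu_n j)) :
  let E := Estar le_nu_n v in
  let mu' := fun k : 'I_nu => mu (widen_ord le_nu_n k) in
  exists U : 'rV[R]_n -> 'rV[R]_nu,
    [/\ (* existence and smoothness *)
        [/\ invariant_foliation F U, tangent_to E U & class_C_near0 r U],
        (* uniqueness *)
        forall U' : 'rV[R]_n -> 'rV[R]_nu,
          invariant_foliation F U' -> tangent_to E U' ->
          times_differentiable_near0 sigma U' -> same_foliation U U',
        (* polynomial conjugate dynamics *)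
        exists (U1 : 'rV[R]_n -> 'rV[R]_nu) (S : 'rV[R]_nu -> 'rV[R]_nu),
          representation r F E U U1 S /\ polynomial_map (sigma - 1) S &
        (* simplest form of the conjugate dynamics *)
        (exists tau, conj_pairing mu' tau) /\
        forall tau, conj_pairing mu' tau ->
        exists (U1 : 'rV[R]_n -> 'rV[R]_nu) (S : 'rV[R]_nu -> 'rV[R]_nu)
               (T : 'M[R[i]]_nu),
          [/\ representation r F E U U1 S,
              polynomial_map (sigma - 1) S,
              eigen_coordinates mu' tau S T &
              resonant_form (sigma - 1) mu' S T]].
Proof.
move=> E mu'.
have hs : (2 <= sigma <= r)%N by rewrite sigma_ge2.
have hres (j : 'I_nu) (m : mpoly.multinom n) : (2 <= mpoly.mdeg m < sigma)%N ->
    \prod_k mu k ^+ m k = mu (widen_ord le_nu_n j) -> forall k : 'I_n, (nu <= k)%N -> m k = 0%N.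
  move=> hm hprod k nk; apply/eqP; rewrite -[_ == _]negbK; apply/negP => /eqP mk.
  apply: (nonresonance j (fun k => m k)) hprod; first by exists k.
  by rewrite -mpoly.mdegE; move: hm; rewrite subn1; case: (sigma) sigma_ge2.
have fE : row_free E.
  have -> : E = rowsub (widen_ord le_nu_n) (\matrix_k v k) by apply/matrixP => i j; rewrite !mxE.
  exact: row_free_rowsub.
have hE : E *m complexify (Jac F 0) = diag_mx (\row_k mu' k) *m E.
  apply/row_matrixP => i; rewrite row_mul !rowK v_eigen mul_diag_mx.
  by apply/rowP => j; rewrite !mxE.
have [tau htau] := conj_pairing_of_invariant fE hE E_conj.
have existence tau' : conj_pairing mu' tau' -> _ :=
  normal_form_foliation nu_gt0 F_Cr F0 v_eigen v_basis E_conj mu_lt1 hs beth_lt hres (tau := tau').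
have unique := foliation_uniqueness nu_gt0 F_Cr F0 v_eigen v_basis mu_lt1 hs beth_lt hres.
have diff_sigma (U : 'rV[R]_n -> 'rV[R]_nu) : class_C_near0 r U -> times_differentiable_near0 sigma U.
  move=> [A oA hA]; exists A => //.
  exact: (times_differentiable_le sigma_le_r (class_C_times_differentiable hA)).
have [U [S [T [subU tanU CU invU [polS _ _]]]]] := existence tau htau.
have dynU : exists S, invariance_equation F U S by exists S.
exists U; split=> //.
- by move=> U' [_ dynU'] tanU' dU'; apply: unique.
- exists U, S; split=> //; split=> //.
  by apply: unique => //; exact: diff_sigma.
split; first by exists tau.
move=> tau' htau'.
have [U1 [S1 [T1 [subU1 tanU1 CU1 invU1 [polS1 eigS1 resS1]]]]] := existence tau' htau'.
exists U1, S1, T1; split=> //; split=> //.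
by apply: unique => //; [exists S1|exact: diff_sigma].
Qed.
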